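(* Fix $\rho\in(-\infty,-2)$. Let $\eta$ denote an arc-length parametrization of the whole-plane $\mathrm{SLE}_0(\rho)$ starting at $\infty$ in the direction $1$, of any conformal radius, positive orientation, and with reference point $0$ and force point $\infty$. Then $\eta$ has a lift $\tilde\eta$ to $M_0$ such that $\arg(\tilde\eta(t))\to0$ as $t\to-\infty$. The curve $\tilde\eta$ is a flow-line of $h(z)=\frac{6+\rho}{4}\arg(z)+\pi$. This further implies that $\eta$ is (as a set) the image of $\{x+iy_0:x\in(x_0,\infty)\}$, for some $y_0>0$ and $x_0\in[-\infty,\infty)$, under $z\mapsto z^{-\frac4{2+\rho}}$, where the branch is chosen so that $\arg\big((x+iy_0)^{-\frac{4}{\rho+2}}\big)\to0$ as $x\to+\infty$.
   Context: Whole-plane Loewner chain (from $\infty$, with interior point $0$). For a continuous $w:(-\infty,T)\to\mathbb R$, the whole-plane Loewner chain with driving function $e^{iw_t}$ is the family of growing closed sets $(\gamma_t)_{t<T}$ (containing a neighborhood of $\infty$'s prime end, i.e. growing from $\infty$) with conformal maps $g_t:\mathbb C\setminus\gamma_t\to\mathbb D$, $g_t(0)=0$, $g_t'(0)=e^t$, satisfying $\partial_tg_t(z)=g_t(z)\frac{e^{iw_t}+g_t(z)}{e^{iw_t}-g_t(z)}$ for $t\in(-\infty,T)$ and $g_t(z)e^{-t}\to z$ as $t\to-\infty$ uniformly on compacts. The chain considered here is generated by a curve $\gamma:(-\infty,T)\to\mathbb C$, with $\gamma_t=\gamma((-\infty,t])$. Whole-plane $\mathrm{SLE}_0(\rho)$.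 For $\rho<-2$, $T\in\mathbb R$ (the conformal radius parameter, ''conformal radius $e^T$'') and $\theta\in\mathbb R$, the whole-plane $\mathrm{SLE}_0(\rho)$ started at $\infty$ in the direction $e^{i\theta}$, of positive orientation, with reference point $0$ and force point $\infty$, is the whole-plane Loewner chain with driving function $e^{iw_t}$, $$w_t=\frac{2\rho}{\rho+2}\arcsin\big(e^{\frac{\rho+2}4(T-t)}\big)+\theta,\qquad t\in(-\infty,T).$$ Direction $1$ means $\theta=0$. $M_0=\{(r,\vartheta):r>0,\vartheta\in\mathbb R\}$ is the logarithmic Riemann surface over $\mathbb C\setminus\{0\}$ with projection $(r,\vartheta)\mapsto re^{i\vartheta}$, so that $\arg:M_0\to\mathbb R$, $(r,\vartheta)\mapsto\vartheta$, is single-valued. A $C^1$ curve $\tilde\eta$ parametrized by arc-length is a flow-line of a field $h$ if $\tilde\eta'(t)=e^{ih(\tilde\eta(t))}$ (using the local identification of $M_0$ with $\mathbb C$). The arc-length parametrization runs in the direction of growth, $t\to-\infty$ corresponding to the start at $\infty$. *)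

(* Defs.v *)
From Stdlib Require Import Reals List.
From Coquelicot Require Import Coquelicot.
Open Scope R_scope.

Definition cis (x : R) : C := (cos x, sin x).

Definition compact_set {U : UniformSpace} (Q : U -> Prop) : Prop :=
  forall (I : Type) (O : I -> U -> Prop),
    (forall i, open (O i)) ->
    (forall x, Q x -> exists i, O i x) ->
    exists l : list I, forall x, Q x -> exists i, In i l /\ O i x.

Definition conformal_onto_disk (D : C -> Prop) (g : C -> C) : Prop :=
  (forall z, D z -> @ex_derive C_AbsRing C_NormedModule g z) /\
  (forall z, D z -> Cmod (g z) < 1) /\
  (forall z1 z2, D z1 -> D z2 -> g z1 = g z2 -> z1 = z2) /\
  (forall u, Cmod u < 1 -> exists z, D z /\ g z = u).

(* Only the values [g t z] with [t < T] and [z] outside [K t] are meaningful.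
   The last field is the convergence [g t z * e^(-t) --> z] as [t --> -oo],
   uniformly on compact sets; it includes that a given compact set is
   eventually contained in the domain of [g t], i.e. that the hulls grow
   from infinity. *)
Record whole_plane_loewner_chain
    (T : R) (w : R -> R) (K : R -> C -> Prop) (g : R -> C -> C) : Prop := {
  wplc_driving : forall t, t < T -> continuous w t;
  wplc_closed : forall t, t < T -> closed (K t);
  wplc_growing : forall s t z, s <= t -> t < T -> K s z -> K t z;
  wplc_interior : forall t, t < T -> ~ K t (RtoC 0);
  wplc_conformal : forall t, t < T -> conformal_onto_disk (fun z => ~ K t z) (g t);
  wplc_zero : forall t, t < T -> g t (RtoC 0) = RtoC 0;
  wplc_deriv0 : forall t, t < T ->
    @is_derive C_AbsRing C_NormedModule (g t) (RtoC 0) (RtoC (exp t));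
  wplc_ode : forall t z, t < T -> ~ K t z ->
    @is_derive R_AbsRing C_R_NormedModule (fun s => g s z) t
      (g t z * ((cis (w t) + g t z) / (cis (w t) - g t z)))%C;
  wplc_infty : forall Q : C -> Prop, compact_set Q -> forall eps, 0 < eps ->
    Rbar_locally m_infty (fun t => forall z, Q z ->
      ~ K t z /\ Cmod (g t z * RtoC (exp (- t)) - z)%C < eps)
}.

Definition trace (gamma : R -> C) (t : R) (z : C) : Prop :=
  exists s, s <= t /\ gamma s = z.

Definition sle0_driving (rho T theta t : R) : R :=
  2 * rho / (rho + 2) * asin (exp ((rho + 2) / 4 * (T - t))) + theta.

(* [gamma], restricted to (-oo, T), is the whole-plane SLE_0(rho) from infinity
   in the direction e^(i theta), positively oriented, with reference point 0
   and force point infinity. *)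
Definition whole_plane_sle0 (rho T theta : R) (gamma : R -> C) : Prop :=
  (forall t, t < T -> continuous gamma t) /\
  exists g : R -> C -> C,
    whole_plane_loewner_chain T (sle0_driving rho T theta) (trace gamma) g.

Definition polygonal_length (eta : R -> C) (a b L : R) : Prop :=
  exists (n : nat) (p : nat -> R),
    p 0%nat = a /\ p (S n) = b /\
    (forall i, (i <= n)%nat -> p i <= p (S i)) /\
    L = sum_n (fun i => Cmod (eta (p (S i)) - eta (p i))%C) n.

Definition is_length (eta : R -> C) (a b L : R) : Prop :=
  is_lub (polygonal_length eta a b) L.

(* [eta], restricted to (-oo, S), is an arc-length parametrization, in the
   direction of growth, of [gamma] restricted to (-oo, T); [S = p_infty] is
   allowed, as the curve may have infinite length towards its end. *)
Definition arclength_parametrization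
    (T : R) (gamma : R -> C) (S : Rbar) (eta : R -> C) : Prop :=
  (exists s : R -> R,
    (forall t t', t <= t' -> t' < T -> s t <= s t') /\
    (forall u : R, Rbar_lt u S <-> exists t, t < T /\ s t = u) /\
    (forall t, t < T -> gamma t = eta (s t))) /\
  (forall a b : R, a <= b -> Rbar_lt b S -> is_length eta a b (b - a)).

Definition M0 (p : R * R) : Prop := 0 < fst p.
Definition M0_arg (p : R * R) : R := snd p.
Definition M0_proj (p : R * R) : C := (RtoC (fst p) * cis (snd p))%C.

Definition is_lift (S : Rbar) (eta : R -> C) (etat : R -> R * R) : Prop :=
  forall u : R, Rbar_lt u S ->
    M0 (etat u) /\ continuous etat u /\ M0_proj (etat u) = eta u.

Definition is_flow_line (h : R * R -> R) (S : Rbar) (etat : R -> R * R) : Prop :=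
  exists v : R -> C, forall u : R, Rbar_lt u S ->
    M0 (etat u) /\ continuous etat u /\
    @is_derive R_AbsRing C_R_NormedModule (fun s => M0_proj (etat s)) u (v u) /\
    continuous v u /\
    Cmod (v u) = 1 /\
    v u = cis (h (etat u)).

Definition sle0_field (rho : R) (z : R * R) : R :=
  (6 + rho) / 4 * M0_arg z + PI.

Definition upper_half_plane (z : C) : Prop := 0 < Im z.

(* A branch of z |-> z^a on D, with its value recorded in M0, so that its
   argument is a real number: z^a = exp (a (ln |z| + i theta z)) for a
   continuous determination theta of the argument on D. *)
Definition is_power_branch (a : R) (D : C -> Prop) (f : C -> R * R) : Prop :=
  exists theta : C -> R, forall z, D z ->
    continuous theta z /\
    z = (RtoC (Cmod z) * cis (theta z))%C /\
    f z = (Rpower (Cmod z) a, a * theta z).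

(* Main.v *)
Require Import Defs.
From Stdlib Require Import Reals List.
From Coquelicot Require Import Coquelicot.
From Stdlib Require Import ZArith Lra Lia Classical ClassicalEpsilon.
Open Scope R_scope.

(** Write [b = -(rho+2)/4], [phi = arcsin (e^(b(t-T)))], so that the driving
    function is [(2 + 1/b) phi], and let [q = g_t(z) / e^(i w_t)].  The function
    [b e^(-bt) e^(i(1+2b) phi) int_0^q zeta^(b-1) (1-zeta) (1+zeta e^(2i phi))^(-1-2b) dzeta]
    is constant along the Loewner flow, because its time derivative is the
    integral of an exact differential, and it equals [z^b].  The tip is the value
    at [q = 1]; there the same computation shows that [z^b] moves with negative
    real velocity, so it runs along a horizontal line [Im = y0], and [y0 > 0] is
    read off from the integrand for small [phi].  A point is swallowed at time [t]
    exactly when [q -> 1], which identifies the hull with the set of tips; double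
    points of [x |-> (x + i y0)^(1/b)] are discrete, so by continuity the
    generating curve is the curve of tips.  The branch of the power is controlled
    by continuous logarithms on rectangles.  Finally the unit tangent of
    [x |-> (x + i y0)^(1/b)] traversed leftwards has argument
    [(1/b - 1) arg (x + i y0) + PI]. *)

(** * Complex exponential, logarithm and derivatives along the real line *)

(** The exponent [b] need not be an integer, so [z ^ b] is multivalued and the conserved quantity
    has to be carried by a logarithm continued from [q = 0], where the normalized integral equals
    [1]. This requires that the integral vanish nowhere in the disk, and the chain itself provides
    it: each such [q] lies on some trajectory, along which the integral solves a homogeneous linear
    equation, and far back in time it is close to [1]. Exactness of the differential rests on
    [phi' = b tan phi], hence [w' = (1+2b) tan phi]: the singular point [-e^(-2i phi)] of the
    integrand then moves like a boundary point under the rotated flow, namely the image of the force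
    point. That [q -> 1] at a swallowing time comes from surjectivity of [g_t] onto the disk, which
    leaves no room for a swallowed trajectory that converges inside it. Self-intersections of the
    curve of tips are not excluded beforehand; this is why equality of the hull with a set of tips
    does not identify the parametrizations at once. *)

Definition cexp (z : C) : C := (exp (fst z) * cos (snd z), exp (fst z) * sin (snd z)).
(** [atan (y / x)] is the principal argument only in the right half-plane; this is the source of the
    conditions [0 < fst _] that accompany [clog]. *)
Definition clog (z : C) : C := (ln (Cmod z), atan (snd z / fst z)).

(** Stated by components so that [auto_derive] and the real theorems on integrals apply to each of
    them; [cder_iff] ties it to the derivative in [C_R_NormedModule]. *)
Definition cder (f : R -> C) (t : R) (l : C) : Prop :=
  is_derive (fun s => fst (f s)) t (fst l) /\ is_derive (fun s => snd (f s)) t (snd l).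

Lemma continuous_C {U : UniformSpace} (f : U -> C) (x : U) :
  continuous f x <->
  continuous (fun u => fst (f u)) x /\ continuous (fun u => snd (f u)) x.
Proof.
  split.
  - intros H; split.
    + apply (continuous_comp f fst); [exact H | destruct (f x); apply continuous_fst].
    + apply (continuous_comp f snd); [exact H | destruct (f x); apply continuous_snd].
  - intros [H1 H2].
    intros P [eps HP].
    assert (K1 := proj1 (filterlim_locally _ _) H1 eps).
    assert (K2 := proj1 (filterlim_locally _ _) H2 eps).
    unfold filtermap.
    generalize (filter_and _ _ K1 K2). apply filter_imp.
    intros u [B1 B2]; apply HP; split; assumption.
Qed.

Lemma continuous_R {U : UniformSpace} (f : U -> R) (x : U) :
  continuous f x <-> forall eps : posreal, locally x (fun u => Rabs (f u - f x) < eps).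
Proof. apply (filterlim_locally (F := locally x) f (f x)). Qed.

Lemma continuous_close (f : R -> R) (x eps : R) : continuous f x -> 0 < eps ->
  exists d, 0 < d /\ forall y, Rabs (y - x) < d -> Rabs (f y - f x) < eps.
Proof.
  intros Hf He. destruct (proj1 (continuous_R _ _) Hf (mkposreal _ He)) as [d Hd].
  exists d. split; [apply cond_pos | exact Hd].
Qed.

Lemma continuous_close_left (f : R -> R) (s0 x eps : R) : continuous f x -> 0 < eps -> s0 < x ->
  exists s, s0 <= s < x /\ Rabs (f s - f x) < eps.
Proof.
  intros Hf He H0. destruct (continuous_close f x eps Hf He) as [d [Hd Hc]].
  set (s := Rmax s0 (x - d / 2)).
  assert (s0 <= s) by apply Rmax_l. assert (x - d / 2 <= s) by apply Rmax_r.
  assert (s < x) by (unfold s; apply Rmax_lub_lt; lra).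
  exists s. split; [lra|]. apply Hc. apply Rabs_def1; lra.
Qed.

Lemma continuous_Rmult {U : UniformSpace} (f g : U -> R) (x : U) :
  continuous f x -> continuous g x -> continuous (fun u => f u * g u) x.
Proof. intros; apply (continuous_mult (K := R_AbsRing)); assumption. Qed.

Lemma continuous_Rplus {U : UniformSpace} (f g : U -> R) (x : U) :
  continuous f x -> continuous g x -> continuous (fun u => f u + g u) x.
Proof. intros; apply (continuous_plus (V := R_NormedModule)); assumption. Qed.

Lemma continuous_Rminus {U : UniformSpace} (f g : U -> R) (x : U) :
  continuous f x -> continuous g x -> continuous (fun u => f u - g u) x.
Proof. intros; apply (continuous_minus (V := R_NormedModule)); assumption. Qed.

Lemma continuous_Ropp {U : UniformSpace} (f : U -> R) (x : U) :
  continuous f x -> continuous (fun u => - f u) x.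
Proof. intros; apply (continuous_opp (V := R_NormedModule)); assumption. Qed.

Lemma continuous_pt_comp {U : UniformSpace} (h : R -> R) (f : U -> R) (x : U) :
  continuity_pt h (f x) -> continuous f x -> continuous (fun u => h (f u)) x.
Proof.
  intros Hh Hf. apply (continuous_comp f h); [exact Hf | now apply continuity_pt_filterlim].
Qed.

Lemma continuous_derivable_comp {U : UniformSpace} (h : R -> R) (f : U -> R) (x : U) :
  ex_derive h (f x) -> continuous f x -> continuous (fun u => h (f u)) x.
Proof.
  intros Hh Hf. apply (continuous_comp f h); [exact Hf | exact (ex_derive_continuous (V := R_NormedModule) h (f x) Hh)].
Qed.

Lemma continuous_Cplus {U : UniformSpace} (f g : U -> C) (x : U) :
  continuous f x -> continuous g x -> continuous (fun u => (f u + g u)%C) x.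
Proof.
  intros Hf%continuous_C Hg%continuous_C; apply continuous_C; cbn; split;
    apply continuous_Rplus; tauto.
Qed.

Lemma continuous_Copp {U : UniformSpace} (f : U -> C) (x : U) :
  continuous f x -> continuous (fun u => (- f u)%C) x.
Proof.
  intros Hf%continuous_C; apply continuous_C; cbn; split; apply continuous_Ropp; tauto.
Qed.

Lemma continuous_Cminus {U : UniformSpace} (f g : U -> C) (x : U) :
  continuous f x -> continuous g x -> continuous (fun u => (f u - g u)%C) x.
Proof. intros; apply continuous_Cplus; [|apply continuous_Copp]; assumption. Qed.

Lemma continuous_Cmult {U : UniformSpace} (f g : U -> C) (x : U) :
  continuous f x -> continuous g x -> continuous (fun u => (f u * g u)%C) x.
Proof.
  intros Hf%continuous_C Hg%continuous_C; apply continuous_C; cbn; split;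
    [apply continuous_Rminus | apply continuous_Rplus]; apply continuous_Rmult; tauto.
Qed.

Lemma continuous_RtoC {U : UniformSpace} (f : U -> R) (x : U) :
  continuous f x -> continuous (fun u => RtoC (f u)) x.
Proof. intros; apply continuous_C; cbn; split; [assumption | apply continuous_const]. Qed.

Lemma continuous_Cinv {U : UniformSpace} (f : U -> C) (x : U) :
  continuous f x -> f x <> 0%C -> continuous (fun u => (/ f u)%C) x.
Proof.
  intros Hf%continuous_C Hx; apply continuous_C.
  assert (Hn : fst (f x) ^ 2 + snd (f x) ^ 2 <> 0).
  { intros E. apply Hx. destruct (f x) as [p q]; cbn in *.
    assert (p = 0) by nra. assert (q = 0) by nra. now subst. }
  assert (Hc : continuous (fun u => / (fst (f u) ^ 2 + snd (f u) ^ 2)) x).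
  { apply (continuous_derivable_comp Rinv (fun u => fst (f u) ^ 2 + snd (f u) ^ 2)).
    - auto_derive; exact Hn.
    - apply continuous_Rplus; apply (continuous_derivable_comp (fun y => y ^ 2));
        try tauto; auto_derive; exact I. }
  unfold Cinv; cbn -[pow]; unfold Rdiv; split; apply continuous_Rmult; try exact Hc;
    try apply continuous_Ropp; tauto.
Qed.

Lemma continuous_Cdiv {U : UniformSpace} (f g : U -> C) (x : U) :
  continuous f x -> continuous g x -> g x <> 0%C -> continuous (fun u => (f u / g u)%C) x.
Proof. intros; apply continuous_Cmult; [|apply continuous_Cinv]; assumption. Qed.

Lemma continuous_cexp {U : UniformSpace} (f : U -> C) (x : U) :
  continuous f x -> continuous (fun u => cexp (f u)) x.
Proof.
  intros Hf%continuous_C; apply continuous_C; cbn; split; apply continuous_Rmult;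
    apply (continuous_derivable_comp _ (fun u => _ (f u))); try tauto; auto_derive; exact I.
Qed.

Lemma continuous_Cmod {U : UniformSpace} (f : U -> C) (x : U) :
  continuous f x -> continuous (fun u => Cmod (f u)) x.
Proof.
  intros Hf%continuous_C. unfold Cmod.
  apply (continuous_pt_comp sqrt).
  - apply continuity_pt_sqrt. apply Rplus_le_le_0_compat; apply pow2_ge_0.
  - apply continuous_Rplus; apply (continuous_derivable_comp (fun y => y ^ 2));
      try tauto; auto_derive; exact I.
Qed.

Lemma Cmod_gt_0_fst (z : C) : 0 < fst z -> 0 < Cmod z.
Proof.
  intros H. apply Cmod_gt_0. intros ->. cbn in H. lra.
Qed.

Lemma continuous_clog {U : UniformSpace} (f : U -> C) (x : U) :
  0 < fst (f x) -> continuous f x -> continuous (fun u => clog (f u)) x.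
Proof.
  intros Hp Hf; apply continuous_C; cbn; split.
  - apply (continuous_derivable_comp ln).
    + auto_derive. now apply Cmod_gt_0_fst.
    + now apply continuous_Cmod.
  - apply continuous_C in Hf. apply (continuous_derivable_comp atan).
    + auto_derive; exact I.
    + apply continuous_Rmult; [tauto|].
      apply (continuous_derivable_comp Rinv); [auto_derive; lra | tauto].
Qed.

Lemma cexp_plus (z w : C) : cexp (z + w) = (cexp z * cexp w)%C.
Proof.
  destruct z as [a b], w as [c d]; unfold cexp, Cmult; cbn.
  rewrite exp_plus, cos_plus, sin_plus. f_equal; ring.
Qed.

Lemma cexp_0 : cexp 0 = 1%C.
Proof. unfold cexp; cbn. rewrite exp_0, cos_0, sin_0. unfold RtoC. f_equal; ring. Qed.

Lemma cexp_opp (z : C) : (cexp (- z) * cexp z)%C = 1%C.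
Proof. rewrite <- cexp_plus. replace (- z + z)%C with (RtoC 0) by ring. apply cexp_0. Qed.

Lemma Cmod_cexp (z : C) : Cmod (cexp z) = exp (fst z).
Proof.
  destruct z as [a b]; unfold cexp, Cmod; cbn -[pow].
  replace ((exp a * cos b) ^ 2 + (exp a * sin b) ^ 2) with (exp a * exp a).
  - apply sqrt_square. left; apply exp_pos.
  - pose proof (sin2_cos2 b) as E; unfold Rsqr in E. nra.
Qed.

Lemma cexp_neq_0 (z : C) : cexp z <> 0%C.
Proof.
  intros E. pose proof (Cmod_cexp z) as H. rewrite E, Cmod_0 in H.
  pose proof (exp_pos (fst z)); lra.
Qed.

Lemma cexp_minus (z w : C) : cexp (z - w) = (cexp z / cexp w)%C.
Proof.
  unfold Cminus, Cdiv. rewrite cexp_plus. f_equal.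
  pose proof (cexp_opp w) as E. pose proof (cexp_neq_0 w).
  rewrite <- (Cmult_1_r (cexp (- w))), <- (Cinv_r (cexp w)) by assumption.
  rewrite Cmult_assoc, E. ring.
Qed.

Lemma cexp_real_plus (x y : R) : cexp (x, y) = (RtoC (exp x) * cis y)%C.
Proof. unfold cexp, cis, Cmult, RtoC; cbn. f_equal; ring. Qed.

Lemma cexp_eq_1 (z : C) : cexp z = 1%C -> fst z = 0 /\ exists k : Z, snd z = 2 * PI * IZR k.
Proof.
  intros E. assert (H0 : fst z = 0).
  { pose proof (Cmod_cexp z) as H. rewrite E, Cmod_1 in H.
    apply exp_inv. rewrite exp_0. now symmetry. }
  split; [exact H0|].
  unfold cexp in E. rewrite H0, exp_0, 2!Rmult_1_l in E. injection E as Ec Es.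
  (* [cos y = 1 - 2 sin^2 (y/2)] turns [cos y = 1] into a zero of the sine. *)
  assert (Hs : sin (snd z / 2) = 0).
  { pose proof (cos_2a_sin (snd z / 2)) as H. replace (2 * (snd z / 2)) with (snd z) in H by field.
    nra. }
  destruct (sin_eq_0_0 _ Hs) as [k Hk]. exists k. lra.
Qed.

Lemma cexp_clog (z : C) : 0 < fst z -> cexp (clog z) = z.
Proof.
  intros Hp. unfold cexp, clog; cbn [fst snd].
  pose proof (Cmod_gt_0_fst z Hp) as Hm.
  rewrite exp_ln by exact Hm. rewrite cos_atan, sin_atan.
  assert (E : sqrt (1 + (snd z / fst z)²) = Cmod z / fst z).
  { apply sqrt_lem_1.
    - pose proof (Rle_0_sqr (snd z / fst z)); lra.
    - apply Rlt_le. apply Rdiv_lt_0_compat; assumption.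
    - unfold Cmod. replace (sqrt (fst z ^ 2 + snd z ^ 2) / fst z * (sqrt (fst z ^ 2 + snd z ^ 2) / fst z))
        with ((sqrt (fst z ^ 2 + snd z ^ 2) * sqrt (fst z ^ 2 + snd z ^ 2)) / (fst z * fst z)) by (field; lra).
      rewrite sqrt_sqrt by (apply Rplus_le_le_0_compat; apply pow2_ge_0).
      unfold Rsqr. field. lra. }
  rewrite E. destruct z as [p q]; cbn [fst snd] in *. f_equal; field; split; lra.
Qed.

Lemma clog_real (x : R) : 0 < x -> clog (RtoC x) = RtoC (ln x).
Proof.
  intros H. unfold clog; cbn [fst snd RtoC]. rewrite Cmod_R, Rabs_pos_eq by lra.
  unfold Rdiv. rewrite Rmult_0_l, atan_0. reflexivity.
Qed.

Lemma norm_C_R (z : C) : @norm R_AbsRing C_R_NormedModule z = Cmod z.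
Proof.
  change (sqrt (Rabs (fst z) ^ 2 + Rabs (snd z) ^ 2) = Cmod z).
  unfold Cmod. now rewrite <- !Rsqr_pow2, <- !Rsqr_abs.
Qed.

Lemma Cmod_diag (z : C) : Cmod (z - z) = 0.
Proof. replace (z - z)%C with (RtoC 0) by ring. apply Cmod_0. Qed.

Lemma Cmod_minus_eq_0 (z w : C) : Cmod (z - w) = 0 -> z = w.
Proof. intros E%Cmod_eq_0. replace z with (w + (z - w))%C by ring. rewrite E. ring. Qed.

Lemma Cmod_minus_pos (z w : C) : z <> w -> 0 < Cmod (z - w).
Proof.
  intros N. destruct (Cmod_ge_0 (z - w)) as [|E]; [assumption|]. elim N. now apply Cmod_minus_eq_0.
Qed.

Lemma Cmod_le_sum (d : C) : Cmod d <= Rabs (fst d) + Rabs (snd d).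
Proof.
  replace d with (RtoC (fst d) + (0, snd d))%C at 1
    by (destruct d; unfold RtoC, Cplus; cbn; f_equal; ring).
  eapply Rle_trans; [apply Cmod_triangle|]. rewrite Cmod_R.
  replace (Cmod (0, snd d)) with (Rabs (snd d)); [lra|].
  unfold Cmod; cbn [fst snd]. replace (0 ^ 2 + snd d ^ 2) with (snd d)² by (unfold Rsqr; ring).
  now rewrite sqrt_Rsqr_abs.
Qed.

Lemma Cmod_fst_le (d : C) : Rabs (fst d) <= Cmod d.
Proof. apply Rle_trans with (2 := Rmax_Cmod d). apply Rmax_l. Qed.

Lemma Cmod_snd_le (d : C) : Rabs (snd d) <= Cmod d.
Proof. apply Rle_trans with (2 := Rmax_Cmod d). apply Rmax_r. Qed.

Lemma cder_iff (f : R -> C) (t : R) (l : C) :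
  @is_derive R_AbsRing C_R_NormedModule f t l <-> cder f t l.
Proof.
  split.
  - intros [_ H]. specialize (H t (fun P HP => HP)).
    split; (split; [apply is_linear_scal_l|]); intros x Hx;
      (assert (t = x) by (apply is_filter_lim_locally_unique; exact Hx); subst x);
      intros eps; specialize (H eps); revert H; apply filter_imp; intros y Hy;
      refine (Rle_trans _ _ _ _ Hy); rewrite norm_C_R;
      match goal with |- _ <= Cmod ?d =>
        (exact (Cmod_fst_le d) || exact (Cmod_snd_le d)) end.
  - intros [[_ H1] [_ H2]].
    specialize (H1 t (fun P HP => HP)). specialize (H2 t (fun P HP => HP)).
    split; [apply is_linear_scal_l|]. intros x Hx.
    assert (t = x) by (apply is_filter_lim_locally_unique; exact Hx); subst x.
    intros eps. assert (He : 0 < eps / 2) by (destruct eps; cbn; lra).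
    specialize (H1 (mkposreal _ He)). specialize (H2 (mkposreal _ He)).
    generalize (filter_and _ _ H1 H2). apply filter_imp. intros y [B1 B2].
    rewrite norm_C_R.
    match goal with |- Cmod ?d <= _ =>
      apply (Rle_trans _ _ _ (Cmod_le_sum d)) end.
    change (Rabs (minus (minus (fst (f y)) (fst (f t))) (scal (minus y t) (fst l)))
      <= eps / 2 * norm (minus y t)) in B1.
    change (Rabs (minus (minus (snd (f y)) (snd (f t))) (scal (minus y t) (snd l)))
      <= eps / 2 * norm (minus y t)) in B2.
    eapply Rle_trans; [apply (Rplus_le_compat _ _ _ _ B1 B2)|]. set (n := norm _). change (pos (mkposreal _ He)) with (eps / 2). lra.
Qed.

Lemma cder_continuous (f : R -> C) (t : R) (l : C) : cder f t l -> continuous f t.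
Proof.
  intros [H1 H2]; apply continuous_C; split;
    apply (ex_derive_continuous (V := R_NormedModule)); eexists; eassumption.
Qed.

Lemma cder_const (c : C) (t : R) : cder (fun _ => c) t 0%C.
Proof. split; apply (is_derive_const (K := R_AbsRing) (V := R_NormedModule)). Qed.

Lemma cder_RtoC (f : R -> R) (t l : R) : is_derive f t l -> cder (fun s => RtoC (f s)) t (RtoC l).
Proof. intros H; split; cbn; [exact H | apply (is_derive_const (K := R_AbsRing) (V := R_NormedModule))]. Qed.

Lemma cder_plus (f g : R -> C) (t : R) (l m : C) :
  cder f t l -> cder g t m -> cder (fun s => (f s + g s)%C) t (l + m)%C.
Proof.
  intros [F1 F2] [G1 G2]; split; cbn;
    apply (is_derive_plus (K := R_AbsRing) (V := R_NormedModule)); assumption.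
Qed.

Lemma cder_opp (f : R -> C) (t : R) (l : C) :
  cder f t l -> cder (fun s => (- f s)%C) t (- l)%C.
Proof.
  intros [F1 F2]; split; cbn;
    apply (is_derive_opp (K := R_AbsRing) (V := R_NormedModule)); assumption.
Qed.

Lemma cder_minus (f g : R -> C) (t : R) (l m : C) :
  cder f t l -> cder g t m -> cder (fun s => (f s - g s)%C) t (l - m)%C.
Proof. intros; apply cder_plus; [|apply cder_opp]; assumption. Qed.

Lemma cder_eq (f : R -> C) (t : R) (l m : C) : cder f t l -> l = m -> cder f t m.
Proof. now intros H <-. Qed.

Lemma cder_ext_loc (f g : R -> C) (t : R) (l : C) :
  locally t (fun s => f s = g s) -> cder f t l -> cder g t l.
Proof.
  intros E [H1 H2]; split; eapply is_derive_ext_loc; try eassumption;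
    revert E; apply filter_imp; intros s ->; reflexivity.
Qed.

Lemma cder_mult (f g : R -> C) (t : R) (l m : C) :
  cder f t l -> cder g t m -> cder (fun s => (f s * g s)%C) t (l * g t + f t * m)%C.
Proof.
  intros [F1 F2] [G1 G2]; split; cbn.
  - evar_last.
    + apply (is_derive_minus (K := R_AbsRing) (V := R_NormedModule));
      apply Derive.is_derive_mult; eassumption.
    + cbn. unfold minus, plus, opp; cbn. ring.
  - evar_last.
    + apply (is_derive_plus (K := R_AbsRing) (V := R_NormedModule));
      apply Derive.is_derive_mult; eassumption.
    + cbn. unfold plus; cbn. ring.
Qed.

Lemma is_derive_exp_cos (u v : R -> R) (t p q : R) :
  is_derive u t p -> is_derive v t q ->
  is_derive (fun s => exp (u s) * cos (v s)) t (p * exp (u t) * cos (v t) - q * exp (u t) * sin (v t)).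
Proof.
  intros F1 F2. auto_derive; [repeat split; eexists; eassumption|].
  change (fun x => u x) with u; change (fun x => v x) with v.
  rewrite (is_derive_unique _ _ _ F1), (is_derive_unique _ _ _ F2). ring.
Qed.

Lemma is_derive_exp_sin (u v : R -> R) (t p q : R) :
  is_derive u t p -> is_derive v t q ->
  is_derive (fun s => exp (u s) * sin (v s)) t (p * exp (u t) * sin (v t) + q * exp (u t) * cos (v t)).
Proof.
  intros F1 F2. auto_derive; [repeat split; eexists; eassumption|].
  change (fun x => u x) with u; change (fun x => v x) with v.
  rewrite (is_derive_unique _ _ _ F1), (is_derive_unique _ _ _ F2). ring.
Qed.

Lemma cder_cexp (f : R -> C) (t : R) (l : C) :
  cder f t l -> cder (fun s => cexp (f s)) t (l * cexp (f t))%C.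
Proof.
  intros [F1 F2]; split; cbn [cexp fst snd Cmult].
  - evar_last; [exact (is_derive_exp_cos _ _ _ _ _ F1 F2)|]. cbn. ring.
  - evar_last; [exact (is_derive_exp_sin _ _ _ _ _ F1 F2)|]. cbn. ring.
Qed.

Lemma is_derive_ln_Cmod (u v : R -> R) (t p q : R) :
  is_derive u t p -> is_derive v t q -> 0 < u t ->
  is_derive (fun s => ln (sqrt (u s ^ 2 + v s ^ 2))) t
    ((p * u t + q * v t) / (u t ^ 2 + v t ^ 2)).
Proof.
  intros F1 F2 Hp.
  assert (Hn : 0 < u t ^ 2 + v t ^ 2).
  { pose proof (pow2_ge_0 (v t)). nra. }
  assert (Hs := sqrt_lt_R0 _ Hn).
  assert (Hss := sqrt_sqrt _ (Rlt_le _ _ Hn)).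
  auto_derive.
  - cbn in Hn, Hs; repeat split; try (eexists; eassumption); auto.
  - change (fun x => u x) with u; change (fun x => v x) with v.
    rewrite (is_derive_unique _ _ _ F1), (is_derive_unique _ _ _ F2).
    cbn [pow] in *. set (s := sqrt _) in *. rewrite <- Hss. field. lra.
Qed.

Lemma is_derive_atan_div (u v : R -> R) (t p q : R) :
  is_derive u t p -> is_derive v t q -> 0 < u t ->
  is_derive (fun s => atan (v s / u s)) t
    ((q * u t - p * v t) / (u t ^ 2 + v t ^ 2)).
Proof.
  intros F1 F2 Hp.
  assert (Hn : 0 < u t ^ 2 + v t ^ 2).
  { pose proof (pow2_ge_0 (v t)). nra. }
  auto_derive.
  - repeat split; try (eexists; eassumption). lra.
  - change (fun x => u x) with u; change (fun x => v x) with v.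
    rewrite (is_derive_unique _ _ _ F1), (is_derive_unique _ _ _ F2).
    field. repeat split; nra.
Qed.

Lemma cder_clog (f : R -> C) (t : R) (l : C) :
  cder f t l -> 0 < fst (f t) -> cder (fun s => clog (f s)) t (l / f t)%C.
Proof.
  intros [F1 F2] Hp.
  assert (Hn : 0 < fst (f t) ^ 2 + snd (f t) ^ 2).
  { pose proof (pow2_ge_0 (snd (f t))). nra. }
  split; unfold clog, Cmod; cbn [fst snd].
  - evar_last; [exact (is_derive_ln_Cmod _ _ _ _ _ F1 F2 Hp)|].
    unfold Cdiv, Cinv; cbn [fst snd Cmult]; field; nra.
  - evar_last; [exact (is_derive_atan_div _ _ _ _ _ F1 F2 Hp)|].
    unfold Cdiv, Cinv; cbn [fst snd Cmult]; field; nra.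
Qed.

(** * Continuous logarithms *)

Lemma continuous_Rcontinuity_pt (f : R -> R) (x : R) : continuous f x -> continuity_pt f x.
Proof. intros H. apply continuity_pt_filterlim. exact H. Qed.

Lemma ivt_closed (f : R -> R) (x y c : R) :
  x <= y -> (forall t, x <= t <= y -> continuous f t) ->
  f x <= c <= f y \/ f y <= c <= f x -> exists t, x <= t <= y /\ f t = c.
Proof.
  intros Hxy Hc H.
  (* [IVT_gen] wants continuity on the whole line; clamping the argument to [[x, y]] supplies it
     without changing [f] there. *)
  set (g := fun t => f (Rmax x (Rmin t y))).
  assert (Hg : continuity g).
  { intros t. apply continuous_Rcontinuity_pt. unfold g.
    apply (continuous_comp (fun t => Rmax x (Rmin t y)) f).
    - apply continuity_pt_filterlim. intros e He. exists e. split; [exact He|].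
      intros u [_ Hu]. cbn in *. unfold R_dist in *.
      revert Hu. unfold Rmax, Rmin, Rabs.
      repeat (destruct Rle_dec); repeat (destruct Rcase_abs); intros; try lra.
    - apply Hc. split; [apply Rmax_l | apply Rmax_lub; [exact Hxy | apply Rmin_r]]. }
  assert (Gx : g x = f x) by (unfold g; rewrite Rmin_left, Rmax_left; auto with real).
  assert (Gy : g y = f y) by (unfold g; rewrite Rmin_left, Rmax_right; auto with real).
  destruct (IVT_gen g x y c Hg) as [t [Ht E]].
  - rewrite Gx, Gy. unfold Rmin, Rmax; repeat destruct Rle_dec; lra.
  - rewrite Rmin_left, Rmax_right in Ht by lra.
    exists t; split; [exact Ht|]. rewrite <- E. unfold g.
    rewrite Rmin_left, Rmax_right by lra. reflexivity.
Qed.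

(** Two continuous logarithms of one function differ by a continuous function with values in
    [2 pi i Z]. If its values at the ends differed, it would pass through a level half a unit away
    from an integer, which parity forbids. *)
Lemma cexp_lift_eq_aux (f g : R -> C) (x y : R) :
  x <= y -> (forall t, x <= t <= y -> continuous f t /\ continuous g t /\ cexp (f t) = cexp (g t)) ->
  (f x = g x <-> f y = g y).
Proof.
  intros Hxy H.
  assert (Hd : forall t, x <= t <= y ->
    fst (f t - g t)%C = 0 /\ exists k : Z, snd (f t - g t)%C = 2 * PI * IZR k).
  { intros t Ht. apply cexp_eq_1. destruct (H t Ht) as [_ [_ E]].
    rewrite cexp_minus, E. unfold Cdiv. apply Cinv_r, cexp_neq_0. }
  assert (Hc : forall t, x <= t <= y -> continuous (fun t => snd (f t - g t)%C) t).
  { intros t Ht. destruct (H t Ht) as [F [G _]].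
    assert (K := continuous_Cminus _ _ _ F G). apply continuous_C in K. apply K. }
  assert (E : snd (f x - g x)%C = snd (f y - g y)%C).
  { apply NNPP. intros N.
    destruct (Hd x ltac:(lra)) as [_ [k Hk]]. destruct (Hd y ltac:(lra)) as [_ [l Hl]].
    assert (Hkl : (k <> l)%Z) by (intros ->; apply N; congruence).
    pose proof PI_RGT_0 as HPI.
    assert (exists t, x <= t <= y /\ snd (f t - g t)%C = 2 * PI * (IZR k + (if ZArith_dec.Z_lt_dec k l then 1/2 else -(1/2))))
      as [t [Ht Et]].
    { apply ivt_closed; [exact Hxy | exact Hc|]. rewrite Hk, Hl.
      destruct ZArith_dec.Z_lt_dec as [L|L].
      - left. assert (IZR k + 1 <= IZR l) by (rewrite <- plus_IZR; apply IZR_le; lia). nra.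
      - right. assert (IZR l + 1 <= IZR k) by (rewrite <- plus_IZR; apply IZR_le; lia). nra. }
    destruct (Hd t Ht) as [_ [m Hm]]. rewrite Hm in Et.
    assert (Em : IZR m = IZR k + (if ZArith_dec.Z_lt_dec k l then 1/2 else -(1/2))) by nra.
    assert (E2 : IZR (2 * m) = IZR (2 * k + (if ZArith_dec.Z_lt_dec k l then 1 else -1)%Z)).
    { rewrite plus_IZR, !mult_IZR. destruct ZArith_dec.Z_lt_dec; lra. }
    apply eq_IZR in E2. destruct ZArith_dec.Z_lt_dec; lia. }
  destruct (Hd x ltac:(lra)) as [Rx _]. destruct (Hd y ltac:(lra)) as [Ry _].
  destruct (f x) as [a b], (g x) as [c d], (f y) as [a' b'], (g y) as [c' d']; cbn in *.
  split; intros Q; injection Q as -> ->; f_equal; lra.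
Qed.

Lemma cexp_lift_eq (f g : R -> C) (x y : R) :
  (forall t, Rmin x y <= t <= Rmax x y ->
     continuous f t /\ continuous g t /\ cexp (f t) = cexp (g t)) ->
  f x = g x -> f y = g y.
Proof.
  intros H E. destruct (Rle_dec x y) as [L|L].
  - rewrite Rmin_left, Rmax_right in H by lra. now apply (cexp_lift_eq_aux f g x y).
  - rewrite Rmin_right, Rmax_left in H by lra. apply (cexp_lift_eq_aux f g y x); auto; lra.
Qed.

Fixpoint Csum (n : nat) (f : nat -> C) : C :=
  match n with O => 0%C | S n => (Csum n f + f n)%C end.

Lemma continuous_Csum {U : UniformSpace} (n : nat) (f : nat -> U -> C) (x : U) :
  (forall i, (i < n)%nat -> continuous (f i) x) -> continuous (fun u => Csum n (fun i => f i u)) x.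
Proof.
  induction n; cbn; intros H; [apply continuous_const|].
  apply continuous_Cplus; [apply IHn; intros; apply H; lia | apply H; lia].
Qed.

(* The lift is the sum of the principal logarithms of the ratios between
   consecutive points of a fine subdivision of the first coordinate. *)
Lemma rectangle_log (F : R * R -> C) (al be : R) :
  (forall s t, 0 <= s <= 1 -> al <= t <= be -> continuous F (s, t) /\ F (s, t) <> 0%C) ->
  (forall t, al <= t <= be -> F (0, t) = 1%C) ->
  exists G : R * R -> C, forall s t, 0 <= s <= 1 -> al <= t <= be ->
    continuous G (s, t) /\ cexp (G (s, t)) = F (s, t) /\ G (0, t) = 0%C.
Proof.
  intros HF H0.
  (* Relative oscillation below [1/4] near each point. The bound is asked at distance [2 * d] so
     that both ends of a step shorter than [d] can be compared with one centre at distance [d]. *)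
  assert (Hloc : forall s t, exists d : posreal, 0 <= s <= 1 -> al <= t <= be ->
    forall s' t', Rabs (s' - s) < 2 * d -> Rabs (t' - t) < 2 * d ->
      Cmod (F (s', t') - F (s, t)) < Cmod (F (s, t)) / 4).
  { intros s t. destruct (classic (0 <= s <= 1 /\ al <= t <= be)) as [[Hs Ht]|N].
    2: { exists (mkposreal 1 Rlt_0_1). tauto. }
    destruct (HF s t Hs Ht) as [Hc Hn]. apply Cmod_gt_0 in Hn.
    assert (K : continuous (fun p => Cmod (F p - F (s, t))) (s, t)).
    { apply continuous_Cmod, continuous_Cminus; [exact Hc | apply continuous_const]. }
    assert (He : 0 < Cmod (F (s, t)) / 4) by lra.
    destruct (proj1 (continuous_R _ _) K (mkposreal _ He)) as [d Hd].
    assert (Hd2 : 0 < d / 2) by (destruct d; cbn; lra).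
    exists (mkposreal _ Hd2). intros _ _ s' t' Hs' Ht'. cbn in Hs', Ht'.
    specialize (Hd (s', t')). cbn in Hd.
    rewrite Cmod_diag, Rminus_0_r, Rabs_pos_eq in Hd by apply Cmod_ge_0.
    apply Hd. split; cbn.
    - change (Rabs (s' - s) < d). lra.
    - change (Rabs (t' - t) < d). lra. }
  assert (exists del : R -> R -> posreal, forall s t, 0 <= s <= 1 -> al <= t <= be ->
    forall s' t', Rabs (s' - s) < 2 * del s t -> Rabs (t' - t) < 2 * del s t ->
      Cmod (F (s', t') - F (s, t)) < Cmod (F (s, t)) / 4) as [del Hdel].
  { exists (fun s t => proj1_sig (constructive_indefinite_description _ (Hloc s t))).
    intros s t. exact (proj2_sig (constructive_indefinite_description _ (Hloc s t))). }
  destruct (compactness_value_2d 0 1 al be del) as [d Hd].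
  assert (Hratio : forall s s' t, 0 <= s <= 1 -> 0 <= s' <= 1 -> al <= t <= be ->
    Rabs (s' - s) < d -> 0 < fst (F (s', t) / F (s, t))%C).
  { intros s s' t Hs Hs' Ht Hss. apply NNPP. intros N.
    apply (Hd s t Hs Ht). intros (u & v & Hu & Hv & Hsu & Htv & Hle). apply N.
    assert (B1 := Hdel u v Hu Hv s t).
    assert (B2 := Hdel u v Hu Hv s' t).
    pose proof (cond_pos (del u v)).
    assert (Rabs (s' - u) < 2 * del u v).
    { replace (s' - u) with ((s' - s) + (s - u)) by ring.
      eapply Rle_lt_trans; [apply Rabs_triang|]. lra. }
    specialize (B1 ltac:(lra) ltac:(lra)). specialize (B2 ltac:(lra) ltac:(lra)).
    destruct (HF s t Hs Ht) as [_ Hn].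
    set (z := F (s, t)) in *. set (z' := F (s', t)) in *. set (c := F (u, v)) in *.
    assert (M1 : Cmod (z' - z) < Cmod c / 2).
    { replace (z' - z)%C with ((z' - c) + - (z - c))%C by ring.
      eapply Rle_lt_trans; [apply Cmod_triangle|]. rewrite Cmod_opp. lra. }
    assert (M2 : Cmod c < 4 / 3 * Cmod z).
    { assert (Cmod c <= Cmod z + Cmod (z - c)).
      { replace c with (z + - (z - c))%C at 1 by ring.
        eapply Rle_trans; [apply Cmod_triangle|]. rewrite Cmod_opp. lra. }
      lra. }
    assert (Hz := proj1 (Cmod_gt_0 z) Hn).
    (* [|z' - z| < |c| / 2 < 2/3 |z|], so the ratio lies in the unit disk about [1], inside the
       right half-plane. *)
    assert (M3 : Cmod (z' / z - 1) < 1).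
    { replace (z' / z - 1)%C with ((z' - z) / z)%C by (field; exact Hn).
      rewrite Cmod_div by exact Hn. apply (Rmult_lt_reg_r (Cmod z)); [exact Hz|].
      unfold Rdiv. rewrite Rmult_assoc, Rinv_l by lra. lra. }
    pose proof (Cmod_fst_le (z' / z - 1)) as M4.
    assert (M5 : Rabs (fst (z' / z - 1)%C) < 1) by lra.
    apply Rabs_def2 in M5. destruct (z' / z)%C as [p q]. cbn in *. lra. }
  destruct (INR_unbounded (/ d)) as [n Hn].
  pose proof (cond_pos d) as Hdp. pose proof (Rinv_0_lt_compat _ Hdp) as Hdi.
  assert (Hnp : 0 < INR n) by lra.
  (* The subdivision is of [[0, s]] rather than of [[0, 1]]: the number of ratios is then the same
     for all [s], so the sum is continuous in [s] and telescopes to [F (s, t)]. *)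
  set (pt := fun (i : nat) (s : R) => INR i / INR n * s).
  assert (Hpt : forall i s, (i <= n)%nat -> 0 <= s <= 1 -> 0 <= pt i s <= 1).
  { intros i s Hi Hs. unfold pt.
    assert (0 <= INR i / INR n <= 1); [|nra].
    split; [apply Rdiv_le_0_compat; [apply pos_INR | exact Hnp]|].
    apply Rle_div_l; [lra|]. rewrite Rmult_1_l. now apply le_INR. }
  exists (fun p => Csum n (fun i => clog (F (pt (S i) (fst p), snd p) / F (pt i (fst p), snd p))%C)).
  intros s t Hs Ht. cbn [fst snd].
  assert (Hstep : forall i, (i < n)%nat -> 0 < fst (F (pt (S i) s, t) / F (pt i s, t))%C).
  { intros i Hi. apply Hratio; auto with arith; try (apply Hpt; auto with arith).
    unfold pt. rewrite S_INR. replace ((INR i + 1) / INR n * s - INR i / INR n * s) with (s * / INR n) by (field; lra).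
    rewrite Rabs_pos_eq by (apply Rmult_le_pos; [lra | left; apply Rinv_0_lt_compat; lra]).
    assert (/ INR n < d).
    { rewrite <- (Rinv_inv d). apply Rinv_lt_contravar; [|exact Hn]. nra. }
    assert (0 < / INR n) by (apply Rinv_0_lt_compat; lra). nra. }
  split; [|split].
  - apply (continuous_Csum n (fun i p => clog (F (pt (S i) (fst p), snd p) / F (pt i (fst p), snd p))%C)).
    intros i Hi. apply continuous_clog; [apply Hstep, Hi|].
    assert (Hcc : forall j, (j <= n)%nat -> continuous (fun p : R * R => F (pt j (fst p), snd p)) (s, t)).
    { intros j Hj. apply (continuous_comp (fun p : R * R => (pt j (fst p), snd p)) F).
      - apply continuous_C; cbn [fst snd]. split; [|apply continuous_snd].
        apply continuous_Rmult; [apply continuous_const | apply continuous_fst].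
      - apply HF; auto. }
    apply continuous_Cdiv; try (apply Hcc; lia). apply HF; auto; apply Hpt; auto; lia.
  - assert (K : forall m, (m <= n)%nat ->
      cexp (Csum m (fun i => clog (F (pt (S i) s, t) / F (pt i s, t))%C)) = F (pt m s, t)).
    { induction m as [|m IH]; intros Hm.
      - cbn [Csum]. rewrite cexp_0. unfold pt. rewrite Rdiv_0_l, Rmult_0_l. now rewrite H0.
      - cbn [Csum]. rewrite cexp_plus, IH by lia. rewrite cexp_clog by (apply Hstep; lia).
        field. apply HF; auto. apply Hpt; auto; lia. }
    rewrite K by lia. unfold pt. replace (INR n / INR n * s) with s by (field; lra). reflexivity.
  - assert (K : forall m, Csum m (fun i => clog (F (pt (S i) 0, t) / F (pt i 0, t))%C) = 0%C).
    { induction m as [|m IH]; cbn [Csum]; [reflexivity|]. rewrite IH.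
      unfold pt. rewrite !Rmult_0_r, H0 by exact Ht.
      replace (1 / 1)%C with (RtoC 1) by (field; intros E; injection E; lra).
      rewrite clog_real by lra. rewrite ln_1. ring. }
    apply K.
Qed.

(** * Integrals depending on a parameter *)

(** Joint continuity along the compact fibre over [u0] makes [f u] uniformly close to [f u0] on
    [[0, 1]]. The parameter ranges over an arbitrary uniform space because [jfun] is needed as a
    function on [C * R]. *)
Lemma RInt_param_continuous {U : UniformSpace} (f : U -> R -> R) (u0 : U) :
  locally u0 (fun u => forall s, 0 <= s <= 1 ->
    continuous (fun p : U * R => f (fst p) (snd p)) (u, s)) ->
  continuous (fun u => RInt (f u) 0 1) u0.
Proof.
  intros Hloc.
  assert (Hint : forall u, (forall s, 0 <= s <= 1 ->
    continuous (fun p : U * R => f (fst p) (snd p)) (u, s)) -> ex_RInt (f u) 0 1).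
  { intros u Hu. apply (ex_RInt_continuous (V := R_CompleteNormedModule)). intros s Hs.
    rewrite Rmin_left, Rmax_right in Hs by lra.
    apply (continuous_comp_2 (fun _ : R => u) (fun s : R => s) f);
      [apply continuous_const | apply continuous_id | now apply Hu]. }
  assert (H0 := locally_singleton _ _ Hloc).
  apply continuous_R. intros eps.
  assert (He : 0 < eps / 4) by (destruct eps; cbn; lra).
  assert (Hd : forall s, exists d : posreal, 0 <= s <= 1 ->
    forall u s', ball u0 d u -> Rabs (s' - s) < d -> Rabs (f u s' - f u0 s) < eps / 4).
  { intros s. destruct (classic (0 <= s <= 1)) as [Hs|N].
    - destruct (proj1 (continuous_R _ _) (H0 s Hs) (mkposreal _ He)) as [d Hd].
      exists d. intros _ u s' Hu Hs'. apply (Hd (u, s')). split; assumption.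
    - exists (mkposreal 1 Rlt_0_1). tauto. }
  set (del := fun s => proj1_sig (constructive_indefinite_description _ (Hd s))).
  assert (Hdel : forall s, 0 <= s <= 1 ->
    forall u s', ball u0 (del s) u -> Rabs (s' - s) < del s -> Rabs (f u s' - f u0 s) < eps / 4).
  { intros s. exact (proj2_sig (constructive_indefinite_description _ (Hd s))). }
  destruct (compactness_value_1d 0 1 del) as [d Hcd].
  assert (Hball : locally u0 (ball u0 d)) by (exists d; auto).
  generalize (filter_and _ _ Hball Hloc). apply filter_imp. intros u [Bu Hu].
  assert (Hclose : forall s, 0 <= s <= 1 -> Rabs (f u s - f u0 s) <= eps / 2).
  { intros s Hs. apply NNPP. intros N. apply (Hcd s Hs). intros (t & Ht & Hst & Hle). apply N.
    assert (B1 : Rabs (f u s - f u0 t) < eps / 4).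
    { apply (Hdel t Ht); [|exact Hst]. eapply ball_le; [exact Hle | exact Bu]. }
    assert (B2 : Rabs (f u0 s - f u0 t) < eps / 4).
    { apply (Hdel t Ht); [|exact Hst]. apply ball_center. }
    replace (f u s - f u0 s) with ((f u s - f u0 t) - (f u0 s - f u0 t)) by ring.
    eapply Rle_trans; [apply Rabs_triang|]. rewrite Rabs_Ropp. lra. }
  assert (E : RInt (f u) 0 1 - RInt (f u0) 0 1 = RInt (fun s => f u s - f u0 s) 0 1).
  { symmetry. apply (RInt_minus (V := R_CompleteNormedModule)); auto. }
  rewrite E. apply Rle_lt_trans with ((1 - 0) * (eps / 2)).
  - apply abs_RInt_le_const; [lra | | exact Hclose].
    apply (ex_RInt_minus (V := R_NormedModule)); auto.
  - destruct eps; cbn in *; lra.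
Qed.

Lemma RInt_param_derive (f df : R -> R -> R) (t : R) :
  locally t (fun x => forall s, 0 <= s <= 1 -> is_derive (fun u => f u s) x (df x s)) ->
  (forall s, 0 <= s <= 1 ->
     locally (t, s) (fun p => is_derive (fun u => f u (snd p)) (fst p) (df (fst p) (snd p)))) ->
  (forall s, 0 <= s <= 1 -> continuous (fun p : R * R => df (fst p) (snd p)) (t, s)) ->
  locally t (fun x => forall s, 0 <= s <= 1 -> continuous (f x) s) ->
  is_derive (fun x => RInt (f x) 0 1) t (RInt (df t) 0 1).
Proof.
  intros H1 H2 H3 H4.
  assert (E : RInt (df t) 0 1 = RInt (fun s => Derive (fun u => f u s) t) 0 1).
  { apply RInt_ext. intros s Hs. rewrite Rmin_left, Rmax_right in Hs by lra.
    symmetry. apply is_derive_unique. apply (locally_singleton _ _ H1). lra. }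
  rewrite E. apply is_derive_RInt_param.
  - revert H1. apply filter_imp. intros x Hx s Hs. rewrite Rmin_left, Rmax_right in Hs by lra.
    eexists. now apply Hx.
  - intros s Hs. rewrite Rmin_left, Rmax_right in Hs by lra.
    apply continuity_2d_pt_filterlim.
    apply (continuous_ext_loc (fun p : R * R => Derive (fun z => f z (snd p)) (fst p))
      (fun p : R * R => df (fst p) (snd p)) (t, s)).
    + generalize (H2 s Hs). apply filter_imp. intros p Hp. symmetry. now apply is_derive_unique.
    + now apply H3.
  - revert H4. apply filter_imp. intros x Hx.
    apply (ex_RInt_continuous (V := R_CompleteNormedModule)). intros s Hs.
    rewrite Rmin_left, Rmax_right in Hs by lra. now apply Hx.
Qed.

Definition CInt (f : R -> C) : C := (RInt (fun s => fst (f s)) 0 1, RInt (fun s => snd (f s)) 0 1).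

Lemma CInt_param_continuous {U : UniformSpace} (f : U -> R -> C) (u0 : U) :
  locally u0 (fun u => forall s, 0 <= s <= 1 ->
    continuous (fun p : U * R => f (fst p) (snd p)) (u, s)) ->
  continuous (fun u => CInt (f u)) u0.
Proof.
  intros H. apply continuous_C; split;
    [apply (RInt_param_continuous (fun u s => fst (f u s)))
    |apply (RInt_param_continuous (fun u s => snd (f u s)))];
    revert H; apply filter_imp; intros u Hu s Hs; specialize (Hu s Hs);
    apply continuous_C in Hu; apply Hu.
Qed.

Lemma CInt_param_derive (f df : R -> R -> C) (t : R) :
  locally t (fun x => forall s, 0 <= s <= 1 -> cder (fun u => f u s) x (df x s)) ->
  (forall s, 0 <= s <= 1 ->
     locally (t, s) (fun p => cder (fun u => f u (snd p)) (fst p) (df (fst p) (snd p)))) ->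
  (forall s, 0 <= s <= 1 -> continuous (fun p : R * R => df (fst p) (snd p)) (t, s)) ->
  locally t (fun x => forall s, 0 <= s <= 1 -> continuous (f x) s) ->
  cder (fun x => CInt (f x)) t (CInt (df t)).
Proof.
  intros H1 H2 H3 H4. split;
    [apply (RInt_param_derive (fun u s => fst (f u s)) (fun u s => fst (df u s)))
    |apply (RInt_param_derive (fun u s => snd (f u s)) (fun u s => snd (df u s)))];
    try (intros s Hs; specialize (H3 s Hs); apply continuous_C in H3; apply H3);
    try (intros s Hs; generalize (H2 s Hs); apply filter_imp; intros p Hp; apply Hp).
  1, 3: revert H1; apply filter_imp; intros x Hx s Hs; apply (Hx s Hs).
  all: revert H4; apply filter_imp; intros x Hx s Hs; specialize (Hx s Hs);
    apply continuous_C in Hx; apply Hx.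
Qed.

Lemma ex_RInt_components (f : R -> C) : (forall s, 0 <= s <= 1 -> continuous f s) ->
  ex_RInt (fun s => fst (f s)) 0 1 /\ ex_RInt (fun s => snd (f s)) 0 1.
Proof.
  intros H. split; apply (ex_RInt_continuous (V := R_CompleteNormedModule)); intros s Hs;
    rewrite Rmin_left, Rmax_right in Hs by lra; specialize (H s Hs); apply continuous_C in H; apply H.
Qed.

(** Linearity and the fundamental theorem of calculus in the combination that occurs: the time
    derivative of the kernel is a constant multiple of the kernel plus an exact differential. With
    [dP = 0] it is plain linearity. *)
Lemma CInt_affine_exact (f P dP : R -> C) (al : C) :
  (forall s, 0 <= s <= 1 -> continuous f s) ->
  (forall s, 0 <= s <= 1 -> continuous dP s) ->
  (forall s, 0 <= s <= 1 -> cder P s (dP s)) ->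
  CInt (fun s => al * f s + dP s)%C = (al * CInt f + (P 1 - P 0))%C.
Proof.
  intros Hf HdP HP.
  destruct (ex_RInt_components f Hf) as [F1 F2].
  apply (RInt_correct (V := R_CompleteNormedModule)) in F1, F2.
  assert (P1 : is_RInt (fun s => fst (dP s)) 0 1 (minus (fst (P 1)) (fst (P 0)))).
  { apply (is_RInt_derive (V := R_CompleteNormedModule) (fun s => fst (P s))); intros s Hs;
      rewrite Rmin_left, Rmax_right in Hs by lra.
    - apply (HP s Hs).
    - specialize (HdP s Hs). apply continuous_C in HdP. apply HdP. }
  assert (P2 : is_RInt (fun s => snd (dP s)) 0 1 (minus (snd (P 1)) (snd (P 0)))).
  { apply (is_RInt_derive (V := R_CompleteNormedModule) (fun s => snd (P s))); intros s Hs;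
      rewrite Rmin_left, Rmax_right in Hs by lra.
    - apply (HP s Hs).
    - specialize (HdP s Hs). apply continuous_C in HdP. apply HdP. }
  unfold CInt at 1. apply injective_projections; cbn [fst snd].
  - apply is_RInt_unique.
    assert (K := is_RInt_plus _ _ _ _ _ _ (is_RInt_minus _ _ _ _ _ _ (is_RInt_scal _ _ _ (fst al) _ F1)
        (is_RInt_scal _ _ _ (snd al) _ F2)) P1).
    exact K.
  - apply is_RInt_unique.
    assert (K := is_RInt_plus _ _ _ _ _ _ (is_RInt_plus _ _ _ _ _ _ (is_RInt_scal _ _ _ (fst al) _ F2)
        (is_RInt_scal _ _ _ (snd al) _ F1)) P2).
    exact K.
Qed.

(** * The Schwarz-Christoffel integral *)

Ltac ccont := repeat
  match goal with
  | H : continuous ?f ?x |- continuous ?f ?x => exact H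
  | |- continuous (fun u => (@?f u + @?g u)%C) _ => apply (continuous_Cplus f g)
  | |- continuous (fun u => (@?f u - @?g u)%C) _ => apply (continuous_Cminus f g)
  | |- continuous (fun u => (@?f u * @?g u)%C) _ => apply (continuous_Cmult f g)
  | |- continuous (fun u => (@?f u / @?g u)%C) _ => apply (continuous_Cdiv f g)
  | |- continuous (fun u => (- @?f u)%C) _ => apply (continuous_Copp f)
  | |- continuous (fun _ => ?c) _ => apply continuous_const
  end.

Ltac cderiv := repeat
  match goal with
  | |- cder (fun u => (@?f u + @?g u)%C) _ _ => eapply (cder_plus f g)
  | |- cder (fun u => (@?f u - @?g u)%C) _ _ => eapply (cder_minus f g)
  | |- cder (fun u => (@?f u * @?g u)%C) _ _ => eapply (cder_mult f g)
  | |- cder (fun u => (- @?f u)%C) _ _ => eapply (cder_opp f)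
  | |- cder (fun _ => ?c) _ _ => apply cder_const
  | |- _ => eassumption
  end.

(* [s ^ (1/b)] extended continuously by [0]; [Rpower 0 (1/b)] would be the junk value [1]. *)
Definition root (b s : R) : R := if Rle_dec s 0 then 0 else Rpower s (/ b).

Lemma root_0 (b : R) : root b 0 = 0.
Proof. unfold root. destruct Rle_dec; lra. Qed.

Lemma root_1 (b : R) : root b 1 = 1.
Proof.
  unfold root. destruct Rle_dec; [lra|]. unfold Rpower. now rewrite ln_1, Rmult_0_r, exp_0.
Qed.

Lemma root_pos (b s : R) : 0 < s -> 0 < root b s.
Proof. intros H. unfold root. destruct Rle_dec; [lra|]. apply exp_pos. Qed.

Lemma root_ge_0 (b s : R) : 0 <= root b s.
Proof. unfold root. destruct Rle_dec; [lra|]. left; apply exp_pos. Qed.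

Lemma root_lt_1 (b s : R) : 0 < b -> s < 1 -> root b s < 1.
Proof.
  intros Hb H. unfold root. destruct Rle_dec; [lra|].
  unfold Rpower. rewrite <- exp_0. apply exp_increasing.
  assert (ln s < 0) by (rewrite <- ln_1; apply ln_increasing; lra).
  pose proof (Rinv_0_lt_compat _ Hb). nra.
Qed.

Lemma root_le_1 (b s : R) : 0 < b -> s <= 1 -> root b s <= 1.
Proof.
  intros Hb [H | ->]; [left; now apply root_lt_1 | rewrite root_1; lra].
Qed.

Lemma root_derive (b s : R) : 0 < b -> 0 < s -> is_derive (root b) s (/ b * root b s / s).
Proof.
  intros Hb Hs.
  apply (is_derive_ext_loc (fun s => Rpower s (/ b))).
  - exists (mkposreal _ Hs). intros y Hy. cbn in Hy. unfold ball, AbsRing_ball, abs, minus, plus, opp in Hy; cbn in Hy.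
    unfold root. destruct Rle_dec; [|reflexivity].
    change (Rabs (y + - s) < s) in Hy. apply Rabs_def2 in Hy. lra.
  - unfold root. destruct Rle_dec; [lra|]. unfold Rpower. auto_derive; [exact Hs|]. field. lra.
Qed.

Lemma root_continuous (b s : R) : 0 < b -> continuous (root b) s.
Proof.
  intros Hb. destruct (Rlt_dec 0 s) as [Hs|Hs].
  { apply (ex_derive_continuous (V := R_NormedModule)). eexists. now apply root_derive. }
  apply continuous_R. intros eps.
  assert (E : root b s = 0) by (unfold root; destruct Rle_dec; lra).
  rewrite E. destruct (Rlt_dec s 0) as [Hn|Hn].
  - assert (Hp : 0 < - s) by lra. exists (mkposreal _ Hp). intros y Hy.
    change (Rabs (y - s) < - s) in Hy. apply Rabs_def2 in Hy.
    unfold root. destruct Rle_dec; [|lra]. rewrite Rminus_0_r, Rabs_R0. apply cond_pos.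
  - assert (s = 0) by lra. subst s.
    (* [exp (b * ln eps)] is [eps ^ b], the point whose [1/b]-th power is [eps]. *)
    exists (mkposreal _ (exp_pos (b * ln eps))). intros y Hy.
    change (Rabs (y - 0) < exp (b * ln eps)) in Hy. rewrite Rminus_0_r in *.
    rewrite Rabs_pos_eq by apply root_ge_0.
    unfold root. destruct Rle_dec as [|L]; [apply cond_pos|].
    rewrite Rabs_pos_eq in Hy by lra.
    unfold Rpower. rewrite <- (exp_ln eps) by apply cond_pos. apply exp_increasing.
    apply ln_increasing in Hy; [|lra]. rewrite ln_exp in Hy.
    apply (Rmult_lt_reg_l b); [exact Hb|]. rewrite <- Rmult_assoc, Rinv_r by lra. lra.
Qed.

Lemma continuous_root {U : UniformSpace} (b : R) (f : U -> R) (x : U) :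
  0 < b -> continuous f x -> continuous (fun u => root b (f u)) x.
Proof. intros Hb Hf. apply (continuous_comp f (root b)); [exact Hf | now apply root_continuous]. Qed.

(** It vanishes at [m = -e^(-2i phi)], the image of the force point in the rotated coordinate. On
    the open disk, and at [1] when [|phi| < pi/2], its real part is positive, so [power] is there
    the principal branch of [base ^ (-1-2b)]. *)
Definition base (m : C) (phi : R) : C := (1 + m * cis (2 * phi))%C.
Definition power (b : R) (m : C) (phi : R) : C := cexp (RtoC (- (1 + 2 * b)) * clog (base m phi))%C.
Definition kern (b : R) (m : C) (phi : R) : C := ((1 - m) * power b m phi)%C.
(* After the substitution [zeta = s ^ (1/b) q] this is
   [b q^(-b) int_0^q zeta^(b-1) (1 - zeta) (1 + zeta e^(2 i phi))^(-1-2b) dzeta]: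
   up to an explicit factor, [z ^ b] as a Schwarz-Christoffel integral of [q]. *)
Definition jfun (b : R) (q : C) (phi : R) : C := CInt (fun s => kern b (RtoC (root b s) * q)%C phi).

Lemma continuous_cis {U : UniformSpace} (f : U -> R) (x : U) :
  continuous f x -> continuous (fun u => cis (f u)) x.
Proof.
  intros Hf; apply continuous_C; cbn; split;
    apply (continuous_derivable_comp _ f); try tauto; auto_derive; exact I.
Qed.

Lemma continuous_base {U : UniformSpace} (m : U -> C) (phi : U -> R) (x : U) :
  continuous m x -> continuous phi x -> continuous (fun u => base (m u) (phi u)) x.
Proof.
  intros Hm Hp. apply continuous_Cplus; [apply continuous_const|].
  apply continuous_Cmult; [exact Hm|]. apply continuous_cis.
  apply continuous_Rmult; [apply continuous_const | exact Hp].
Qed.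

Lemma continuous_power {U : UniformSpace} (b : R) (m : U -> C) (phi : U -> R) (x : U) :
  continuous m x -> continuous phi x -> 0 < fst (base (m x) (phi x)) ->
  continuous (fun u => power b (m u) (phi u)) x.
Proof.
  intros Hm Hp H. apply continuous_cexp, continuous_Cmult; [apply continuous_const|].
  apply continuous_clog; [exact H | now apply continuous_base].
Qed.

Lemma continuous_kern {U : UniformSpace} (b : R) (m : U -> C) (phi : U -> R) (x : U) :
  continuous m x -> continuous phi x -> 0 < fst (base (m x) (phi x)) ->
  continuous (fun u => kern b (m u) (phi u)) x.
Proof.
  intros Hm Hp H. apply continuous_Cmult; [|now apply continuous_power].
  apply continuous_Cminus; [apply continuous_const | exact Hm].
Qed.

(** [base (s q)] is the convex combination of [1] and [base q] with weights [1 - s] and [s], so the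
    right half-plane is not left along the radius. *)
Lemma base_scal (s : R) (q : C) (phi : R) :
  0 <= s <= 1 -> 0 < fst (base q phi) -> 0 < fst (base (RtoC s * q)%C phi).
Proof.
  intros Hs. unfold base, cis; destruct q as [x y]; cbn. intros H.
  set (c := cos _) in *. set (d := sin _) in *.
  replace (1 + _) with ((1 - s) + s * (1 + (x * c - y * d))) by ring.
  destruct (Rle_lt_or_eq_dec _ _ (proj2 Hs)); nra.
Qed.

Lemma base_root (b s : R) (q : C) (phi : R) :
  0 < b -> 0 <= s <= 1 -> 0 < fst (base q phi) -> 0 < fst (base (RtoC (root b s) * q)%C phi).
Proof.
  intros Hb Hs. apply base_scal. split; [apply root_ge_0 | now apply root_le_1].
Qed.

Lemma locally_pos {U : UniformSpace} (f : U -> R) (x : U) :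
  continuous f x -> 0 < f x -> locally x (fun u => 0 < f u).
Proof.
  intros Hf Hp. generalize (proj1 (continuous_R _ _) Hf (mkposreal _ Hp)).
  apply filter_imp. cbn. intros u Hu. apply Rabs_def2 in Hu. lra.
Qed.

Lemma locally_base_pos {U : UniformSpace} (m : U -> C) (phi : U -> R) (x : U) :
  continuous m x -> continuous phi x -> 0 < fst (base (m x) (phi x)) ->
  locally x (fun u => 0 < fst (base (m u) (phi u))).
Proof.
  intros Hm Hp H. apply (locally_pos (fun u => fst (base (m u) (phi u)))); [|exact H].
  assert (K := continuous_base m phi x Hm Hp). apply continuous_C in K. apply K.
Qed.

Lemma continuous_kern_root {U : UniformSpace} (b : R) (q : U -> C) (phi s : U -> R) (x : U) :
  0 < b -> continuous q x -> continuous phi x -> continuous s x ->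
  0 < fst (base (RtoC (root b (s x)) * q x)%C (phi x)) ->
  continuous (fun u => kern b (RtoC (root b (s u)) * q u)%C (phi u)) x.
Proof.
  intros Hb Hq Hp Hs H.
  apply (continuous_kern b (fun u => (RtoC (root b (s u)) * q u)%C) phi); auto.
  apply continuous_Cmult; [apply continuous_RtoC, continuous_root|]; assumption.
Qed.

Lemma jfun_continuous_prod (b : R) (p : C * R) :
  0 < b -> 0 < fst (base (fst p) (snd p)) -> continuous (fun p : C * R => jfun b (fst p) (snd p)) p.
Proof.
  intros Hb Hp.
  apply (CInt_param_continuous (fun (p : C * R) s => kern b (RtoC (root b s) * fst p)%C (snd p))).
  assert (L : locally p (fun p : C * R => 0 < fst (base (fst p) (snd p)))).
  { apply (locally_base_pos (fun p : C * R => fst p) (fun p : C * R => snd p)); auto.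
    - destruct p; apply (continuous_fst (U := C_UniformSpace)).
    - destruct p; apply (continuous_snd (U := C_UniformSpace)). }
  revert L. apply filter_imp. intros u Hu s Hs.
  apply (continuous_kern_root b (fun v : C * R * R => fst (fst v)) (fun v => snd (fst v)) snd); auto.
  - apply (continuous_comp (U := prod_UniformSpace (prod_UniformSpace C_UniformSpace R_UniformSpace) R_UniformSpace) fst fst);
      [apply continuous_fst | destruct u; apply (continuous_fst (U := C_UniformSpace))].
  - apply (continuous_comp (U := prod_UniformSpace (prod_UniformSpace C_UniformSpace R_UniformSpace) R_UniformSpace) fst snd);
      [apply continuous_fst | destruct u; apply (continuous_snd (U := C_UniformSpace))].
  - apply continuous_snd.
  - cbn [fst snd]. now apply base_root.
Qed.

Lemma continuous_jfun {U : UniformSpace} (b : R) (q : U -> C) (phi : U -> R) (x : U) :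
  0 < b -> continuous q x -> continuous phi x -> 0 < fst (base (q x) (phi x)) ->
  continuous (fun u => jfun b (q u) (phi u)) x.
Proof.
  intros Hb Hq Hp H.
  apply (continuous_comp_2 (V := C_UniformSpace) (W := R_UniformSpace) q phi (jfun b)); auto.
  now apply (jfun_continuous_prod b (q x, phi x)).
Qed.

Lemma cder_cis (f : R -> R) (t l : R) :
  is_derive f t l -> cder (fun s => cis (f s)) t (Ci * RtoC l * cis (f t))%C.
Proof.
  intros H. assert (K := cder_cexp (fun s => (0, f s)) t (0, l)).
  assert (E : forall x, cexp (0, x) = cis x).
  { intros x; unfold cexp, cis; cbn; rewrite exp_0; f_equal; ring. }
  eapply cder_ext_loc; [apply filter_forall; intros s; apply E|].
  eapply cder_eq; [apply K|].
  - split; cbn; [apply (is_derive_const (K := R_AbsRing) (V := R_NormedModule)) | exact H].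
  - rewrite E. f_equal. unfold Ci, RtoC, Cmult; cbn; f_equal; ring.
Qed.

Definition dbase (m : C) (phi : R) (dm : C) (dphi : R) : C :=
  ((dm + m * (2 * Ci * RtoC dphi)) * cis (2 * phi))%C.

Definition dkern (b : R) (m : C) (phi : R) (dm : C) (dphi : R) : C :=
  (- dm * power b m phi
   - (1 - m) * (RtoC (1 + 2 * b) * (dbase m phi dm dphi / base m phi) * power b m phi))%C.

Lemma cder_power (b : R) (m : R -> C) (phi : R -> R) (t : R) (dm : C) (dphi : R) :
  cder m t dm -> is_derive phi t dphi -> 0 < fst (base (m t) (phi t)) ->
  cder (fun u => power b (m u) (phi u)) t
    (- (RtoC (1 + 2 * b) * (dbase (m t) (phi t) dm dphi / base (m t) (phi t)) * power b (m t) (phi t)))%C.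
Proof.
  intros Hm Hp H.
  assert (Hb0 : base (m t) (phi t) <> 0%C) by (intros E; rewrite E in H; cbn in H; lra).
  assert (Hbase : cder (fun u => base (m u) (phi u)) t (dbase (m t) (phi t) dm dphi)).
  { eapply cder_eq.
    - apply cder_plus; [apply cder_const|]. apply cder_mult; [exact Hm|].
      apply cder_cis. apply (is_derive_scal phi t 2), Hp.
    - unfold dbase. rewrite RtoC_mult. ring. }
  eapply cder_eq.
  - apply cder_cexp, cder_mult; [apply cder_const|]. apply cder_clog; [exact Hbase | exact H].
  - unfold power. rewrite RtoC_opp. ring.
Qed.

Lemma cder_kern (b : R) (m : R -> C) (phi : R -> R) (t : R) (dm : C) (dphi : R) :
  cder m t dm -> is_derive phi t dphi -> 0 < fst (base (m t) (phi t)) ->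
  cder (fun u => kern b (m u) (phi u)) t (dkern b (m t) (phi t) dm dphi).
Proof.
  intros Hm Hp H. eapply cder_eq.
  - apply cder_mult; [apply cder_minus; [apply cder_const | exact Hm]|].
    now apply (cder_power b m phi t dm dphi).
  - unfold dkern. ring.
Qed.

Lemma continuous_dkern {U : UniformSpace} (b : R) (m dm : U -> C) (phi dphi : U -> R) (x : U) :
  continuous m x -> continuous dm x -> continuous phi x -> continuous dphi x ->
  0 < fst (base (m x) (phi x)) ->
  continuous (fun u => dkern b (m u) (phi u) (dm u) (dphi u)) x.
Proof.
  intros Hm Hdm Hp Hdp H.
  assert (Hb0 : base (m x) (phi x) <> 0%C) by (intros E; rewrite E in H; cbn in H; lra).
  assert (Hpow := continuous_power b m phi x Hm Hp H).
  apply continuous_Cminus; apply continuous_Cmult.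
  - now apply continuous_Copp.
  - exact Hpow.
  - apply continuous_Cminus; [apply continuous_const | exact Hm].
  - apply continuous_Cmult; [|exact Hpow].
    apply continuous_Cmult; [apply continuous_const|].
    apply continuous_Cdiv; [|now apply continuous_base|exact Hb0].
    apply continuous_Cmult.
    + apply continuous_Cplus; [exact Hdm|].
      apply continuous_Cmult; [exact Hm|].
      apply continuous_Cmult; [apply continuous_const | now apply continuous_RtoC].
    + apply continuous_cis, continuous_Rmult; [apply continuous_const | exact Hp].
Qed.

(* The integrand of the time derivative is a multiple of the kernel plus an
   exact differential; the only relation used is [e (1 - y) = 1 + y], which
   holds for [e = cis (2 phi)] and [y = i tan phi]. *)
Lemma kernel_identity (E m r b y e : C) :
  (1 + m * e)%C <> 0%C -> (e * (1 - y))%C = (1 + y)%C ->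
  let dE := (- ((1 + 2 * b) * (e / (1 + m * e)) * E))%C in
  (- (m * r) * E - (1 - m) * ((1 + 2 * b) * ((m * r + m * (2 * (b * y))) * e / (1 + m * e)) * E)
   = (b - b * (1 + 2 * b) * y - b * r) * ((1 - m) * E)
     + (b * (r * ((1 - m) * E) - E * ((1 + m) - (1 + 2 * b) * y * (1 - m)))
        + m * (r * (- E + (1 - m) * dE) - dE * ((1 + m) - (1 + 2 * b) * y * (1 - m))
               - E * (1 + (1 + 2 * b) * y))))%C.
Proof.
  intros Hn He dE.
  match goal with |- ?L = ?Rr => transitivity (Rr - m * E * (1 + 2 * b) / (1 + m * e) * (e * (1 - y) - (1 + y)))%C end.
  - unfold dE. field. exact Hn.
  - rewrite He. ring.
Qed.

Lemma cis_tan (phi : R) : cos phi <> 0 ->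
  (cis (2 * phi) * (1 - Ci * RtoC (tan phi)) = 1 + Ci * RtoC (tan phi))%C.
Proof.
  intros H. unfold cis, tan. rewrite cos_2a, sin_2a. pose proof (sin2_cos2 phi) as E. unfold Rsqr in E.
  assert (E' : sin phi * sin phi = 1 - cos phi * cos phi) by lra.
  set (c := cos phi) in *. set (s := sin phi) in *.
  unfold Ci, RtoC, Cmult, Cminus, Copp, Cplus; cbn [fst snd]; f_equal.
  - transitivity (c * c - s * s + 2 * (s * s)); [unfold Cplus; cbn; field; exact H|]. rewrite E'. ring.
  - transitivity (s / c * (- (c * c) + s * s + 2 * c * c)); [unfold Cplus; cbn; field; exact H|]. rewrite E'. field. exact H.
Qed.

Lemma CInt_ext (f g : R -> C) : (forall s, 0 <= s <= 1 -> f s = g s) -> CInt f = CInt g.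
Proof.
  intros H. unfold CInt. f_equal; apply RInt_ext; intros s Hs;
    rewrite Rmin_left, Rmax_right in Hs by lra; rewrite H by lra; reflexivity.
Qed.

(** Continuity of [h] suffices because of the factor [s]. The case arises at the origin of the
    integration segment, where [s ^ (1/b)] has no derivative once [b > 1]. *)
Lemma is_derive_id_mult_0 (h : R -> R) : continuous h 0 -> is_derive (fun s => s * h s) 0 (h 0).
Proof.
  intros Hc. apply is_derive_Reals. intros eps Heps.
  destruct (proj1 (continuous_R _ _) Hc (mkposreal _ Heps)) as [d Hd].
  exists d. intros x Hx Hlt. replace ((0 + x) * h (0 + x) - 0 * h 0) with (x * h x) by (rewrite Rplus_0_l; ring).
  replace (x * h x / x - h 0) with (h x - h 0) by (field; exact Hx).
  apply Hd. change (Rabs (x - 0) < d). now rewrite Rminus_0_r.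
Qed.

Lemma cder_id_mult_0 (h : R -> C) : continuous h 0 -> cder (fun s => (RtoC s * h s)%C) 0 (h 0).
Proof.
  intros Hc%continuous_C. split; cbn.
  - apply (is_derive_ext (fun s => s * fst (h s))); [intros; cbn; ring|].
    now apply (is_derive_id_mult_0 (fun s => fst (h s))).
  - apply (is_derive_ext (fun s => s * snd (h s))); [intros; cbn; ring|].
    now apply (is_derive_id_mult_0 (fun s => snd (h s))).
Qed.

Lemma cder_id (t : R) : cder RtoC t 1%C.
Proof. apply (cder_RtoC (fun s => s)). apply (is_derive_id (K := R_AbsRing)). Qed.

Section Derivative.

Variables (b : R) (q : C) (phi : R) (r y : C).
Hypothesis (Hb : 0 < b) (Hq : 0 < fst (base q phi)).

Let e := cis (2 * phi).
Let pw (m : C) := power b m phi.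
Let dpw (m : C) := (- ((1 + 2 * RtoC b) * (e / (1 + m * e)) * pw m))%C.
(** [b * s * prim (pt s)] is the primitive of the exact part in [kernel_identity], and [dprim] is
    the derivative of [prim] in [m]. Here [r] stands for the logarithmic derivative of [q], and [y]
    for [i tan phi]. *)
Let prim (m : C) := (r * ((1 - m) * pw m) - pw m * ((1 + m) - (1 + 2 * RtoC b) * y * (1 - m)))%C.
Let dprim (m : C) :=
  (r * (- pw m + (1 - m) * dpw m) - dpw m * ((1 + m) - (1 + 2 * RtoC b) * y * (1 - m))
   - pw m * (1 + (1 + 2 * RtoC b) * y))%C.
Let pt (s : R) := (RtoC (root b s) * q)%C.

Lemma base_pt (s : R) : 0 <= s <= 1 -> 0 < fst (base (pt s) phi).
Proof. intros Hs. now apply base_root. Qed.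

Lemma base_pt_neq_0 (s : R) : 0 <= s <= 1 -> (1 + pt s * e)%C <> 0%C.
Proof.
  intros Hs E. assert (K := base_pt s Hs). unfold base in K. fold e in K. rewrite E in K. cbn in K. lra.
Qed.

Lemma continuous_pt (s : R) : continuous pt s.
Proof.
  apply continuous_Cmult; [|apply continuous_const].
  apply continuous_RtoC, continuous_root; [exact Hb | apply continuous_id].
Qed.

Lemma continuous_pw_pt (s : R) : 0 <= s <= 1 -> continuous (fun s => pw (pt s)) s.
Proof.
  intros Hs. apply (continuous_power b pt (fun _ => phi)).
  - apply continuous_pt.
  - apply continuous_const.
  - now apply base_pt.
Qed.

Lemma continuous_prim_pt (s : R) : 0 <= s <= 1 -> continuous (fun s => prim (pt s)) s.
Proof.
  intros Hs. assert (K1 := continuous_pw_pt s Hs). assert (K2 := continuous_pt s).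
  unfold prim.
  ccont.
Qed.

Lemma continuous_dprim_pt (s : R) : 0 <= s <= 1 -> continuous (fun s => dprim (pt s)) s.
Proof.
  intros Hs. assert (K1 := continuous_pw_pt s Hs). assert (K2 := continuous_pt s).
  assert (K3 := base_pt_neq_0 s Hs).
  unfold dprim, dpw.
  ccont; exact K3.
Qed.

Lemma cder_prim_pt (s : R) : 0 <= s <= 1 ->
  cder (fun s => (RtoC b * (RtoC s * prim (pt s)))%C) s (RtoC b * prim (pt s) + pt s * dprim (pt s))%C.
Proof.
  intros Hs. destruct (Rle_lt_or_eq_dec _ _ (proj1 Hs)) as [Hp | <-].
  - assert (Hpt : cder pt s (RtoC (/ b * root b s / s) * q)%C).
    { eapply cder_eq; [apply cder_mult; [|apply cder_const]|].
      - apply cder_RtoC. now apply root_derive.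
      - cbn beta. ring. }
    assert (Hpw := cder_power b pt (fun _ => phi) s _ 0 Hpt
      (is_derive_const (K := R_AbsRing) (V := R_NormedModule) phi s) (base_pt s Hs)).
    cbv beta in Hpw. fold (pw (pt s)) in Hpw.
    eapply cder_eq.
    { apply cder_mult; [apply cder_const|]. apply cder_mult; [apply cder_id|].
      unfold prim. cderiv. }
    cbv beta.
    unfold dprim, dpw, prim, dbase, base. fold e. fold (pw (pt s)).
    rewrite RtoC_div, RtoC_mult, RtoC_inv by lra. unfold pt.
    set (E := pw _). set (w := RtoC (root b s)). rewrite RtoC_plus, RtoC_mult.
    assert (RtoC b <> 0%C) by (intros X; apply RtoC_inj in X; lra).
    assert (RtoC s <> 0%C) by (intros X; apply RtoC_inj in X; lra).
    assert (K := base_pt_neq_0 s Hs). unfold pt in K. fold w in K.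
    field. auto.
  - eapply cder_eq.
    { apply cder_mult; [apply cder_const|].
      apply (cder_id_mult_0 (fun s => prim (pt s))). now apply continuous_prim_pt. }
    replace (pt 0) with (RtoC 0); [ring|]. unfold pt. rewrite root_0. ring.
Qed.

(** The primitive of the exact part carries a factor [s], so only its value at [s = 1], that is at
    [q] itself, survives as a boundary term. *)
Lemma CInt_dkern (tau : R) :
  y = (Ci * RtoC tau)%C -> (e * (1 - y))%C = (1 + y)%C ->
  CInt (fun s => dkern b (pt s) phi (r * pt s)%C (b * tau))
  = ((RtoC b - RtoC b * (1 + 2 * RtoC b) * y - RtoC b * r) * jfun b q phi
     + RtoC b * (r * kern b q phi - power b q phi * ((1 + q) - (1 + 2 * RtoC b) * y * (1 - q))))%C.
Proof.
  intros Hy He.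
  rewrite (CInt_ext _ (fun s =>
    (RtoC b - RtoC b * (1 + 2 * RtoC b) * y - RtoC b * r) * kern b (pt s) phi
    + (RtoC b * prim (pt s) + pt s * dprim (pt s)))%C).
  - rewrite (CInt_affine_exact _ (fun s => (RtoC b * (RtoC s * prim (pt s)))%C)).
    + unfold jfun. fold pt. f_equal.
      unfold prim, pt. rewrite root_1. replace (RtoC 1 * q)%C with q by ring.
      unfold pw, kern. ring.
    + intros s Hs. apply (continuous_kern b pt (fun _ => phi)).
      * apply continuous_pt.
      * apply continuous_const.
      * now apply base_pt.
    + intros s Hs. assert (K1 := continuous_prim_pt s Hs). assert (K2 := continuous_dprim_pt s Hs).
      assert (K3 := continuous_pt s).
      apply continuous_Cplus; apply continuous_Cmult; try assumption; apply continuous_const.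
    + exact cder_prim_pt.
  - intros s Hs. unfold dkern, kern, dbase, base. fold e. fold (pw (pt s)).
    assert (K := kernel_identity (pw (pt s)) (pt s) r (RtoC b) y e (base_pt_neq_0 s Hs) He).
    cbv zeta in K. unfold prim, dprim, dpw. rewrite <- K.
    rewrite Hy, RtoC_mult, RtoC_plus, RtoC_mult. field. apply base_pt_neq_0, Hs.
Qed.

End Derivative.

Lemma continuous_tan {U : UniformSpace} (f : U -> R) (x : U) :
  cos (f x) <> 0 -> continuous f x -> continuous (fun u => tan (f u)) x.
Proof.
  intros H Hf. apply (continuous_derivable_comp tan f); [|exact Hf].
  unfold tan. auto_derive. exact H.
Qed.

(** The logarithmic derivative [r] of [q] is left free: in one use it is that of a trajectory of the
    flow, in the other it is [0] with [q] constantly [1], which gives the tip. *)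
Lemma jfun_derive (b : R) (q r : R -> C) (phi : R -> R) (t : R) :
  0 < b ->
  locally t (fun u => cder q u (r u * q u)%C) ->
  locally t (fun u => is_derive phi u (b * tan (phi u))) ->
  continuous r t ->
  0 < fst (base (q t) (phi t)) -> cos (phi t) <> 0 ->
  cder (fun u => jfun b (q u) (phi u)) t
    (let y := (Ci * RtoC (tan (phi t)))%C in
     (RtoC b - RtoC b * (1 + 2 * RtoC b) * y - RtoC b * r t) * jfun b (q t) (phi t)
     + RtoC b * (r t * kern b (q t) (phi t)
         - power b (q t) (phi t) * ((1 + q t) - (1 + 2 * RtoC b) * y * (1 - q t))))%C.
Proof.
  intros Hb Hq Hphi Hr Hpos Hcos. cbv zeta. set (y := (Ci * RtoC (tan (phi t)))%C).
  assert (Cq := cder_continuous _ _ _ (locally_singleton _ _ Hq)).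
  assert (Cphi : continuous phi t).
  { apply (ex_derive_continuous (V := R_NormedModule)). eexists. exact (locally_singleton _ _ Hphi). }
  assert (Hder : forall u s, cder q u (r u * q u)%C -> is_derive phi u (b * tan (phi u)) ->
    0 < fst (base (RtoC (root b s) * q u)%C (phi u)) ->
    cder (fun u => kern b (RtoC (root b s) * q u)%C (phi u)) u
      (dkern b (RtoC (root b s) * q u)%C (phi u) (r u * (RtoC (root b s) * q u))%C (b * tan (phi u)))).
  { intros u s H1 H2 H3. apply (cder_kern b (fun u => (RtoC (root b s) * q u)%C) phi); auto.
    eapply cder_eq; [apply cder_mult; [apply cder_const | exact H1]|]. cbv beta; ring. }
  rewrite <- (CInt_dkern b (q t) (phi t) (r t) y Hb Hpos (tan (phi t))); [|reflexivity | now apply cis_tan].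
  apply (CInt_param_derive (fun u s => kern b (RtoC (root b s) * q u)%C (phi u))
    (fun u s => dkern b (RtoC (root b s) * q u)%C (phi u) (r u * (RtoC (root b s) * q u))%C (b * tan (phi u)))).
  - assert (L := locally_base_pos q phi t Cq Cphi Hpos).
    generalize (filter_and _ _ L (filter_and _ _ Hq Hphi)). apply filter_imp.
    intros u (L1 & L2 & L3) s Hs. apply Hder; auto. now apply base_root.
  - intros s Hs.
    assert (Fs : filterlim (fun p : R * R => fst p) (locally (t, s)) (locally t)) by apply continuous_fst.
    assert (L : locally (t, s) (fun p : R * R => 0 < fst (base (RtoC (root b (snd p)) * q (fst p))%C (phi (fst p))))).
    { apply (locally_base_pos (fun p : R * R => (RtoC (root b (snd p)) * q (fst p))%C) (fun p => phi (fst p))).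
      - apply continuous_Cmult.
        + apply continuous_RtoC, continuous_root; [exact Hb | apply continuous_snd].
        + apply (continuous_comp fst q); [apply continuous_fst | exact Cq].
      - apply (continuous_comp fst phi); [apply continuous_fst | exact Cphi].
      - now apply base_root. }
    generalize (filter_and _ _ L (filter_and _ _ (Fs _ Hq) (Fs _ Hphi))). unfold filtermap. apply filter_imp.
    intros p (L1 & L2 & L3). apply Hder; auto.
  - intros s Hs.
    assert (C1 : continuous (fun p : R * R => (RtoC (root b (snd p)) * q (fst p))%C) (t, s)).
    { apply continuous_Cmult.
      + apply continuous_RtoC, continuous_root; [exact Hb | apply continuous_snd].
      + apply (continuous_comp fst q); [apply continuous_fst | exact Cq]. }
    assert (C2 : continuous (fun p : R * R => phi (fst p)) (t, s)).
    { apply (continuous_comp fst phi); [apply continuous_fst | exact Cphi]. }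
    apply (continuous_dkern b (fun p : R * R => (RtoC (root b (snd p)) * q (fst p))%C)
      (fun p => (r (fst p) * (RtoC (root b (snd p)) * q (fst p)))%C)
      (fun p => phi (fst p)) (fun p => b * tan (phi (fst p)))); auto.
    + apply continuous_Cmult; [|exact C1]. apply (continuous_comp fst r); [apply continuous_fst | exact Hr].
    + apply continuous_Rmult; [apply continuous_const|]. now apply (continuous_tan (fun p : R * R => phi (fst p))).
    + now apply base_root.
  - assert (L := locally_base_pos q phi t Cq Cphi Hpos).
    revert L. apply filter_imp. intros u Hu s Hs.
    apply (continuous_kern_root b (fun _ => q u) (fun _ => phi u) (fun s => s)); auto;
      try apply continuous_const; [apply continuous_id | now apply base_root].
Qed.

(** * The driving angle and the trace of the tip *)

Definition angle (b T t : R) : R := asin (exp (b * (t - T))).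

Lemma exp_lt_1 (x : R) : x < 0 -> exp x < 1.
Proof. intros. rewrite <- exp_0. now apply exp_increasing. Qed.

Section Angle.
Variables (b T : R).
Hypothesis Hb : 0 < b.

Lemma sin_angle (t : R) : t < T -> sin (angle b T t) = exp (b * (t - T)).
Proof.
  intros Ht. apply sin_asin. pose proof (exp_pos (b * (t - T))).
  assert (exp (b * (t - T)) < 1) by (apply exp_lt_1; nra). lra.
Qed.

Lemma angle_bound (t : R) : t < T -> 0 < angle b T t < PI / 2.
Proof.
  intros Ht. pose proof (exp_pos (b * (t - T))).
  assert (exp (b * (t - T)) < 1) by (apply exp_lt_1; nra).
  pose proof (asin_bound_lt (exp (b * (t - T))) ltac:(lra)) as K. fold (angle b T t) in K.
  split; [|lra]. destruct (Rle_lt_dec (angle b T t) 0) as [L|L]; [|exact L].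
  pose proof (sin_angle t Ht) as E. pose proof PI_RGT_0.
  assert (sin (angle b T t) <= 0).
  { rewrite <- (Ropp_involutive (angle b T t)), sin_neg.
    assert (0 <= sin (- angle b T t)) by (apply sin_ge_0; lra). lra. }
  lra.
Qed.

Lemma cos_angle_pos (t : R) : t < T -> 0 < cos (angle b T t).
Proof. intros Ht. pose proof (angle_bound t Ht). apply cos_gt_0; lra. Qed.

(** The derivative of [asin] at [sin phi] is [1 / cos phi], and the inner exponential, being
    [sin phi], has derivative [b sin phi]. *)
Lemma angle_derive (t : R) : t < T -> is_derive (angle b T) t (b * tan (angle b T t)).
Proof.
  intros Ht. pose proof (exp_pos (b * (t - T))).
  assert (exp (b * (t - T)) < 1) by (apply exp_lt_1; nra).
  assert (Hx : -1 < exp (b * (t - T)) < 1) by lra.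
  assert (D := derive_pt_eq_1 _ _ _ _ (derive_pt_asin _ Hx)).
  apply is_derive_Reals in D.
  evar_last.
  - apply (is_derive_comp asin (fun t => exp (b * (t - T)))); [exact D|].
    auto_derive; [exact I | reflexivity].
  - unfold tan. rewrite sin_angle by exact Ht. unfold angle. rewrite cos_asin by lra.
    unfold scal; cbn. unfold mult; cbn. unfold Rsqr. rewrite ?Rmult_1_r.
    assert (0 < sqrt (1 - exp (b * (t - T)) * exp (b * (t - T)))) by (apply sqrt_lt_R0; nra).
    replace (t + - T) with (t - T) by ring. field. lra.
Qed.

Lemma angle_continuous (t : R) : t < T -> continuous (angle b T) t.
Proof.
  intros Ht. apply (ex_derive_continuous (V := R_NormedModule)). eexists. now apply angle_derive.
Qed.

Lemma angle_lim (d : R) : 0 < d -> exists M, M < T /\ forall t, t < M -> angle b T t < d.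
Proof.
  intros Hd. pose proof PI_RGT_0. set (d' := Rmin d (PI / 4)).
  assert (Hd' : 0 < d' <= PI / 4).
  { split; [unfold d'; apply Rmin_glb_lt; lra | apply Rmin_r]. }
  assert (Hs : 0 < sin d') by (apply sin_gt_0; lra).
  exists (Rmin (T - 1) (T + ln (sin d') / b)). split.
  { eapply Rle_lt_trans; [apply Rmin_l|]. lra. }
  intros t Ht. assert (t < T - 1) by (eapply Rlt_le_trans; [exact Ht | apply Rmin_l]).
  assert (Ht2 : t < T + ln (sin d') / b) by (eapply Rlt_le_trans; [exact Ht | apply Rmin_r]).
  assert (Hlt : sin (angle b T t) < sin d').
  { rewrite sin_angle by lra. rewrite <- (exp_ln (sin d')) by exact Hs. apply exp_increasing.
    apply (Rmult_lt_reg_r (/ b)); [now apply Rinv_0_lt_compat|].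
    replace (b * (t - T) * / b) with (t - T) by (field; lra). unfold Rdiv in Ht2. lra. }
  pose proof (angle_bound t ltac:(lra)).
  apply Rlt_le_trans with d'; [|apply Rmin_l].
  apply Rnot_le_lt. intros L. apply (Rlt_not_le _ _ Hlt). apply sin_incr_1; lra.
Qed.

Lemma angle_surj (phi : R) : 0 < phi < PI / 2 -> exists t, t < T /\ angle b T t = phi.
Proof.
  intros H. assert (Hs : 0 < sin phi) by (apply sin_gt_0; lra).
  assert (Hs1 : sin phi < 1).
  { rewrite <- sin_PI2. apply sin_increasing_1; lra. }
  exists (T + ln (sin phi) / b). split.
  - assert (ln (sin phi) < 0) by (rewrite <- ln_1; apply ln_increasing; lra).
    assert (ln (sin phi) / b < 0) by (apply Rdiv_neg_pos; lra). lra.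
  - unfold angle. replace (b * (T + ln (sin phi) / b - T)) with (ln (sin phi)) by (field; lra).
    rewrite exp_ln by exact Hs. apply asin_sin. lra.
Qed.

End Angle.

Lemma cis_plus (x y : R) : cis (x + y) = (cis x * cis y)%C.
Proof. unfold cis, Cmult; cbn. rewrite cos_plus, sin_plus. f_equal; ring. Qed.

Lemma cis_0 : cis 0 = 1%C.
Proof. unfold cis. rewrite cos_0, sin_0. reflexivity. Qed.

Lemma cis_opp_r (x : R) : (cis x * cis (- x))%C = 1%C.
Proof. rewrite <- cis_plus, Rplus_opp_r. apply cis_0. Qed.

Lemma Cmod_cis (x : R) : Cmod (cis x) = 1.
Proof.
  unfold Cmod, cis; cbn [fst snd]. rewrite <- !Rsqr_pow2, Rplus_comm, sin2_cos2. apply sqrt_1.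
Qed.

Lemma base_disk (q : C) (phi : R) : Cmod q < 1 -> 0 < fst (base q phi).
Proof.
  intros Hq. unfold base. pose proof (Cmod_fst_le (q * cis (2 * phi))%C) as K.
  rewrite Cmod_mult, Cmod_cis, Rmult_1_r in K.
  assert (K2 : Rabs (fst (q * cis (2 * phi))%C) < 1) by lra. apply Rabs_def2 in K2.
  change (fst (1 + q * cis (2 * phi))%C) with (1 + fst (q * cis (2 * phi))%C). lra.
Qed.

Lemma base_1 (phi : R) : - (PI / 2) < phi < PI / 2 -> 0 < fst (base 1 phi).
Proof.
  intros H. unfold base, cis; cbn. rewrite cos_2a_cos. pose proof (cos_gt_0 phi ltac:(lra) ltac:(lra)). nra.
Qed.

(** [1 + e^(2i phi) = 2 cos phi e^(i phi)]. *)
Lemma clog_base_1 (phi : R) : - (PI / 2) < phi < PI / 2 ->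
  clog (base 1 phi) = (ln (2 * cos phi), phi).
Proof.
  intros H. assert (Hc := cos_gt_0 phi ltac:(lra) ltac:(lra)).
  assert (E : base 1 phi = (2 * cos phi * cos phi, 2 * cos phi * sin phi)).
  { unfold base, cis, Cmult, Cplus, RtoC; cbn. rewrite cos_2a_cos, sin_2a. f_equal; ring. }
  unfold clog. rewrite E. f_equal.
  - f_equal. unfold Cmod; cbn [fst snd].
    replace ((2 * cos phi * cos phi) ^ 2 + (2 * cos phi * sin phi) ^ 2)
      with ((2 * cos phi) ^ 2 * ((sin phi)² + (cos phi)²)) by (unfold Rsqr; ring).
    rewrite sin2_cos2, Rmult_1_r. apply sqrt_pow2. lra.
  - cbn [fst snd]. replace (2 * cos phi * sin phi / (2 * cos phi * cos phi)) with (tan phi)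
      by (unfold tan; field; lra). apply atan_tan. lra.
Qed.

Lemma jfun_0 (b phi : R) : jfun b 0 phi = 1%C.
Proof.
  unfold jfun. rewrite (CInt_ext _ (fun _ => RtoC 1)).
  - unfold CInt; cbn [fst snd]. rewrite !RInt_const. unfold scal; cbn. unfold mult; cbn.
    unfold RtoC. f_equal; ring.
  - intros s _. unfold kern, power, base. rewrite Cmult_0_r, Cmult_0_l, Cplus_0_r.
    rewrite clog_real, ln_1 by lra. rewrite Cmult_0_r, cexp_0. ring.
Qed.

(* [rot b phi * jfun b 1 phi], divided by [sin phi], is up to scaling the
   position of the tip in the coordinate [z ^ b]. *)
Definition rot (b phi : R) : C := cexp (0, (1 + 2 * b) * phi).


Lemma kern_real_continuous (b phi s : R) :
  0 < b -> - (PI / 2) < phi < PI / 2 -> 0 <= s <= 1 ->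
  continuous (fun s => kern b (RtoC (root b s) * 1)%C phi) s.
Proof.
  intros Hb Hp Hs.
  apply (continuous_kern_root b (fun _ => 1%C) (fun _ => phi) (fun s => s)); auto;
    try apply continuous_const; [apply continuous_id | apply base_root; auto; now apply base_1].
Qed.

Lemma rot_jfun_1 (b phi : R) : 0 < b -> - (PI / 2) < phi < PI / 2 ->
  (rot b phi * jfun b 1 phi)%C = CInt (fun s => rot b phi * kern b (RtoC (root b s) * 1)%C phi)%C.
Proof.
  intros Hb Hp.
  rewrite (CInt_ext (fun s => rot b phi * kern b (RtoC (root b s) * 1)%C phi)%C
    (fun s => rot b phi * kern b (RtoC (root b s) * 1)%C phi + 0)%C) by (intros; ring).
  rewrite (CInt_affine_exact _ (fun _ => 0%C) (fun _ => 0%C)).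
  - unfold jfun. ring.
  - intros s Hs. now apply kern_real_continuous.
  - intros; apply continuous_const.
  - intros; apply cder_const.
Qed.

Lemma rot_kern (b phi s : R) : 0 < s -> s < 1 -> 0 <= phi < PI / 2 ->
  (rot b phi * kern b (RtoC s * 1)%C phi)%C =
  (RtoC (1 - s) * cexp ((- (1 + 2 * b) * ln (Cmod (base (RtoC s * 1)%C phi)))%R,
    ((1 + 2 * b) * (phi - atan (s * sin (2 * phi) / (1 + s * cos (2 * phi)))))%R))%C.
Proof.
  intros H0 H1 Hp. unfold kern, rot, power.
  replace (cexp (0%R, ((1 + 2 * b) * phi)%R) * ((1 - RtoC s * 1) * cexp (RtoC (- (1 + 2 * b)) * clog (base (RtoC s * 1)%C phi))))%C
    with (RtoC (1 - s) * (cexp (0%R, ((1 + 2 * b) * phi)%R) * cexp (RtoC (- (1 + 2 * b)) * clog (base (RtoC s * 1)%C phi))))%C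
    by (rewrite RtoC_minus, RtoC_opp; ring).
  rewrite <- cexp_plus. do 2 f_equal. unfold clog.
  replace (snd (base (RtoC s * 1)%C phi) / fst (base (RtoC s * 1)%C phi))
    with (s * sin (2 * phi) / (1 + s * cos (2 * phi))).
  - unfold Cplus, Cmult, RtoC; cbn [fst snd]. f_equal; ring.
  - unfold base, cis; cbn. f_equal; [ring|]. f_equal; ring.
Qed.

(** The arctangent is the argument of [1 + s e^(2i phi)], which would equal [phi] at [s = 1]. After
    comparison of tangents and clearing of denominators the upper bound reads
    [s sin phi < sin phi]. *)
Lemma atan_lt_angle (phi s : R) : 0 <= s < 1 -> 0 < phi < PI / 2 ->
  0 <= atan (s * sin (2 * phi) / (1 + s * cos (2 * phi))) < phi.
Proof.
  intros Hs Hp.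
  assert (Hsin : 0 < sin phi) by (apply sin_gt_0; lra).
  assert (Hcos : 0 < cos phi) by (apply cos_gt_0; lra).
  assert (Hd : 0 < 1 + s * cos (2 * phi)) by (rewrite cos_2a_cos; nra).
  split.
  - assert (H0 : 0 <= s * sin (2 * phi) / (1 + s * cos (2 * phi))).
    { apply Rdiv_le_0_compat; [|exact Hd]. rewrite sin_2a.
      apply Rmult_le_pos; [lra|]. apply Rmult_le_pos; lra. }
    destruct H0 as [L | <-]; [|rewrite atan_0; lra].
    apply atan_increasing in L. rewrite atan_0 in L. lra.
  - rewrite <- (atan_tan phi) at 3 by lra. apply atan_increasing. unfold tan.
    apply (Rmult_lt_reg_r (1 + s * cos (2 * phi))); [exact Hd|].
    unfold Rdiv at 1. rewrite Rmult_assoc, Rinv_l by lra.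
    apply (Rmult_lt_reg_r (cos phi)); [exact Hcos|].
    replace (sin phi / cos phi * (1 + s * cos (2 * phi)) * cos phi) with (sin phi * (1 + s * cos (2 * phi))) by (field; lra).
    rewrite sin_2a, cos_2a_cos. pose proof (sin2_cos2 phi) as E; unfold Rsqr in E. nra.
Qed.

(** For [0 < s < 1] the integrand has argument [1 + 2b] times the excess of [phi] over the argument
    of [base]; the smallness condition confines this to [(0, pi)]. Larger angles are reached in
    [rot_jfun_im_pos]. *)
Lemma rot_jfun_1_im_pos (b phi : R) :
  0 < b -> 0 < phi < PI / 2 -> (1 + 2 * b) * phi < PI -> 0 < snd (rot b phi * jfun b 1 phi)%C.
Proof.
  intros Hb Hp Hsmall. rewrite rot_jfun_1 by lra. cbn [CInt snd].
  apply RInt_gt_0; [lra| |].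
  - intros s Hs. assert (R0 := root_pos b s ltac:(lra)). assert (R1 := root_lt_1 b s Hb ltac:(lra)).
    rewrite rot_kern by lra.
    pose proof (atan_lt_angle phi (root b s) ltac:(lra) Hp) as Ha.
    set (at_ := atan _) in *. set (l := ln _).
    unfold cexp, Cmult, RtoC; cbn [fst snd]. rewrite Rmult_0_l, Rplus_0_r.
    apply Rmult_lt_0_compat; [lra|]. apply Rmult_lt_0_compat; [apply exp_pos|].
    apply sin_gt_0; nra.
  - intros s Hs. assert (K := kern_real_continuous b phi s Hb ltac:(lra) ltac:(lra)).
    assert (K2 := continuous_Cmult (fun _ => rot b phi) _ s (continuous_const _ _) K).
    apply continuous_C in K2. apply K2.
Qed.

Lemma base_sub_1 (s phi : R) : 0 <= s <= 1 -> - (PI / 2) < phi < PI / 2 -> 0 < fst (base (RtoC s) phi).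
Proof.
  intros Hs Hp. replace (RtoC s) with (RtoC s * 1)%C by ring. apply base_scal; [exact Hs | now apply base_1].
Qed.

(* The value [phi = 0] corresponds to [t = -oo]; there all integrands are positive reals. *)
Lemma jfun_start (b s : R) : 0 < b -> 0 <= s <= 1 ->
  snd (jfun b (RtoC s) 0) = 0 /\ 0 < fst (jfun b (RtoC s) 0).
Proof.
  intros Hb Hs.
  assert (K : forall u, 0 <= u <= 1 -> exists x, (u < 1 -> 0 < x) /\ kern b (RtoC (root b u) * RtoC s)%C 0 = RtoC x).
  { intros u Hu. pose proof (root_ge_0 b u). pose proof (root_le_1 b u Hb ltac:(lra)).
    set (m := root b u * s). assert (0 <= m <= 1) by (unfold m; nra).
    exists ((1 - m) * exp (- (1 + 2 * b) * ln (1 + m))). split.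
    - intros L. apply Rmult_lt_0_compat; [|apply exp_pos].
      pose proof (root_lt_1 b u Hb L). unfold m. nra.
    - rewrite <- RtoC_mult. fold m. unfold kern, power, base.
      rewrite Rmult_0_r. replace (cis 0) with (RtoC 1) by (unfold cis; rewrite cos_0, sin_0; reflexivity).
      rewrite Cmult_1_r, <- RtoC_plus, clog_real by lra. rewrite <- RtoC_mult.
      unfold cexp, Cmult, Cminus, Cplus, Copp, RtoC; cbn [fst snd]. rewrite cos_0, sin_0. f_equal; ring. }
  unfold jfun, CInt; cbn [fst snd]. split.
  - rewrite (RInt_ext _ (fun _ => 0)).
    + rewrite RInt_const. unfold scal; cbn; unfold mult; cbn. ring.
    + intros u Hu. rewrite Rmin_left, Rmax_right in Hu by lra.
      destruct (K u ltac:(lra)) as [x [_ ->]]. reflexivity.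
  - apply RInt_gt_0; [lra | |].
    + intros u Hu. destruct (K u ltac:(lra)) as [x [Hx ->]]. cbn. apply Hx. lra.
    + intros u Hu.
      assert (C1 := continuous_kern_root b (fun _ => RtoC s) (fun _ => 0) (fun u => u) u Hb
        (continuous_const _ _) (continuous_const _ _) (continuous_id _)).
      apply continuous_C in C1; [apply C1|]. apply base_root; [exact Hb | lra |].
      apply base_sub_1; [exact Hs|]. pose proof PI_RGT_0. lra.
Qed.

Lemma derive_le_const (f : R -> R) (df : R -> R) (x y : R) :
  x <= y -> (forall t, x <= t <= y -> is_derive f t (df t)) ->
  exists c, x <= c <= y /\ f y - f x = df c * (y - x).
Proof.
  intros Hxy H. destruct (MVT_gen f x y df) as [c [Hc E]].
  - intros t Ht. apply H. rewrite Rmin_left, Rmax_right in Ht by lra. lra.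
  - intros t Ht. rewrite Rmin_left, Rmax_right in Ht by lra. apply continuous_Rcontinuity_pt.
    apply (ex_derive_continuous (V := R_NormedModule)). eexists. now apply H.
  - rewrite Rmin_left, Rmax_right in Hc by lra. eauto.
Qed.

Lemma cder_0_const (f : R -> C) (x y : R) :
  x <= y -> (forall t, x <= t <= y -> cder f t 0%C) -> f y = f x.
Proof.
  intros Hxy H.
  destruct (derive_le_const (fun t => fst (f t)) (fun _ => 0) x y Hxy) as [c [_ E1]].
  { intros t Ht. apply (H t Ht). }
  destruct (derive_le_const (fun t => snd (f t)) (fun _ => 0) x y Hxy) as [d [_ E2]].
  { intros t Ht. apply (H t Ht). }
  destruct (f x), (f y); cbn in *. f_equal; lra.
Qed.

Lemma fst_RtoC_mult (x : R) (z : C) : fst (RtoC x * z)%C = x * fst z.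
Proof. cbn. ring. Qed.

Lemma snd_RtoC_mult (x : R) (z : C) : snd (RtoC x * z)%C = x * snd z.
Proof. cbn. ring. Qed.

(** The formula for [z ^ b] at [q = 1]: there [g = e^(i w)] with [w = (2 + 1/b) phi], so
    [(g e^(-t)) ^ b] is [e^(-bt)] times [rot]. *)
Definition tip (b T t : R) : C := (RtoC (exp (- (b * t))) * (rot b (angle b T t) * jfun b 1 (angle b T t)))%C.

Section Tip.
Variables (b T : R).
Hypothesis Hb : 0 < b.

(** [rot] cancels exactly the phase of [(1 + e^(2i phi)) ^ (-1-2b)]; this is what makes the velocity
    of the tip real. *)
Lemma rot_power_1 (phi : R) : - (PI / 2) < phi < PI / 2 ->
  (rot b phi * power b 1 phi)%C = RtoC (exp (- (1 + 2 * b) * ln (2 * cos phi))).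
Proof.
  intros Hp. unfold rot, power. rewrite <- cexp_plus, clog_base_1 by exact Hp.
  unfold cexp, Cplus, Cmult, RtoC; cbn [fst snd].
  replace ((1 + 2 * b) * phi + (- (1 + 2 * b) * phi + 0 * ln (2 * cos phi))) with 0 by ring.
  rewrite cos_0, sin_0. f_equal; [|ring]. rewrite Rmult_1_r. f_equal. ring.
Qed.

Lemma cder_rot (t : R) : t < T ->
  cder (fun t => rot b (angle b T t)) t
    (Ci * RtoC ((1 + 2 * b) * (b * tan (angle b T t))) * rot b (angle b T t))%C.
Proof.
  intros Ht. eapply cder_eq.
  - apply (cder_cexp _ t (0, (1 + 2 * b) * (b * tan (angle b T t)))). split; cbn [fst snd].
    + apply (is_derive_const (K := R_AbsRing) (V := R_NormedModule) 0).
    + apply (is_derive_scal (angle b T) t (1 + 2 * b) _ (angle_derive b T Hb t Ht)).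
  - unfold rot. f_equal. unfold Ci, Cmult, RtoC; cbn. f_equal; ring.
Qed.

(** In the product rule the multiples of [jfun] cancel: [-b] from the exponential,
    [i b (1+2b) tan phi] from [rot], and the opposite of their sum from [jfun_derive] with [r = 0].
    What remains is the boundary term [-2b e^(-bt) rot power], real by [rot_power_1]. *)
Lemma tip_derive (t : R) : t < T ->
  cder (tip b T) t (RtoC (- (2 * b * exp (- (b * t)) * exp (- (1 + 2 * b) * ln (2 * cos (angle b T t)))))).
Proof.
  intros Ht. pose proof (angle_bound b T Hb t Ht). pose proof (cos_angle_pos b T Hb t Ht).
  assert (Hj : cder (fun t => jfun b 1 (angle b T t)) t
    (let y := (Ci * RtoC (tan (angle b T t)))%C in
     (RtoC b - RtoC b * (1 + 2 * RtoC b) * y - RtoC b * 0) * jfun b 1 (angle b T t)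
     + RtoC b * (0 * kern b 1 (angle b T t)
         - power b 1 (angle b T t) * ((1 + 1) - (1 + 2 * RtoC b) * y * (1 - 1))))%C).
  { apply (jfun_derive b (fun _ => RtoC 1) (fun _ => RtoC 0) (angle b T) t Hb).
    - apply filter_forall. intros u. eapply cder_eq; [apply cder_const|]. ring.
    - assert (Hd : 0 < T - t) by lra. exists (mkposreal _ Hd). intros u Hu.
      change (Rabs (u - t) < T - t) in Hu. apply Rabs_def2 in Hu. apply angle_derive; [exact Hb | lra].
    - apply continuous_const.
    - apply base_1. lra.
    - lra. }
  cbv zeta in Hj.
  assert (He : cder (fun t => RtoC (exp (- (b * t)))) t (RtoC (- b * exp (- (b * t))))).
  { apply cder_RtoC. auto_derive; [exact I | ring]. }
  eapply cder_eq.
  { apply cder_mult; [exact He|]. apply cder_mult; [apply cder_rot; exact Ht | exact Hj]. }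
  cbv beta. assert (K := rot_power_1 (angle b T t) ltac:(lra)).
  set (phi := angle b T t) in *. rewrite RtoC_opp.
  rewrite (RtoC_mult (2 * b * exp (- (b * t)))), <- K.
  rewrite !RtoC_mult, RtoC_opp, RtoC_plus, RtoC_mult. ring.
Qed.

Lemma tip_im : exists y0, 0 < y0 /\ forall t, t < T -> snd (tip b T t) = y0.
Proof.
  pose proof PI_RGT_0 as HPI.
  (* Below this angle [rot_jfun_1_im_pos] applies; one such time fixes the sign of the constant
     imaginary part. *)
  destruct (angle_lim b T Hb (PI / (1 + 2 * b))) as [M [HM Hlim]].
  { apply Rdiv_lt_0_compat; lra. }
  assert (Hconst : forall t u, t <= u -> u < T -> snd (tip b T u) = snd (tip b T t)).
  { intros t u Htu Hu.
    destruct (derive_le_const (fun t => snd (tip b T t)) (fun _ => 0) t u Htu) as [c [_ E]]; [|lra].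
    intros s Hs. apply (tip_derive s). lra. }
  exists (snd (tip b T (M - 1))). split.
  - unfold tip. rewrite snd_RtoC_mult.
    apply Rmult_lt_0_compat; [apply exp_pos|]. 
    apply rot_jfun_1_im_pos; [exact Hb | apply angle_bound; [exact Hb | lra] |].
    apply (Rmult_lt_reg_r (/ (1 + 2 * b))); [apply Rinv_0_lt_compat; lra|].
    replace ((1 + 2 * b) * angle b T (M - 1) * / (1 + 2 * b)) with (angle b T (M - 1)) by (field; lra).
    apply Hlim. lra.
  - intros t Ht. destruct (Rle_dec t (M - 1)).
    + symmetry. apply Hconst; lra.
    + apply Hconst; lra.
Qed.

Lemma tip_re_decr (t u : R) : t < u -> u < T -> fst (tip b T u) < fst (tip b T t).
Proof.
  intros Htu Hu.
  destruct (derive_le_const (fun t => fst (tip b T t)) _ t u (Rlt_le _ _ Htu)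
    (fun s Hs => proj1 (tip_derive s ltac:(lra)))) as [c [_ E]].
  cbn [fst RtoC] in E. 
  pose proof (exp_pos (- (b * c))). pose proof (exp_pos (- (1 + 2 * b) * ln (2 * cos (angle b T c)))).
  assert (0 < 2 * b * exp (- (b * c)) * exp (- (1 + 2 * b) * ln (2 * cos (angle b T c)))) by
    (repeat apply Rmult_lt_0_compat; lra).
  nra.
Qed.

Lemma tip_continuous (t : R) : t < T -> continuous (tip b T) t.
Proof. intros Ht. eapply cder_continuous. now apply tip_derive. Qed.

Lemma rot_continuous {U : UniformSpace} (f : U -> R) (x : U) :
  continuous f x -> continuous (fun u => rot b (f u)) x.
Proof.
  intros Hf. apply continuous_cexp, continuous_C; cbn; split; [apply continuous_const|].
  apply continuous_Rmult; [apply continuous_const | exact Hf].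
Qed.

Lemma rot_0 : rot b 0 = 1%C.
Proof. unfold rot. rewrite Rmult_0_r. apply cexp_0. Qed.

Lemma rot_jfun_continuous (phi : R) : - (PI / 2) < phi < PI / 2 ->
  continuous (fun phi => (rot b phi * jfun b 1 phi)%C) phi.
Proof.
  intros Hp. apply continuous_Cmult.
  - apply (rot_continuous (fun x => x)), continuous_id.
  - apply (continuous_jfun b (fun _ => RtoC 1) (fun x => x)); auto;
      [apply continuous_const | apply continuous_id | now apply base_1].
Qed.

(** As [t -> -oo] the angle tends to [0], where [rot * jfun] is a positive real [c], so its real
    part eventually exceeds [c / 2], while the factor [e^(-bt)] is unbounded. *)
Lemma tip_re_lim (M : R) : exists t0, t0 < T /\ forall t, t < t0 -> M < fst (tip b T t).
Proof.
  pose proof PI_RGT_0 as HPI.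
  assert (Hc := rot_jfun_continuous 0 ltac:(lra)). apply continuous_C in Hc. destruct Hc as [Hc _].
  destruct (jfun_start b 1 Hb ltac:(lra)) as [_ Hp]. set (c := fst (jfun b 1 0)) in *.
  assert (E0 : fst (rot b 0 * jfun b 1 0)%C = c) by (rewrite rot_0, Cmult_1_l; reflexivity).
  assert (Hc2 : 0 < c / 2) by lra.
  destruct (continuous_close _ _ _ Hc Hc2) as [d [Hd0 Hd]].
  destruct (angle_lim b T Hb d Hd0) as [t1 [Ht1 Hlim]].
  (* The bound is raised to at least [1] so that its logarithm can be taken. *)
  set (M' := Rmax 1 M).
  assert (HM' : 1 <= M') by apply Rmax_l.
  assert (HM2 : M <= M') by apply Rmax_r.
  exists (Rmin t1 (- ln (M' / (c / 2)) / b)). split.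
  - eapply Rle_lt_trans; [apply Rmin_l | exact Ht1].
  - intros t Ht. assert (t < t1) by (eapply Rlt_le_trans; [exact Ht | apply Rmin_l]).
    assert (Ht2 : t < - ln (M' / (c / 2)) / b) by (eapply Rlt_le_trans; [exact Ht | apply Rmin_r]).
    pose proof (angle_bound b T Hb t ltac:(lra)).
    specialize (Hd (angle b T t)). cbv beta in Hd. rewrite E0 in Hd.
    specialize (Hlim t ltac:(lra)).
    specialize (Hd ltac:(apply Rabs_def1; lra)). apply Rabs_def2 in Hd.
    unfold tip. rewrite fst_RtoC_mult.
    assert (Hexp : M' / (c / 2) < exp (- (b * t))).
    { rewrite <- (exp_ln (M' / (c / 2))) by (apply Rdiv_lt_0_compat; lra).
      apply exp_increasing. apply (Rmult_lt_compat_l b) in Ht2; [|exact Hb].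
      replace (b * (- ln (M' / (c / 2)) / b)) with (- ln (M' / (c / 2))) in Ht2 by (field; lra). lra. }
    assert (M' < exp (- (b * t)) * (c / 2)).
    { apply (Rmult_lt_compat_r (c / 2)) in Hexp; [|exact Hc2].
      replace (M' / (c / 2) * (c / 2)) with M' in Hexp by (field; lra). exact Hexp. }
    pose proof (exp_pos (- (b * t))).
    set (v := fst (rot b (angle b T t) * jfun b 1 (angle b T t))%C) in *.
    assert (exp (- (b * t)) * (c / 2) < exp (- (b * t)) * v) by (apply Rmult_lt_compat_l; lra). lra.
Qed.

(** Every angle in [(0, pi/2)] is attained at some time, so constancy of the imaginary part of the
    tip carries the sign from small angles to all of them. *)
Lemma rot_jfun_im_pos (phi : R) : 0 < phi < PI / 2 -> 0 < snd (rot b phi * jfun b 1 phi)%C.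
Proof.
  intros Hp. destruct (angle_surj b T Hb phi Hp) as [t [Ht <-]].
  destruct tip_im as [y0 [Hy0 H]]. specialize (H t Ht). unfold tip in H.
  rewrite snd_RtoC_mult in H.
  pose proof (exp_pos (- (b * t))).
  apply (Rmult_lt_reg_l (exp (- (b * t)))); [assumption|]. rewrite Rmult_0_r. lra.
Qed.

End Tip.

(* Principal logarithm on the plane slit along the nonpositive reals, through
   the square root [z = w^2 / (2 (|z| + Re z))] with [w = |z| + z] in the right half-plane. *)
Definition half (z : C) : C := (RtoC (Cmod z) + z)%C.
Definition slit_log (z : C) : C := (2 * clog (half z) - RtoC (ln (2 * (Cmod z + fst z))))%C.

Lemma half_pos (z : C) : snd z <> 0 \/ 0 < fst z -> 0 < fst (half z).
Proof.
  intros H. change (0 < Cmod z + fst z).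
  destruct (Rlt_dec 0 (fst z)) as [L|L]; [pose proof (Cmod_ge_0 z); lra|].
  assert (Hs : snd z <> 0) by (destruct H; [assumption | lra]).
  assert (fst z * fst z < Cmod z * Cmod z).
  { unfold Cmod. rewrite sqrt_sqrt by (apply Rplus_le_le_0_compat; apply pow2_ge_0).
    assert (0 < snd z ^ 2) by (apply pow2_gt_0; exact Hs). nra. }
  pose proof (Cmod_ge_0 z). nra.
Qed.

Lemma cexp_slit_log (z : C) : snd z <> 0 \/ 0 < fst z -> cexp (slit_log z) = z.
Proof.
  intros H. apply half_pos in H. assert (Hh : fst (half z) = Cmod z + fst z) by reflexivity.
  unfold slit_log. replace (2 * clog (half z))%C with (clog (half z) + clog (half z))%C by ring.
  rewrite cexp_minus, cexp_plus, cexp_clog by exact H.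
  set (c := Cmod z + fst z) in *. assert (Hc : 0 < c) by lra.
  assert (E : cexp (RtoC (ln (2 * c))) = RtoC (2 * c)).
  { unfold cexp, RtoC; cbn. rewrite cos_0, sin_0, exp_ln by lra. f_equal; ring. }
  rewrite E. assert (Hne : RtoC (2 * c) <> 0%C) by (intros X; apply RtoC_inj in X; lra).
  assert (E2 : (half z * half z = RtoC (2 * c) * z)%C).
  { unfold half, c. unfold Cmult, Cplus, RtoC; destruct z as [x y]; cbn [fst snd].
    assert (Hm : Cmod (x, y) * Cmod (x, y) = x * x + y * y).
    { unfold Cmod; cbn [fst snd]. rewrite sqrt_sqrt by (apply Rplus_le_le_0_compat; apply pow2_ge_0). ring. }
    set (m := Cmod (x, y)) in *. f_equal; [|ring].
    replace ((m + x) * (m + x) - (0 + y) * (0 + y)) with (m * m + 2 * m * x + x * x - y * y) by ring.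
    rewrite Hm. ring. }
  rewrite E2. field. exact Hne.
Qed.

Lemma slit_log_real (x : R) : 0 < x -> slit_log (RtoC x) = RtoC (ln x).
Proof.
  intros Hx. unfold slit_log, half. rewrite Cmod_R, Rabs_pos_eq by lra. cbn [fst RtoC].
  rewrite <- RtoC_plus, clog_real by lra.
  replace (2 * (x + x)) with ((x + x) * (x + x) / x) by (field; lra).
  rewrite ln_div, ln_mult by nra. rewrite RtoC_minus, RtoC_plus. ring.
Qed.

Lemma continuous_slit_log {U : UniformSpace} (f : U -> C) (x : U) :
  (snd (f x) <> 0 \/ 0 < fst (f x)) -> continuous f x -> continuous (fun u => slit_log (f u)) x.
Proof.
  intros H Hf. apply half_pos in H.
  assert (Hh : continuous (fun u => half (f u)) x).
  { apply continuous_Cplus; [|exact Hf]. apply continuous_RtoC. now apply continuous_Cmod. }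
  unfold slit_log. apply continuous_Cminus.
  - apply continuous_Cmult; [apply continuous_const | now apply continuous_clog].
  - apply continuous_RtoC. apply (continuous_derivable_comp ln).
    + change (Cmod (f x) + fst (f x)) with (fst (half (f x))). auto_derive. lra.
    + apply continuous_Rmult; [apply continuous_const|].
      apply continuous_C in Hh. apply Hh.
Qed.

(** * Radial logarithms *)

(* [l] is the logarithm of [jfun b q phi] reached by continuation along the
   segment from [0], where [jfun] equals [1]. *)
Definition radial_log (b : R) (q : C) (phi : R) (l : C) : Prop :=
  exists G : R -> C, G 0 = 0%C /\ G 1 = l /\
    forall s, 0 <= s <= 1 -> continuous G s /\ cexp (G s) = jfun b (RtoC s * q)%C phi.

Lemma radial_log_unique (b : R) (q : C) (phi : R) (l m : C) :
  radial_log b q phi l -> radial_log b q phi m -> l = m.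
Proof.
  intros (G & G0 & <- & HG) (K & K0 & <- & HK).
  apply (cexp_lift_eq G K 0 1); [|congruence].
  intros s Hs. rewrite Rmin_left, Rmax_right in Hs by lra.
  destruct (HG s Hs) as [H1 E1]. destruct (HK s Hs) as [H2 E2]. rewrite E1, E2. auto.
Qed.

Lemma radial_log_exp (b : R) (q : C) (phi : R) (l : C) :
  radial_log b q phi l -> cexp l = jfun b q phi.
Proof.
  intros (G & G0 & <- & HG). destruct (HG 1 ltac:(lra)) as [_ ->]. f_equal. ring.
Qed.

Lemma radial_log_scale (b : R) (q : C) (phi : R) (G : R -> C) (s : R) :
  G 0 = 0%C -> (forall s, 0 <= s <= 1 -> continuous G s /\ cexp (G s) = jfun b (RtoC s * q)%C phi) ->
  0 <= s <= 1 -> radial_log b (RtoC s * q)%C phi (G s).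
Proof.
  intros G0 HG Hs. exists (fun u => G (u * s)). split; [|split].
  - now rewrite Rmult_0_l.
  - now rewrite Rmult_1_l.
  - intros u Hu. assert (Hus : 0 <= u * s <= 1) by nra.
    destruct (HG _ Hus) as [H1 H2]. split.
    + apply (continuous_comp (fun u => u * s) G); [|exact H1].
      apply continuous_Rmult; [apply continuous_id | apply continuous_const].
    + rewrite H2. f_equal. rewrite RtoC_mult. ring.
Qed.

(** All radial segments over the path form one rectangle on which the function is nonzero and equals
    [1] on the side [s = 0]; its logarithm on the opposite side is at once radial and continuous in
    time. *)
Lemma path_log (b : R) (q : R -> C) (phi : R -> R) (al be : R) :
  0 < b ->
  (forall t, al <= t <= be -> continuous q t /\ continuous phi t /\ 0 < fst (base (q t) (phi t))) ->
  (forall t s, al <= t <= be -> 0 <= s <= 1 -> jfun b (RtoC s * q t)%C (phi t) <> 0%C) ->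
  exists l : R -> C, forall t, al <= t <= be -> continuous l t /\ radial_log b (q t) (phi t) (l t).
Proof.
  intros Hb Hq Hn.
  destruct (rectangle_log (fun p => jfun b (RtoC (fst p) * q (snd p))%C (phi (snd p))) al be) as [G HG].
  - intros s t Hs Ht. destruct (Hq t Ht) as (H1 & H2 & H3). split; [|now apply Hn].
    apply (continuous_jfun b (fun p : R * R => (RtoC (fst p) * q (snd p))%C) (fun p => phi (snd p))); auto.
    + apply continuous_Cmult; [apply continuous_RtoC, continuous_fst|].
      apply (continuous_comp snd q); [apply continuous_snd | exact H1].
    + apply (continuous_comp snd phi); [apply continuous_snd | exact H2].
    + now apply base_scal.
  - intros t Ht. cbn [fst snd]. rewrite Cmult_0_l. apply jfun_0.
  - exists (fun t => G (1, t)). intros t Ht. split.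
    + apply (continuous_comp (fun t => (1, t)) G).
      * apply continuous_C; cbn; split; [apply continuous_const | apply continuous_id].
      * apply HG; lra.
    + exists (fun s => G (s, t)). split; [|split; [reflexivity|]].
      * apply (HG 0 t ltac:(lra) Ht).
      * intros s Hs. destruct (HG s t Hs Ht) as (H1 & H2 & _). split; [|exact H2].
        apply (continuous_comp (fun s => (s, t)) G).
        -- apply continuous_C; cbn; split; [apply continuous_id | apply continuous_const].
        -- exact H1.
Qed.

(** The initial condition at [t = -oo]: near [(0, 0)] the integral stays in the right half-plane
    along whole radii, so its radial logarithm is the principal one, close to [0]. *)
Lemma radial_log_small (b a eps : R) : 0 < b -> 0 < eps ->
  exists d, 0 < d /\ forall q phi, Cmod q < d -> 0 <= phi < d ->
    jfun b q phi <> 0%C /\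
    exists l, radial_log b q phi l /\ Cmod (cexp (RtoC a * l) - 1)%C < eps.
Proof.
  intros Hb Heps.
  assert (Hpos0 : 0 < fst (base (RtoC 0) 0)).
  { apply base_disk. rewrite Cmod_0. lra. }
  set (o := (RtoC 0, 0) : prod_UniformSpace C_UniformSpace R_UniformSpace).
  assert (Hj := jfun_continuous_prod b o Hb Hpos0).
  assert (E0 : jfun b (fst o) (snd o) = 1%C) by (apply jfun_0).
  assert (L1 : locally o (fun p => 0 < fst (jfun b (fst p) (snd p)))).
  { apply (locally_pos (fun p : prod_UniformSpace C_UniformSpace R_UniformSpace => fst (jfun b (fst p) (snd p)))).
    - apply continuous_C in Hj. apply Hj.
    - rewrite E0. cbn. lra. }
  assert (L2 : locally o (fun p => 0 < fst (base (fst p) (snd p)))).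
  { apply (locally_base_pos (fun p : prod_UniformSpace C_UniformSpace R_UniformSpace => fst p) (fun p => snd p)).
    - apply (continuous_fst (U := C_UniformSpace)).
    - apply (continuous_snd (U := C_UniformSpace)).
    - exact Hpos0. }
  assert (L3 : locally o (fun p => Rabs (Cmod (cexp (RtoC a * clog (jfun b (fst p) (snd p))) - 1)%C
      - Cmod (cexp (RtoC a * clog (jfun b (fst o) (snd o))) - 1)%C) < eps)).
  { assert (K : continuous (fun p : prod_UniformSpace C_UniformSpace R_UniformSpace =>
      Cmod (cexp (RtoC a * clog (jfun b (fst p) (snd p))) - 1)%C) o).
    { apply continuous_Cmod, continuous_Cminus; [|apply continuous_const].
      apply continuous_cexp, continuous_Cmult; [apply continuous_const|].
      apply continuous_clog; [rewrite E0; cbn; lra | exact Hj]. }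
    exact (proj1 (continuous_R _ _) K (mkposreal _ Heps)). }
  destruct (filter_and _ _ L1 (filter_and _ _ L2 L3)) as [d Hd].
  exists d. split; [apply cond_pos|]. intros q phi Hq Hp.
  assert (Hall : forall s, 0 <= s <= 1 ->
    0 < fst (jfun b (RtoC s * q)%C phi) /\ 0 < fst (base (RtoC s * q)%C phi) /\
    Cmod (cexp (RtoC a * clog (jfun b (RtoC s * q)%C phi)) - 1)%C < eps).
  { intros s Hs. destruct (Hd ((RtoC s * q)%C, phi)) as (H1 & H2 & H3).
    - assert (M : Cmod (RtoC s * q)%C < d).
      { rewrite Cmod_mult, Cmod_R, Rabs_pos_eq by lra. pose proof (Cmod_ge_0 q). nra. }
      split; [split|].
      + change (Rabs (fst (RtoC s * q)%C - 0) < d). rewrite Rminus_0_r.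
        eapply Rle_lt_trans; [apply Cmod_fst_le | exact M].
      + change (Rabs (snd (RtoC s * q)%C - 0) < d). rewrite Rminus_0_r.
        eapply Rle_lt_trans; [apply Cmod_snd_le | exact M].
      + change (Rabs (phi - 0) < d). rewrite Rminus_0_r, Rabs_pos_eq by lra. lra.
    - cbn [fst snd] in *. rewrite E0, clog_real, ln_1, Cmult_0_r, cexp_0 in H3 by lra.
      rewrite Cmod_diag, Rminus_0_r, Rabs_pos_eq in H3 by apply Cmod_ge_0.
      auto. }
  assert (E1 : (RtoC 1 * q)%C = q) by ring.
  split.
  - intros E. destruct (Hall 1 ltac:(lra)) as [K _]. rewrite E1, E in K. cbn in K. lra.
  - exists (clog (jfun b q phi)). split.
    + exists (fun s => clog (jfun b (RtoC s * q)%C phi)). split; [|split].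
      * rewrite Cmult_0_l, jfun_0, clog_real, ln_1 by lra. reflexivity.
      * now rewrite E1.
      * intros s Hs. destruct (Hall s Hs) as (H1 & H2 & _). split; [|now apply cexp_clog].
        apply continuous_clog; [exact H1|].
        apply (continuous_jfun b (fun s => (RtoC s * q)%C) (fun _ => phi)); auto.
        -- apply continuous_Cmult; [apply continuous_RtoC, continuous_id | apply continuous_const].
        -- apply continuous_const.
    + destruct (Hall 1 ltac:(lra)) as (_ & _ & K). now rewrite E1 in K.
Qed.

Definition nonvanishing (b : R) : Prop :=
  forall q phi, Cmod q < 1 -> 0 < phi < PI / 2 -> jfun b q phi <> 0%C.

Lemma jfun_1_neq_0 (b phi : R) : 0 < b -> 0 < phi < PI / 2 -> jfun b 1 phi <> 0%C.
Proof.
  intros Hb Hp E. pose proof (rot_jfun_im_pos b 0 Hb phi Hp) as K. rewrite E, Cmult_0_r in K. cbn in K. lra.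
Qed.

Lemma jfun_radius_neq_0 (b s phi : R) : 0 < b -> nonvanishing b -> 0 <= s <= 1 -> 0 <= phi < PI / 2 ->
  jfun b (RtoC s * 1)%C phi <> 0%C.
Proof.
  intros Hb Hn Hs Hp. rewrite Cmult_1_r. destruct (Rle_lt_or_eq_dec _ _ (proj1 Hp)) as [L | <-].
  - destruct (Rle_lt_or_eq_dec _ _ (proj2 Hs)) as [L1 | ->].
    + apply Hn; [|lra]. rewrite Cmod_R, Rabs_pos_eq; lra.
    + apply jfun_1_neq_0; [exact Hb | lra].
  - intros E. destruct (jfun_start b s Hb Hs) as [_ K]. rewrite E in K. cbn in K. lra.
Qed.

(** Deformation of the angle from [0] to [phi]. Both expressions are continuous logarithms of
    [jfun b 1 x] on [0 <= x <= phi], since [rot * jfun] is in the upper half-plane for [x > 0] and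
    positive real for [x = 0]; at [x = 0] all integrals along the radius are positive, so the two
    logarithms agree there. *)
Lemma radial_log_1 (b phi : R) : 0 < b -> nonvanishing b -> 0 < phi < PI / 2 ->
  radial_log b 1 phi (slit_log (rot b phi * jfun b 1 phi) - (0, ((1 + 2 * b) * phi)%R))%C.
Proof.
  intros Hb Hn Hp. pose proof PI_RGT_0.
  destruct (path_log b (fun _ => 1%C) (fun x => x) 0 phi Hb) as [l Hl].
  - intros t Ht. split; [apply continuous_const|]. split; [apply continuous_id|]. apply base_1. lra.
  - intros t s Ht Hs. apply jfun_radius_neq_0; auto; lra.
  - assert (Hslit : forall x, 0 <= x <= phi ->
      snd (rot b x * jfun b 1 x)%C <> 0 \/ 0 < fst (rot b x * jfun b 1 x)%C).
    { intros x Hx. destruct (Rle_lt_or_eq_dec _ _ (proj1 Hx)) as [L | <-].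
      - left. pose proof (rot_jfun_im_pos b 0 Hb x ltac:(lra)). lra.
      - right. rewrite rot_0, Cmult_1_l. apply (jfun_start b 1 Hb). lra. }
    assert (E : l phi = (slit_log (rot b phi * jfun b 1 phi) - (0%R, ((1 + 2 * b) * phi)%R))%C).
    { apply (cexp_lift_eq l (fun x => slit_log (rot b x * jfun b 1 x) - (0%R, ((1 + 2 * b) * x)%R))%C 0 phi).
      - intros t Ht. rewrite Rmin_left, Rmax_right in Ht by lra.
        destruct (Hl t Ht) as [H1 H2]. split; [exact H1|]. split.
        + apply continuous_Cminus.
          * apply (continuous_slit_log (fun x => (rot b x * jfun b 1 x)%C)); [now apply Hslit|].
            apply rot_jfun_continuous; [exact Hb | lra].
          * apply continuous_C; cbn; split; [apply continuous_const|].
            apply continuous_Rmult; [apply continuous_const | apply continuous_id].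
        + rewrite (radial_log_exp _ _ _ _ H2), cexp_minus, cexp_slit_log by now apply Hslit.
          fold (rot b t). field. apply cexp_neq_0.
      - rewrite rot_0, Cmult_1_l, Rmult_0_r.
        destruct (jfun_start b 1 Hb ltac:(lra)) as [Is Ip].
        assert (Ej : jfun b 1 0 = RtoC (fst (jfun b 1 0))) by (apply injective_projections; [reflexivity | exact Is]).
        rewrite Ej, slit_log_real by exact Ip.
        destruct (Hl 0 ltac:(lra)) as [_ H2].
        apply (radial_log_unique b 1 0); [exact H2|].
        exists (fun s => RtoC (ln (fst (jfun b (RtoC s * 1)%C 0)))). split; [|split].
        + rewrite Cmult_0_l, jfun_0. cbn. now rewrite ln_1.
        + rewrite Cmult_1_r. unfold RtoC, Cminus, Cplus, Copp; cbn. f_equal; ring.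
        + intros s Hs. rewrite Cmult_1_r. destruct (jfun_start b s Hb Hs) as [Js Jp].
          split.
          * apply continuous_RtoC. apply (continuous_derivable_comp ln).
            -- rewrite Cmult_1_r. auto_derive. exact Jp.
            -- assert (K : continuous (fun s => jfun b (RtoC s * 1)%C 0) s).
               { apply (continuous_jfun b (fun s => (RtoC s * 1)%C) (fun _ => 0)); auto.
                 - apply continuous_Cmult; [apply continuous_RtoC, continuous_id | apply continuous_const].
                 - apply continuous_const.
                 - apply base_scal; [exact Hs|]. apply base_1. lra. }
               apply continuous_C in K. apply K.
          * unfold cexp, RtoC; cbn [fst snd]. rewrite cos_0, sin_0.
            change (s, 0) with (RtoC s). rewrite exp_ln by exact Jp.
            apply injective_projections; cbn [fst snd]; [ring|]. rewrite Js. ring. }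
    rewrite <- E. apply Hl. lra.
Qed.

(** * Trajectories of the Loewner flow *)

Lemma Cmod_lt_1_neq (q : C) : Cmod q < 1 -> (1 - q)%C <> 0%C.
Proof.
  intros H E. assert (q = 1%C).
  { replace q with (1 - (1 - q))%C by ring. rewrite E. ring. }
  subst q. rewrite Cmod_1 in H. lra.
Qed.

Lemma locally_lt (x y : R) : x < y -> locally x (fun u => u < y).
Proof.
  intros H. assert (Hd : 0 < y - x) by lra. exists (mkposreal _ Hd). intros u Hu.
  change (Rabs (u - x) < y - x) in Hu. apply Rabs_def2 in Hu. lra.
Qed.

Lemma is_derive_antiderivative (c : R -> R) (s0 t1 : R) :
  s0 < t1 -> (forall t, t < t1 -> continuous c t) ->
  forall t, t < t1 -> is_derive (fun t => RInt c s0 t) t (c t).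
Proof.
  intros H0 Hc t Ht. apply (is_derive_RInt c _ s0); [|now apply Hc].
  generalize (locally_lt t t1 Ht). apply filter_imp. intros u Hu.
  apply (RInt_correct (V := R_CompleteNormedModule)).
  apply (ex_RInt_continuous (V := R_CompleteNormedModule)). intros z [_ Hz]. apply Hc.
  eapply Rle_lt_trans; [exact Hz|]. now apply Rmax_lub_lt.
Qed.

Lemma cder_antiderivative (c : R -> C) (s0 t1 : R) :
  s0 < t1 -> (forall t, t < t1 -> continuous c t) ->
  exists mu : R -> C, mu s0 = 0%C /\ forall t, t < t1 -> cder mu t (c t).
Proof.
  intros H0 Hc. exists (fun t => (RInt (fun s => fst (c s)) s0 t, RInt (fun s => snd (c s)) s0 t)).
  split.
  - rewrite !RInt_point. reflexivity.
  - intros t Ht. split; cbn [fst snd].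
    + apply (is_derive_antiderivative (fun s => fst (c s)) s0 t1 H0); [|exact Ht].
      intros s Hs. specialize (Hc s Hs). apply continuous_C in Hc. apply Hc.
    + apply (is_derive_antiderivative (fun s => snd (c s)) s0 t1 H0); [|exact Ht].
      intros s Hs. specialize (Hc s Hs). apply continuous_C in Hc. apply Hc.
Qed.

Lemma linear_ode_solution (p mu c : R -> C) (al : C) (s t : R) :
  s <= t -> (forall u, s <= u <= t -> cder mu u (c u)) ->
  (forall u, s <= u <= t -> cder p u (al * c u * p u)%C) ->
  mu s = 0%C -> p t = (p s * cexp (al * mu t))%C.
Proof.
  intros Hst Hmu Hp H0.
  assert (E := cder_0_const (fun u => p u * cexp (- (al * mu u)))%C s t Hst). cbv beta in E.
  rewrite H0, Cmult_0_r in E. replace (- 0)%C with (RtoC 0) in E by ring.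
  rewrite cexp_0, Cmult_1_r in E. rewrite <- E.
  - rewrite <- Cmult_assoc, cexp_opp. ring.
  - intros u Hu. eapply cder_eq.
    + apply cder_mult; [apply Hp, Hu|]. apply cder_cexp, cder_opp, cder_mult; [apply cder_const | apply Hmu, Hu].
    + cbv beta. ring.
Qed.

(** The facts about a Loewner chain on which the flow argument draws, in terms of [b] and without
    reference to a curve. [ch_open] lets a trajectory that survives at [t] continue beyond [t], as a
    derivative at [t] demands; [ch_lim] is the normalization at infinity, one point at a time. *)
Record sle_chain (b T : R) (K : R -> C -> Prop) (g : R -> C -> C) : Prop := {
  ch_mono : forall s t z, s <= t -> t < T -> K s z -> K t z;
  ch_open : forall t z, t < T -> ~ K t z -> exists t1, t < t1 <= T /\ forall s, s < t1 -> ~ K s z;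
  ch_disk : forall t z, t < T -> ~ K t z -> Cmod (g t z) < 1;
  ch_inj : forall t z1 z2, t < T -> ~ K t z1 -> ~ K t z2 -> g t z1 = g t z2 -> z1 = z2;
  ch_surj : forall t u, t < T -> Cmod u < 1 -> exists z, ~ K t z /\ g t z = u;
  ch_cont : forall t z, t < T -> ~ K t z -> continuous (g t) z;
  ch_g0 : forall t, t < T -> g t 0%C = 0%C;
  ch_ode : forall t z, t < T -> ~ K t z ->
    cder (fun s => g s z) t
      (g t z * ((cis ((2 + / b) * angle b T t) + g t z) / (cis ((2 + / b) * angle b T t) - g t z)))%C;
  ch_lim : forall z eps, 0 < eps -> exists M, M < T /\ forall t, t < M ->
    ~ K t z /\ Cmod (g t z * RtoC (exp (- t)) - z)%C < eps
}.

Section Chain.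
Variables (b T : R) (K : R -> C -> Prop) (g : R -> C -> C).
Hypothesis (Hb : 0 < b) (HC : sle_chain b T K g).

Definition drive (t : R) : R := (2 + / b) * angle b T t.
Definition rel (z : C) (t : R) : C := (g t z * cis (- drive t))%C.
(** The common rate of the flow: [scaled] has logarithmic derivative [2 speed], and [along] has
    [-2b speed]. *)
Definition speed (z : C) (t : R) : C := (rel z t / (1 - rel z t))%C.

Lemma g_rel (z : C) (t : R) : g t z = (rel z t * cis (drive t))%C.
Proof.
  unfold rel. rewrite <- Cmult_assoc, (Cmult_comm (cis (- _))), cis_opp_r. ring.
Qed.

Lemma Cmod_rel (z : C) (t : R) : Cmod (rel z t) = Cmod (g t z).
Proof. unfold rel. rewrite Cmod_mult, Cmod_cis. ring. Qed.

Lemma drive_derive (t : R) : t < T -> is_derive drive t ((1 + 2 * b) * tan (angle b T t)).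
Proof.
  intros Ht. unfold drive. evar_last.
  - apply (is_derive_scal (angle b T) t (2 + / b) _ (angle_derive b T Hb t Ht)).
  - unfold scal; cbn; unfold mult; cbn. field. lra.
Qed.

Lemma drive_continuous (t : R) : t < T -> continuous drive t.
Proof.
  intros Ht. apply continuous_Rmult; [apply continuous_const | now apply angle_continuous].
Qed.

Definition alive (z : C) (t1 : R) : Prop := t1 <= T /\ forall s, s < t1 -> ~ K s z.

Section Trajectory.
Variables (z : C) (t1 : R).
Hypothesis (Hz : z <> 0%C) (Hal : alive z t1).

Lemma rel_disk (t : R) : t < t1 -> Cmod (rel z t) < 1.
Proof.
  intros Ht. rewrite Cmod_rel. destruct Hal as [H1 H2]. apply (ch_disk _ _ _ _ HC); [lra | now apply H2].
Qed.


Lemma rel_derive (t : R) : t < t1 ->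
  cder (rel z) t
    (((1 + rel z t) / (1 - rel z t) - (1 + 2 * RtoC b) * (Ci * RtoC (tan (angle b T t)))) * rel z t)%C.
Proof.
  intros Ht. destruct Hal as [H1 H2]. assert (HtT : t < T) by lra.
  assert (Hd := Cmod_lt_1_neq _ (rel_disk t Ht)).
  eapply cder_eq.
  - apply cder_mult; [apply (ch_ode _ _ _ _ HC t z HtT (H2 t Ht))|].
    apply (cder_cis (fun t => - drive t)).
    apply (is_derive_opp (K := R_AbsRing) (V := R_NormedModule)). apply drive_derive, HtT.
  - fold (drive t). cbv beta.
    rewrite (g_rel z t). assert (Hc : cis (drive t) <> 0%C).
    { intros E. pose proof (Cmod_cis (drive t)) as M. rewrite E, Cmod_0 in M. lra. }
    assert (Ei : cis (- drive t) = (/ cis (drive t))%C).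
    { rewrite <- (Cmult_1_r (cis (- drive t))), <- (Cinv_r (cis (drive t))) by exact Hc.
      rewrite Cmult_assoc, (Cmult_comm (cis (- _))), cis_opp_r. ring. }
    rewrite Ei. set (q := rel z t) in *. set (u := cis (drive t)) in *.
    change (opp ((1 + 2 * b) * tan (angle b T t))) with (- ((1 + 2 * b) * tan (angle b T t))).
    rewrite RtoC_opp, !RtoC_mult, RtoC_plus, RtoC_mult.
    assert ((u - q * u)%C <> 0%C).
    { replace (u - q * u)%C with (u * (1 - q))%C by ring. now apply Cmult_neq_0. }
    field. repeat split; try assumption.
Qed.

Lemma rel_continuous (t : R) : t < t1 -> continuous (rel z) t.
Proof. intros Ht. eapply cder_continuous. now apply rel_derive. Qed.

Lemma speed_continuous (t : R) : t < t1 -> continuous (speed z) t.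
Proof.
  intros Ht. apply continuous_Cdiv; [now apply rel_continuous| |now apply Cmod_lt_1_neq, rel_disk].
  apply continuous_Cminus; [apply continuous_const | now apply rel_continuous].
Qed.

Definition along (t : R) : C := jfun b (rel z t) (angle b T t).
Definition scaled (t : R) : C := (g t z * RtoC (exp (- t)))%C.

(** For the [r] of [rel_derive] the boundary term vanishes, because
    [r (1 - q) = (1 + q) - (1+2b) y (1 - q)], and the coefficient of the integral becomes [b - b (1
    + q) / (1 - q) = -2b q / (1 - q)]. *)
Lemma along_derive (t : R) : t < t1 -> cder along t (- RtoC b * (2 * speed z t) * along t)%C.
Proof.
  intros Ht. destruct Hal as [H1 H2]. assert (HtT : t < T) by lra.
  assert (Hd := Cmod_lt_1_neq _ (rel_disk t Ht)).
  eapply cder_eq.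
  - apply (jfun_derive b (rel z)
      (fun t => ((1 + rel z t) / (1 - rel z t) - (1 + 2 * RtoC b) * (Ci * RtoC (tan (angle b T t))))%C)
      (angle b T) t Hb).
    + generalize (locally_lt t t1 Ht). apply filter_imp. exact rel_derive.
    + generalize (locally_lt t T HtT). apply filter_imp. intros u Hu. now apply angle_derive.
    + assert (Hr := rel_continuous t Ht).
      apply continuous_Cminus.
      * apply continuous_Cdiv; [| |exact Hd];
          [apply continuous_Cplus | apply continuous_Cminus]; auto; apply continuous_const.
      * apply continuous_Cmult; [apply continuous_const|].
        apply continuous_Cmult; [apply continuous_const|].
        apply continuous_RtoC, (continuous_tan (angle b T)).
        -- pose proof (cos_angle_pos b T Hb t HtT). lra.
        -- now apply angle_continuous.
    + apply base_disk. now apply rel_disk.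
    + pose proof (cos_angle_pos b T Hb t HtT). lra.
  - cbv zeta beta. unfold kern, speed. fold (along t). set (y := (Ci * _)%C). field. exact Hd.
Qed.

Lemma scaled_derive (t : R) : t < t1 -> cder scaled t (1 * (2 * speed z t) * scaled t)%C.
Proof.
  intros Ht. destruct Hal as [H1 H2]. assert (HtT : t < T) by lra.
  assert (Hd := Cmod_lt_1_neq _ (rel_disk t Ht)).
  assert (He : cder (fun t => RtoC (exp (- t))) t (RtoC (- exp (- t)))).
  { apply cder_RtoC. auto_derive; [exact I | ring]. }
  eapply cder_eq.
  - apply cder_mult; [apply (ch_ode _ _ _ _ HC t z HtT (H2 t Ht)) | exact He].
  - fold (drive t). cbv beta. unfold scaled, speed. rewrite (g_rel z t), RtoC_opp.
    set (q := rel z t) in *. set (u := cis (drive t)).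
    assert (Hc : u <> 0%C).
    { intros E. pose proof (Cmod_cis (drive t)) as M. fold u in M. rewrite E, Cmod_0 in M. lra. }
    assert ((u - q * u)%C <> 0%C).
    { replace (u - q * u)%C with (u * (1 - q))%C by ring. now apply Cmult_neq_0. }
    field. split; assumption.
Qed.

Lemma start_close (d : R) : 0 < d -> forall t, t < t1 -> exists s, s <= t /\
  Cmod (rel z s) < d /\ 0 <= angle b T s < d /\ Cmod (scaled s - z) < d.
Proof.
  intros Hd t Ht. destruct Hal as [H1 H2].
  set (d' := Rmin d 1). assert (Hd' : 0 < d') by (unfold d'; apply Rmin_glb_lt; lra).
  assert (Hd1 : d' <= d) by apply Rmin_l. assert (Hd2 : d' <= 1) by apply Rmin_r.
  destruct (ch_lim _ _ _ _ HC z d' Hd') as [M1 [HM1 HL1]].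
  destruct (angle_lim b T Hb d Hd) as [M2 [HM2 HL2]].
  pose proof (Cmod_ge_0 z) as Hzp.
  (* Before this time [e^s < d / (|z| + 1)], which with [|scaled s| < |z| + 1] gives
     [|g_s(z)| < d]. *)
  set (M3 := ln (d / (Cmod z + 1))).
  set (s := Rmin (Rmin M1 M2) (Rmin t M3) - 1).
  assert (Rmin (Rmin M1 M2) (Rmin t M3) <= Rmin M1 M2) by apply Rmin_l.
  assert (Rmin (Rmin M1 M2) (Rmin t M3) <= Rmin t M3) by apply Rmin_r.
  pose proof (Rmin_l M1 M2). pose proof (Rmin_r M1 M2).
  pose proof (Rmin_l t M3). pose proof (Rmin_r t M3).
  assert (s < M1 /\ s < M2 /\ s < t /\ s < M3) as (S1 & S2 & S3 & S4) by (unfold s; lra).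
  exists s. destruct (HL1 s S1) as [_ HL]. fold (scaled s) in HL.
  split; [lra|]. split; [|split].
  - rewrite Cmod_rel.
    assert (E : g s z = (scaled s * RtoC (exp s))%C).
    { unfold scaled. rewrite <- Cmult_assoc, <- RtoC_mult, <- exp_plus.
      replace (- s + s) with 0 by ring. rewrite exp_0. ring. }
    rewrite E, Cmod_mult, Cmod_R, Rabs_pos_eq by (left; apply exp_pos).
    assert (Hsc : Cmod (scaled s) < Cmod z + 1).
    { replace (scaled s) with (z + (scaled s - z))%C by ring.
      eapply Rle_lt_trans; [apply Cmod_triangle|]. lra. }
    assert (He : exp s < d / (Cmod z + 1)).
    { rewrite <- (exp_ln (d / (Cmod z + 1))) by (apply Rdiv_lt_0_compat; lra). now apply exp_increasing. }
    replace d with ((Cmod z + 1) * (d / (Cmod z + 1))) by (field; lra).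
    pose proof (Cmod_ge_0 (scaled s)). pose proof (exp_pos s).
    apply Rmult_le_0_lt_compat; lra.
  - split; [|now apply HL2]. pose proof (angle_bound b T Hb s ltac:(lra)). lra.
  - lra.
Qed.

(** A single [mu] drives both quantities, with coefficients [-b] and [1]; this is conservation of
    [scaled ^ b * along] in logarithmic form. *)
Lemma trajectory_exp (s t : R) : s <= t -> t < t1 -> exists mu : R -> C, mu s = 0%C /\
  (forall u, s <= u <= t -> continuous mu u) /\
  (forall u, s <= u <= t -> along u = (along s * cexp (- RtoC b * mu u))%C) /\
  scaled t = (scaled s * cexp (mu t))%C.
Proof.
  intros Hst Ht.
  destruct (cder_antiderivative (fun t => (2 * speed z t)%C) s t1 ltac:(lra)) as [mu [H0 Hmu]].
  { intros u Hu. apply continuous_Cmult; [apply continuous_const | now apply speed_continuous]. }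
  exists mu. split; [exact H0|]. split; [|split].
  - intros u Hu. eapply cder_continuous, Hmu. lra.
  - intros u Hu. apply (linear_ode_solution along mu (fun t => (2 * speed z t)%C)); [lra| | |exact H0].
    + intros v Hv. apply Hmu. lra.
    + intros v Hv. apply along_derive. lra.
  - rewrite (linear_ode_solution scaled mu (fun t => (2 * speed z t)%C) 1 s t); [|lra| | |exact H0].
    + do 2 f_equal. ring.
    + intros v Hv. apply Hmu. lra.
    + intros v Hv. apply scaled_derive. lra.
Qed.

Lemma along_neq_0 (t : R) : t < t1 -> along t <> 0%C.
Proof.
  intros Ht. destruct (radial_log_small b 1 1 Hb Rlt_0_1) as [d [Hd Hsm]].
  destruct (start_close d Hd t Ht) as (s & Hs & Hq & Hp & _).
  destruct (Hsm _ _ Hq Hp) as [Hj _]. fold (along s) in Hj.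
  destruct (trajectory_exp s t Hs Ht) as (mu & _ & _ & E & _).
  rewrite (E t) by lra. apply Cmult_neq_0; [exact Hj | apply cexp_neq_0].
Qed.

End Trajectory.

Lemma chain_nonvanishing : nonvanishing b.
Proof.
  intros q phi Hq Hp. destruct (angle_surj b T Hb phi Hp) as [t [Ht <-]].
  destruct (classic (q = 0%C)) as [-> | Hq0].
  { rewrite jfun_0. intros E. injection E. lra. }
  destruct (ch_surj _ _ _ _ HC t (q * cis (drive t))%C Ht) as [z [Hz E]].
  { rewrite Cmod_mult, Cmod_cis. lra. }
  destruct (ch_open _ _ _ _ HC t z Ht Hz) as [t1 [Ht1 Hal]].
  assert (Er : rel z t = q).
  { unfold rel. rewrite E, <- Cmult_assoc, cis_opp_r. ring. }
  assert (Hz0 : z <> 0%C).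
  { intros ->. apply Hq0. rewrite <- Er. unfold rel. rewrite (ch_g0 _ _ _ _ HC t Ht). ring. }
  rewrite <- Er. fold (along z t). apply (along_neq_0 z t1); [split; [lra | exact Hal] | lra].
Qed.

Lemma jfun_disk_neq_0 (q : C) (s t : R) : t < T -> Cmod q < 1 -> 0 <= s <= 1 ->
  jfun b (RtoC s * q)%C (angle b T t) <> 0%C.
Proof.
  intros Ht Hq Hs. apply chain_nonvanishing; [|now apply angle_bound].
  rewrite Cmod_mult, Cmod_R, Rabs_pos_eq by lra. pose proof (Cmod_ge_0 q). nra.
Qed.

(** The right-hand side keeps its value when [t] is moved back along the trajectory. At a very early
    time [s] the factor [scaled] is near [z] and the exponential near [1], so it differs from [z] by
    an arbitrarily small amount. *)
Lemma chain_position (z : C) (t1 t : R) (l : C) :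
  alive z t1 -> t < t1 -> radial_log b (rel z t) (angle b T t) l ->
  z = (scaled z t * cexp (RtoC (/ b) * l))%C.
Proof.
  intros Hal Ht Hl.
  set (v := (scaled z t * cexp (RtoC (/ b) * l))%C).
  assert (Hv : forall eps, 0 < eps -> eps < 1 -> Cmod (v - z) <= eps * (2 + Cmod z)).
  { intros eps He He1.
    destruct (radial_log_small b (/ b) eps Hb He) as [d0 [Hd0 Hsm]].
    set (d := Rmin d0 eps). assert (Hd : 0 < d) by (unfold d; now apply Rmin_glb_lt).
    assert (d <= d0) by apply Rmin_l. assert (d <= eps) by apply Rmin_r.
    destruct (start_close z t1 Hal d Hd t Ht) as (s & Hs & Hq & Hp & Hsc).
    destruct (Hsm (rel z s) (angle b T s)) as [_ [l0 [Hl0 Hc0]]]; [lra|lra|].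
    destruct (trajectory_exp z t1 Hal s t Hs Ht) as (mu & Hmu0 & Hmuc & Halong & Hscal).
    destruct Hal as [HtT Hal'].
    destruct (path_log b (rel z) (angle b T) s t Hb) as [ll Hll].
    { intros u Hu. split; [|split].
      - apply (rel_continuous z t1 (conj HtT Hal')). lra.
      - apply angle_continuous; [exact Hb | lra].
      - apply base_disk, (rel_disk z t1 (conj HtT Hal')). lra. }
    { intros u x Hu Hx. apply jfun_disk_neq_0; [lra | | exact Hx].
      apply (rel_disk z t1 (conj HtT Hal')). lra. }
    assert (E0 : ll s = l0) by (apply (radial_log_unique b (rel z s) (angle b T s)); [apply Hll; lra | exact Hl0]).
    assert (E1 : ll t = l) by (apply (radial_log_unique b (rel z t) (angle b T t)); [apply Hll; lra | exact Hl]).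
    (* Both sides, as functions of time, are continuous logarithms of [along] on [[s, t]] with the
       same value at [s]; hence the radial branch follows the flow without jumps. *)
    assert (E2 : ll t = (ll s - RtoC b * mu t)%C).
    { apply (cexp_lift_eq ll (fun u => ll s - RtoC b * mu u)%C s t).
      - intros u Hu. rewrite Rmin_left, Rmax_right in Hu by lra. destruct (Hll u Hu) as [H1 H2].
        split; [exact H1|]. split.
        + apply continuous_Cminus; [apply continuous_const|].
          apply continuous_Cmult; [apply continuous_const | now apply Hmuc].
        + rewrite (radial_log_exp _ _ _ _ H2). fold (along z u). rewrite Halong by exact Hu.
          unfold Cminus. rewrite cexp_plus. rewrite (radial_log_exp b (rel z s) (angle b T s) (ll s)) by (apply Hll; lra).
          unfold along. f_equal. f_equal. ring.
      - rewrite Hmu0. ring. }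
    assert (Ev : v = (scaled z s * cexp (RtoC (/ b) * l0))%C).
    { unfold v. rewrite <- E1, E2, E0, Hscal.
      replace (RtoC (/ b) * (l0 - RtoC b * mu t))%C with (RtoC (/ b) * l0 - mu t)%C.
      - rewrite cexp_minus. field. apply cexp_neq_0.
      - rewrite RtoC_inv by lra. field. intros X. apply RtoC_inj in X. lra. }
    rewrite Ev. set (c := cexp (RtoC (/ b) * l0)) in *. set (y := scaled z s) in *.
    replace (y * c - z)%C with ((y - z) * c + z * (c - 1))%C by ring.
    assert (Hc2 : Cmod c <= 1 + eps).
    { replace c with (1 + (c - 1))%C by ring. eapply Rle_trans; [apply Cmod_triangle|]. rewrite Cmod_1. lra. }
    eapply Rle_trans; [apply Cmod_triangle|]. rewrite !Cmod_mult.
    pose proof (Cmod_ge_0 z). pose proof (Cmod_ge_0 (y - z)). pose proof (Cmod_ge_0 (c - 1)). pose proof (Cmod_ge_0 c).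
    assert (Cmod (y - z) * Cmod c <= eps * 2) by (apply Rmult_le_compat; lra).
    assert (Cmod z * Cmod (c - 1) <= Cmod z * eps) by (apply Rmult_le_compat_l; lra). lra. }
  assert (Hvz : Cmod (v - z) = 0).
  { pose proof (Cmod_ge_0 (v - z)). pose proof (Cmod_ge_0 z).
    destruct (Rle_lt_or_eq_dec _ _ H) as [L|]; [|congruence]. exfalso.
    set (e := Rmin (1 / 2) (Cmod (v - z) / (2 * (2 + Cmod z)))).
    assert (He : 0 < e). { unfold e. apply Rmin_glb_lt; [lra|]. apply Rdiv_lt_0_compat; lra. }
    assert (e <= 1 / 2) by apply Rmin_l.
    assert (e <= Cmod (v - z) / (2 * (2 + Cmod z))) by apply Rmin_r.
    specialize (Hv e He ltac:(lra)).
    assert (e * (2 + Cmod z) <= Cmod (v - z) / (2 * (2 + Cmod z)) * (2 + Cmod z)) by (apply Rmult_le_compat_r; lra).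
    replace (Cmod (v - z) / (2 * (2 + Cmod z)) * (2 + Cmod z)) with (Cmod (v - z) / 2) in * by (field; lra). lra. }
  symmetry. now apply Cmod_minus_eq_0.
Qed.

End Chain.

(** * Swallowed points *)

Lemma first_hit (f : R -> R) (x y c : R) :
  x <= y -> (forall t, x <= t <= y -> continuous f t) -> c < f x -> f y <= c ->
  exists v, x < v <= y /\ f v = c /\ forall u, x <= u < v -> c < f u.
Proof.
  intros Hxy Hc Hx Hy.
  set (S := fun s => x <= s <= y /\ forall u, x <= u <= s -> c < f u).
  assert (Sx : S x) by (split; [lra | intros u Hu; replace u with x by lra; exact Hx]).
  destruct (completeness S) as [v [Hub Hlub]].
  { exists y. intros s [Hs _]. lra. }
  { now exists x. }
  assert (Hxv : x <= v) by now apply Hub.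
  assert (Hvy : v <= y) by (apply Hlub; intros s [Hs _]; lra).
  assert (Hbelow : forall u, x <= u < v -> c < f u).
  { intros u Hu. apply NNPP. intros N. apply (Rlt_not_le v u); [lra|]. apply Hlub.
    intros s [Hs1 Hs2]. apply Rnot_lt_le. intros L. apply N. apply Hs2. lra. }
  assert (Hcv := Hc v (conj Hxv Hvy)).
  destruct (Rtotal_order (f v) c) as [L | [E | L]].
  - exfalso. assert (x < v) by (destruct Hxv as [|E]; [assumption | subst; lra]).
    destruct (continuous_close_left f x v (c - f v) Hcv ltac:(lra) ltac:(lra)) as [u [Hu Hd]].
    apply Rabs_def2 in Hd. specialize (Hbelow u Hu). lra.
  - exists v. split; [|auto]. split; [|exact Hvy]. destruct Hxv as [|E']; [assumption | subst; lra].
  - exfalso. destruct (continuous_close f v (f v - c) Hcv ltac:(lra)) as [d [Hd0 Hd]].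
    assert (v < y) by (destruct Hvy as [|E]; [assumption | subst; lra]).
    set (u := Rmin y (v + d / 2)).
    assert (v < u) by (unfold u; apply Rmin_glb_lt; lra).
    assert (u <= y) by apply Rmin_l. assert (u <= v + d / 2) by apply Rmin_r.
    apply (Rlt_not_le u v); [assumption|]. apply Hub. split; [lra|]. intros s Hs.
    destruct (Rlt_le_dec s v) as [Ls | Ls]; [apply Hbelow; lra|].
    specialize (Hd s ltac:(apply Rabs_def1; lra)). apply Rabs_def2 in Hd. lra.
Qed.

(** Gronwall from below: [S e^(ct)] is nondecreasing. It prevents positive quantities from reaching
    [0] in finite time. *)
Lemma exp_growth_bound (S dS : R -> R) (c x y : R) :
  x <= y -> (forall t, x <= t <= y -> is_derive S t (dS t) /\ - c * S t <= dS t) ->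
  S x * exp (- (c * (y - x))) <= S y.
Proof.
  intros Hxy H.
  destruct (derive_le_const (fun t => S t * exp (c * t)) (fun t => (dS t + c * S t) * exp (c * t)) x y Hxy)
    as [t [Ht E]].
  { intros t Ht. destruct (H t Ht) as [Hd _]. evar_last.
    - apply Derive.is_derive_mult; [exact Hd|]. auto_derive; [exact I | reflexivity].
    - cbn. ring. }
  destruct (H t Ht) as [_ Hle].
  assert (0 <= (dS t + c * S t) * exp (c * t) * (y - x)).
  { pose proof (exp_pos (c * t)). apply Rmult_le_pos; [apply Rmult_le_pos|]; lra. }
  assert (Hm : S x * exp (c * x) <= S y * exp (c * y)) by lra.
  apply (Rmult_le_reg_r (exp (c * y))); [apply exp_pos|].
  rewrite Rmult_assoc, <- exp_plus. replace (- (c * (y - x)) + c * y) with (c * x) by ring. exact Hm.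
Qed.

Lemma lipschitz_left_limit (f : R -> C) (x y M : R) : x < y -> 0 < M ->
  (forall u v, x <= u -> u <= v -> v < y -> Cmod (f v - f u)%C <= M * (v - u)) ->
  exists l, forall eps, 0 < eps -> exists r, x <= r < y /\
    forall u, r <= u < y -> Cmod (f u - l)%C < eps.
Proof.
  intros Hxy HM H.
  assert (Hr : forall e, 0 < e -> exists r, x <= r < y /\ M * (y - r) <= e).
  { intros e He. assert (0 < e / M) by (apply Rdiv_lt_0_compat; lra).
    exists (Rmax x (y - e / M)). pose proof (Rmax_l x (y - e / M)). pose proof (Rmax_r x (y - e / M)).
    split; [split; [assumption | apply Rmax_lub_lt; lra]|].
    replace e with (M * (e / M)) at 2 by (field; lra). apply Rmult_le_compat_l; lra. }
  destruct (proj1 (filterlim_locally_cauchy (U := C_R_CompleteNormedModule) (F := at_left y) f)) as [l Hl].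
  - intros eps. destruct (Hr (eps / 2)) as [r [Hrxy Hre]]; [pose proof (cond_pos eps); lra|].
    exists (fun u => r <= u < y). split.
    + assert (Hd : 0 < y - r) by lra. exists (mkposreal _ Hd). intros u Hu Huy.
      change (Rabs (u - y) < y - r) in Hu. apply Rabs_def2 in Hu. lra.
    + assert (W : forall u v, r <= u -> u <= v -> v < y -> Cmod (f v - f u)%C < eps).
      { intros u v H1 H2 H3. eapply Rle_lt_trans; [apply H; lra|].
        assert (M * (v - u) <= M * (y - r)) by (apply Rmult_le_compat_l; lra).
        pose proof (cond_pos eps). lra. }
      assert (W' : forall u v, r <= u < y -> r <= v < y -> Cmod (f v - f u)%C < eps).
      { intros u v Hu Hv. destruct (Rle_dec u v); [apply W; lra|].
        replace (f v - f u)%C with (- (f u - f v))%C by ring. rewrite Cmod_opp. apply W; lra. }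
      intros u v Hu Hv. specialize (W' u v Hu Hv).
      split; (eapply Rle_lt_trans; [|exact W']); [exact (Cmod_fst_le (f v - f u)%C) | exact (Cmod_snd_le (f v - f u)%C)].
  - exists l. intros eps Heps. assert (He2 : 0 < eps / 2) by lra.
    destruct (proj1 (filterlim_locally _ _) Hl (mkposreal _ He2)) as [d Hd]. pose proof (cond_pos d).
    exists (Rmax x (y - d / 2)). pose proof (Rmax_l x (y - d / 2)). pose proof (Rmax_r x (y - d / 2)).
    split; [split; [assumption | apply Rmax_lub_lt; lra]|]. intros u Hu.
    destruct (Hd u) as [B1 B2]; [change (Rabs (u - y) < d); apply Rabs_def1; lra | lra |].
    eapply Rle_lt_trans; [apply Cmod_le_sum|].
    change (Rabs (fst (f u - l)%C) < eps / 2) in B1. change (Rabs (snd (f u - l)%C) < eps / 2) in B2. lra.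
Qed.

(** * Estimates for the Loewner vector field *)

Definition Cdot (z w : C) : R := fst z * fst w + snd z * snd w.
Definition Cnormsq (z : C) : R := Cdot z z.

Lemma Cnormsq_Cmod (z : C) : Cnormsq z = Cmod z * Cmod z.
Proof.
  unfold Cnormsq, Cdot, Cmod. rewrite sqrt_sqrt by (apply Rplus_le_le_0_compat; apply pow2_ge_0). ring.
Qed.

Lemma Cdot_le (z w : C) : Rabs (Cdot z w) <= Cmod z * Cmod w.
Proof.
  replace (Cdot z w) with (fst (z * (fst w, (- snd w)%R))%C) by (unfold Cdot; cbn; ring).
  eapply Rle_trans; [apply Cmod_fst_le|]. rewrite Cmod_mult.
  apply Rmult_le_compat_l; [apply Cmod_ge_0|]. right. unfold Cmod; cbn [fst snd]. f_equal. ring.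
Qed.

Lemma Cnormsq_derive (f : R -> C) (t : R) (l : C) :
  cder f t l -> is_derive (fun t => Cnormsq (f t)) t (2 * Cdot (f t) l).
Proof.
  intros [H1 H2]. evar_last.
  - apply (is_derive_plus (K := R_AbsRing) (V := R_NormedModule));
      apply Derive.is_derive_mult; eassumption.
  - unfold Cdot. cbn. unfold plus; cbn. ring.
Qed.

Lemma Cdot_derive (w : C) (f : R -> C) (t : R) (l : C) :
  cder f t l -> is_derive (fun t => Cdot w (f t)) t (Cdot w l).
Proof.
  intros [H1 H2]. unfold Cdot. apply (is_derive_plus (K := R_AbsRing) (V := R_NormedModule)).
  - apply (is_derive_scal (fun t => fst (f t)) t (fst w) _ H1).
  - apply (is_derive_scal (fun t => snd (f t)) t (snd w) _ H2).
Qed.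

Lemma Cdot_minus (w x y : C) : Cdot w (x - y)%C = Cdot w x - Cdot w y.
Proof. unfold Cdot; cbn; ring. Qed.

(* Projecting on the direction [w] of the chord keeps the sharp constant. *)
Lemma Cmod_mean_value (f df : R -> C) (x y M : R) : x <= y ->
  (forall t, x <= t <= y -> cder f t (df t) /\ Cmod (df t) <= M) ->
  Cmod (f y - f x)%C <= M * (y - x).
Proof.
  intros Hxy H. set (w := (f y - f x)%C).
  destruct (derive_le_const (fun t => Cdot w (f t)) (fun t => Cdot w (df t)) x y Hxy) as [c [Hc E]].
  { intros t Ht. apply Cdot_derive, H, Ht. }
  rewrite <- Cdot_minus in E. fold w in E. change (Cdot w w) with (Cnormsq w) in E. rewrite Cnormsq_Cmod in E.
  pose proof (Cmod_ge_0 w) as Hw.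
  assert (Hd : Cdot w (df c) <= Cmod w * M).
  { eapply Rle_trans; [apply Rle_abs|]. eapply Rle_trans; [apply Cdot_le|].
    apply Rmult_le_compat_l; [exact Hw | now apply H]. }
  assert (Hm : Cmod w * Cmod w <= Cmod w * (M * (y - x))).
  { rewrite E, <- Rmult_assoc. apply Rmult_le_compat_r; lra. }
  destruct Hw as [Hw | <-].
  - now apply Rmult_le_reg_l in Hm.
  - destruct (H x ltac:(lra)) as [_ HM]. pose proof (Cmod_ge_0 (df x)). apply Rmult_le_pos; lra.
Qed.

Definition loewner_field (u x : C) : C := (x * ((u + x) / (u - x)))%C.

Lemma Cmod_1_neq_disk (u x : C) : Cmod u = 1 -> Cmod x < 1 -> (u - x)%C <> 0%C.
Proof.
  intros Hu Hx E. assert (u = x). { replace u with (x + (u - x))%C by ring. rewrite E. ring. }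
  subst. lra.
Qed.

(** For [|u| = 1] the real part of [(u + x) / (u - x)] is the Poisson kernel
    [(1 - |x|^2) / |u - x|^2]. *)
Lemma Cdot_field (u x : C) : Cmod u = 1 -> (u - x)%C <> 0%C ->
  Cdot x (loewner_field u x) = Cnormsq x * (1 - Cnormsq x) / Cnormsq (u - x)%C.
Proof.
  intros Hu Hn.
  assert (Hu2 : fst u * fst u + snd u * snd u = 1).
  { pose proof (Cnormsq_Cmod u) as E. rewrite Hu in E. unfold Cnormsq, Cdot in E. lra. }
  assert (Hd : Cnormsq (u - x)%C <> 0).
  { rewrite Cnormsq_Cmod. apply Cmod_gt_0 in Hn. nra. }
  unfold loewner_field, Cdiv, Cinv. unfold Cnormsq, Cdot in *.
  destruct u as [a c], x as [p q]; cbn [fst snd Cplus Cminus Copp Cmult] in *.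
  apply (Rmult_eq_reg_r ((a + - p) * (a + - p) + (c + - q) * (c + - q))); [|exact Hd].
  transitivity ((p * p + q * q) * (a * a + c * c - (p * p + q * q))).
  - cbn. field. intros X; apply Hd; rewrite <- X; cbn; ring.
  - rewrite Hu2. cbn. field. exact Hd.
Qed.

(** The field is [-x - 2u + 2u^2 / (u - x)], which makes its divided difference explicit. At
    distance at least [e] from the pole it gives the Lipschitz constant [1 + 2 / e^2]. *)
Lemma field_minus (u x y : C) : (u - x)%C <> 0%C -> (u - y)%C <> 0%C ->
  (loewner_field u x - loewner_field u y)%C = ((x - y) * (2 * (u * u) / ((u - x) * (u - y)) - 1))%C.
Proof. intros Hx Hy. unfold loewner_field. now field. Qed.

Section Hitting.
Variables (b T : R) (K : R -> C -> Prop) (g : R -> C -> C).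
Hypothesis (Hb : 0 < b) (HC : sle_chain b T K g).

Let U (t : R) : C := cis (drive b T t).

Lemma Cmod_driving (t : R) : Cmod (U t) = 1.
Proof. apply Cmod_cis. Qed.

Lemma ode_field (t : R) (z : C) : t < T -> ~ K t z -> cder (fun s => g s z) t (loewner_field (U t) (g t z)).
Proof. exact (ch_ode _ _ _ _ HC t z). Qed.

Lemma driving_continuous (t : R) : t < T -> continuous U t.
Proof. intros Ht. apply continuous_cis. now apply drive_continuous. Qed.

(** By the Poisson kernel formula [1 - |g|^2] decays at relative rate at most [2 / e^2], so a
    solution that stays away from the driving point cannot reach the unit circle in finite time. *)
Lemma solution_modulus_bound (z : C) (s t e : R) :
  s <= t -> t < T -> ~ K t z -> 0 < e ->
  (forall u, s <= u <= t -> e <= Cmod (U u - g u z)%C) ->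
  (1 - Cnormsq (g s z)) * exp (- (2 / (e * e) * (t - s))) <= 1 - Cnormsq (g t z).
Proof.
  intros Hst Ht Hz He Hfar.
  apply (exp_growth_bound (fun u => 1 - Cnormsq (g u z)) (fun u => - (2 * Cdot (g u z) (loewner_field (U u) (g u z))))); [exact Hst|].
  intros u Hu. assert (HuT : u < T) by lra.
  assert (Hzu : ~ K u z) by (intros X; apply Hz; apply (ch_mono _ _ _ _ HC u t); auto; lra).
  assert (Hd := ch_disk _ _ _ _ HC u z HuT Hzu).
  assert (Hn := Cmod_1_neq_disk (U u) (g u z) (Cmod_cis _) Hd).
  split.
  - evar_last.
    + apply (is_derive_minus (K := R_AbsRing) (V := R_NormedModule));
        [apply (is_derive_const (K := R_AbsRing) (V := R_NormedModule)) | apply Cnormsq_derive, ode_field; assumption].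
    + unfold minus, plus, opp, zero; cbn. ring.
  - rewrite Cdot_field by (apply Cmod_cis || exact Hn).
    specialize (Hfar u Hu). pose proof (Cmod_ge_0 (g u z)) as Hg0.
    set (n := Cnormsq (g u z)). assert (Hn1 : 0 <= n < 1) by (unfold n; rewrite Cnormsq_Cmod; nra).
    set (D := Cnormsq (U u - g u z)%C). assert (HD : e * e <= D) by (unfold D; rewrite Cnormsq_Cmod; nra).
    assert (He2 : 0 < e * e) by nra.
    assert (n * (1 - n) / D <= (1 - n) / (e * e)).
    { apply Rmult_le_compat; [nra | left; apply Rinv_0_lt_compat; lra | nra | apply Rinv_le_contravar; lra]. }
    replace (- (2 / (e * e)) * (1 - n)) with (- (2 * ((1 - n) / (e * e)))) by (field; lra). lra.
Qed.

(** Away from the singularity the distance of two solutions shrinks at most exponentially. If they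
    come together as time increases to [tau], they coincide at time [s], and injectivity of [g s]
    identifies the starting points. *)
Lemma solution_unique_backward (z z' : C) (s tau e : R) :
  s < tau -> tau < T -> alive T K z tau -> alive T K z' tau -> 0 < e ->
  (forall u, s <= u < tau -> e <= Cmod (U u - g u z)%C /\ e <= Cmod (U u - g u z')%C) ->
  (forall eps, 0 < eps -> exists u, s <= u < tau /\ Cmod (g u z - g u z')%C < eps) ->
  z = z'.
Proof.
  intros Hst Htau [_ Hz] [_ Hz'] He Hfar Hlim.
  assert (HsT : s < T) by lra.
  apply (ch_inj _ _ _ _ HC s); auto.
  set (dd := fun u => (g u z - g u z')%C). set (L := 1 + 2 / (e * e)).
  assert (He2 : 0 < e * e) by nra.
  assert (HL : 0 < L) by (unfold L; assert (0 < 2 / (e * e)) by (apply Rdiv_lt_0_compat; lra); lra).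
  assert (Hgrow : forall u, s <= u < tau -> Cnormsq (dd s) * exp (- (2 * L * (u - s))) <= Cnormsq (dd u)).
  { intros u Hu. apply (exp_growth_bound (fun v => Cnormsq (dd v))
      (fun v => 2 * Cdot (dd v) (loewner_field (U v) (g v z) - loewner_field (U v) (g v z'))%C)); [lra|].
    intros v Hv. assert (HvT : v < T) by lra. destruct (Hfar v ltac:(lra)) as [F1 F2].
    assert (Hd1 := ch_disk _ _ _ _ HC v z HvT (Hz v ltac:(lra))).
    assert (Hd2 := ch_disk _ _ _ _ HC v z' HvT (Hz' v ltac:(lra))).
    assert (Hn1 := Cmod_1_neq_disk (U v) (g v z) (Cmod_cis _) Hd1).
    assert (Hn2 := Cmod_1_neq_disk (U v) (g v z') (Cmod_cis _) Hd2).
    split.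
    - apply Cnormsq_derive, cder_minus; apply ode_field; auto; apply Hz || apply Hz'; lra.
    - rewrite field_minus by assumption. fold (dd v).
      assert (HM : Cmod (2 * (U v * U v) / ((U v - g v z) * (U v - g v z')) - 1)%C <= L).
      { unfold Cminus at 1. eapply Rle_trans; [apply Cmod_triangle|]. rewrite Cmod_opp, Cmod_1.
        rewrite Cmod_div by now apply Cmult_neq_0. rewrite !Cmod_mult, !Cmod_driving, Cmod_R, Rabs_pos_eq by lra.
        unfold L. rewrite Rplus_comm. apply Rplus_le_compat_l. rewrite !Rmult_1_r.
        apply Rmult_le_compat_l; [lra|]. apply Rinv_le_contravar; [exact He2|].
        apply Rmult_le_compat; lra. }
      pose proof (Cdot_le (dd v) (dd v * (2 * (U v * U v) / ((U v - g v z) * (U v - g v z')) - 1))%C) as Hdot.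
      set (w := (_ / _ - 1)%C) in *.
      rewrite Cmod_mult in Hdot. rewrite Cnormsq_Cmod. pose proof (Cmod_ge_0 (dd v)) as H0.
      assert (Cmod (dd v) * (Cmod (dd v) * Cmod w) <= Cmod (dd v) * (Cmod (dd v) * L)).
      { apply Rmult_le_compat_l; [exact H0|]. now apply Rmult_le_compat_l. }
      apply Rabs_le_between in Hdot. lra. }
  assert (H0 : Cnormsq (dd s) <= 0).
  { apply Rnot_lt_le. intros Hp.
    set (c := Cnormsq (dd s) * exp (- (2 * L * (tau - s)))).
    assert (Hc : 0 < c) by (apply Rmult_lt_0_compat; [exact Hp | apply exp_pos]).
    (* A modulus below both [1] and [c] has its square below [c], against the lower bound for the
       squared distance. *)
    destruct (Hlim (Rmin 1 c)) as [u [Hu Hlt]]; [apply Rmin_glb_lt; lra|].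
    assert (Rmin 1 c <= 1) by apply Rmin_l. assert (Rmin 1 c <= c) by apply Rmin_r.
    specialize (Hgrow u Hu). fold (dd u) in Hlt.
    assert (c <= Cnormsq (dd s) * exp (- (2 * L * (u - s)))).
    { apply Rmult_le_compat_l; [lra|]. left. apply exp_increasing. 
      assert (2 * L * (u - s) < 2 * L * (tau - s)) by (apply Rmult_lt_compat_l; lra). lra. }
    rewrite (Cnormsq_Cmod (dd u)) in Hgrow. pose proof (Cmod_ge_0 (dd u)).
    assert (Cmod (dd u) * Cmod (dd u) <= 1 * Cmod (dd u)) by (apply Rmult_le_compat_r; lra). lra. }
  rewrite Cnormsq_Cmod in H0. assert (Hm : Cmod (dd s) = 0) by (destruct (Cmod_ge_0 (dd s)); [nra | congruence]).
  now apply Cmod_minus_eq_0.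
Qed.

(* Otherwise [g s z] would stay away from the singularity, converge inside the
   disk, and agree with the trajectory of a point that survives at time [tau]. *)
Lemma swallowed_limit (z : C) (tau : R) : tau < T -> alive T K z tau -> K tau z ->
  forall d, 0 < d -> exists del, 0 < del /\
    forall s, tau - del < s < tau -> Cmod (U s - g s z)%C < d.
Proof.
  intros Htau Hal HK d Hd. apply NNPP. intros N.
  assert (Hd8 : 0 < d / 8) by lra.
  assert (HU : continuous (fun s => Cmod (U s - U tau)%C) tau).
  { apply continuous_Cmod, continuous_Cminus; [now apply driving_continuous | apply continuous_const]. }
  destruct (continuous_close _ _ _ HU Hd8) as [d0 [Hd0p Hd0]].
  (* As long as [|U tau - g| >= d / 2] the velocity is at most [8 / d], so within time [d^2 / 64] a
     trajectory moves by at most [d / 8]. *)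
  set (del := Rmin d0 (d * d / 64)).
  assert (Hdel : 0 < del) by (unfold del; apply Rmin_glb_lt; nra).
  assert (del <= d0) by apply Rmin_l. assert (del <= d * d / 64) by apply Rmin_r.
  assert (HUclose : forall s, tau - del < s <= tau -> Cmod (U s - U tau)%C < d / 8).
  { intros s Hs. specialize (Hd0 s ltac:(apply Rabs_def1; lra)). cbv beta in Hd0.
    rewrite Cmod_diag, Rminus_0_r, Rabs_pos_eq in Hd0 by apply Cmod_ge_0.
    exact Hd0. }
  assert (exists s, tau - del < s < tau /\ d <= Cmod (U s - g s z)%C) as [s [Hs Hfar]].
  { apply NNPP. intros N'. apply N. exists del. split; [exact Hdel|]. intros s Hs.
    apply Rnot_le_lt. intros L. apply N'. eauto. }
  pose proof Hal as [HtT Halive].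
  assert (Htri : forall u, tau - del < u < tau -> Cmod (U tau - g u z)%C - d / 8 <= Cmod (U u - g u z)%C).
  { intros u Hu. specialize (HUclose u ltac:(lra)).
    assert (Cmod (U tau - g u z)%C <= Cmod (U u - U tau)%C + Cmod (U u - g u z)%C); [|lra].
    replace (U tau - g u z)%C with (- (U u - U tau) + (U u - g u z))%C by ring.
    eapply Rle_trans; [apply Cmod_triangle|]. rewrite Cmod_opp. lra. }
  assert (Hvel : forall u, tau - del < u < tau -> d / 2 <= Cmod (U tau - g u z)%C ->
    Cmod (loewner_field (U u) (g u z)) <= 8 / d).
  { intros u Hu Hu2. specialize (Htri u Hu). assert (HuT : u < T) by lra.
    assert (Hdk := ch_disk _ _ _ _ HC u z HuT (Halive u ltac:(lra))).
    assert (Hn := Cmod_1_neq_disk (U u) (g u z) (Cmod_cis _) Hdk).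
    unfold loewner_field. rewrite Cmod_mult, Cmod_div by exact Hn.
    assert (Cmod (U u + g u z)%C <= 2).
    { eapply Rle_trans; [apply Cmod_triangle|]. unfold U at 1. rewrite Cmod_cis. lra. }
    pose proof (Cmod_ge_0 (U u + g u z)). pose proof (Cmod_ge_0 (g u z)).
    replace (8 / d) with (1 * (2 / (d / 4))) by (field; lra).
    assert (Hi : / Cmod (U u - g u z) <= / (d / 4)) by (apply Rinv_le_contravar; lra).
    assert (0 < / Cmod (U u - g u z)) by (apply Rinv_0_lt_compat; lra).
    apply Rmult_le_compat; try lra; unfold Rdiv at 1.
    - apply Rmult_le_pos; lra.
    - apply Rmult_le_compat; lra. }
  (* At a first time with distance [d / 2] the chord from [U s] to [g s z] would be at most
     [d/8 + d/2 + d/8 < d], against the choice of [s]. *)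
  assert (Hstay : forall u, s <= u < tau -> d / 2 < Cmod (U tau - g u z)%C).
  { intros u Hu. apply Rnot_le_lt. intros L.
    destruct (first_hit (fun v => Cmod (U tau - g v z)%C) s u (d / 2)) as [v [Hv [Ev Hbef]]]; [lra| | |exact L|].
    - intros t Ht. apply continuous_Cmod, continuous_Cminus; [apply continuous_const|].
      eapply cder_continuous. apply ode_field; [lra | apply Halive; lra].
    - specialize (HUclose s ltac:(lra)).
      assert (Cmod (U s - g s z)%C <= Cmod (U s - U tau)%C + Cmod (U tau - g s z)%C); [|lra].
      replace (U s - g s z)%C with ((U s - U tau) + (U tau - g s z))%C by ring. apply Cmod_triangle.
    - assert (Hm : Cmod (g v z - g s z)%C <= 8 / d * (v - s)).
      { apply (Cmod_mean_value (fun v => g v z) (fun v => loewner_field (U v) (g v z)) s v (8 / d)); [lra|].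
        intros t Ht. split; [apply ode_field; [lra | apply Halive; lra]|].
        apply Hvel; [lra|]. destruct (Rlt_le_dec t v) as [Lt|Lt]; [specialize (Hbef t); lra|].
        replace t with v by lra. lra. }
      assert (8 / d * (v - s) <= 8 / d * (d * d / 64)).
      { apply Rmult_le_compat_l; [apply Rlt_le, Rdiv_lt_0_compat; lra|]. lra. }
      replace (8 / d * (d * d / 64)) with (d / 8) in * by (field; lra).
      specialize (HUclose s ltac:(lra)).
      assert (Cmod (U s - g s z)%C <= Cmod (U s - U tau)%C + Cmod (U tau - g v z)%C + Cmod (g v z - g s z)%C); [|lra].
      replace (U s - g s z)%C with ((U s - U tau) + (U tau - g v z) + (g v z - g s z))%C by ring.
      eapply Rle_trans; [apply Cmod_triangle|]. apply Rplus_le_compat_r. apply Cmod_triangle. }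
  destruct (lipschitz_left_limit (fun u => g u z) s tau (8 / d)) as [l Hlim];
    [lra | apply Rdiv_lt_0_compat; lra | |].
  { intros u v Hu1 Hu2 Hu3.
    apply (Cmod_mean_value (fun v => g v z) (fun v => loewner_field (U v) (g v z)) u v (8 / d)); [exact Hu2|].
    intros t Ht. split; [apply ode_field; [lra | apply Halive; lra]|].
    apply Hvel; [lra|]. apply Rlt_le, Hstay. lra. }
  set (e := 3 * d / 8).
  assert (Hfar2 : forall u, s <= u < tau -> e <= Cmod (U u - g u z)%C).
  { intros u Hu. specialize (Htri u ltac:(lra)). specialize (Hstay u Hu). unfold e. lra. }
  (* [1 - |g|^2] stays above a positive [c] up to time [tau], so the limit cannot lie on the
     circle. *)
  assert (Hl1 : Cmod l < 1).
  { assert (HsT : s < T) by lra.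
    assert (Hds := ch_disk _ _ _ _ HC s z HsT (Halive s ltac:(lra))).
    set (c := (1 - Cnormsq (g s z)) * exp (- (2 / (e * e) * (tau - s)))).
    assert (Hn : Cnormsq (g s z) < 1) by (rewrite Cnormsq_Cmod; pose proof (Cmod_ge_0 (g s z)); nra).
    assert (Hc : 0 < c) by (apply Rmult_lt_0_compat; [lra | apply exp_pos]).
    assert (Hgn : forall u, s <= u < tau -> Cmod (g u z) * Cmod (g u z) <= 1 - c).
    { intros u Hu. assert (M := solution_modulus_bound z s u e ltac:(lra) ltac:(lra) (Halive u ltac:(lra)) ltac:(unfold e; lra)
        (fun v Hv => Hfar2 v ltac:(lra))).
      rewrite <- Cnormsq_Cmod.
      assert (c <= (1 - Cnormsq (g s z)) * exp (- (2 / (e * e) * (u - s)))); [|lra].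
      apply Rmult_le_compat_l; [lra|]. left. apply exp_increasing.
      assert (0 < 2 / (e * e)) by (apply Rdiv_lt_0_compat; unfold e; nra).
      assert (2 / (e * e) * (u - s) < 2 / (e * e) * (tau - s)) by (apply Rmult_lt_compat_l; lra). lra. }
    destruct (Hlim (c / 4) ltac:(lra)) as [r [Hr Hrl]]. specialize (Hrl r ltac:(lra)). specialize (Hgn r Hr).
    pose proof (Cmod_ge_0 (g r z)).
    assert (Cmod (g r z) <= 1 - c / 2) by (apply Rnot_lt_le; intros L; nra).
    replace l with (g r z + - (g r z - l))%C by ring.
    eapply Rle_lt_trans; [apply Cmod_triangle|]. rewrite Cmod_opp. lra. }
  destruct (ch_surj _ _ _ _ HC tau l Htau Hl1) as [z' [Hz' Ez']].
  assert (z = z') as ->; [|contradiction].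
  assert (Hal' : alive T K z' tau).
  { split; [lra|]. intros u Hu X. apply Hz'. apply (ch_mono _ _ _ _ HC u tau); auto; lra. }
  assert (Hcz : continuous (fun u => g u z') tau) by (eapply cder_continuous, ode_field; assumption).
  assert (He' : 0 < (1 - Cmod l) / 2) by lra.
  assert (Hfz : continuous (fun u => Cmod (U u - g u z')%C) tau).
  { apply continuous_Cmod, continuous_Cminus; [now apply driving_continuous | exact Hcz]. }
  destruct (continuous_close _ _ _ Hfz He') as [d3 [Hd3p Hd3]].
  set (s' := Rmax s (tau - d3 / 2)).
  assert (s <= s') by apply Rmax_l. assert (tau - d3 / 2 <= s') by apply Rmax_r.
  assert (s' < tau) by (unfold s'; apply Rmax_lub_lt; lra).
  (* The survivor [z'] has the value [l] at time [tau], at distance at least [1 - |l|] from the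
     driving point; half of that distance persists on [[s', tau)] by continuity. *)
  apply (solution_unique_backward z z' s' tau (Rmin e ((1 - Cmod l) / 2))); auto.
  - apply Rmin_glb_lt; unfold e; lra.
  - intros u Hu. split; [eapply Rle_trans; [apply Rmin_l|]; apply Hfar2; lra|].
    eapply Rle_trans; [apply Rmin_r|].
    specialize (Hd3 u ltac:(apply Rabs_def1; lra)). apply Rabs_def2 in Hd3. rewrite Ez' in Hd3.
    assert (1 - Cmod l <= Cmod (U tau - l)%C).
    { assert (HUl : Cmod (U tau) <= Cmod (U tau - l)%C + Cmod l).
      { replace (U tau) with ((U tau - l) + l)%C at 1 by ring. apply Cmod_triangle. }
      rewrite Cmod_driving in HUl. lra. }
    lra.
  - intros eps Heps. destruct (Hlim (eps / 2) ltac:(lra)) as [r [Hr Hrl]].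
    assert (Hcm : continuous (fun u => Cmod (g u z' - l)%C) tau).
    { apply continuous_Cmod, continuous_Cminus; [exact Hcz | apply continuous_const]. }
    pose proof (Rmax_l r s'). pose proof (Rmax_r r s').
    destruct (continuous_close_left _ (Rmax r s') tau (eps / 2) Hcm ltac:(lra)) as [u [Hu Hd4]].
    { apply Rmax_lub_lt; lra. }
    exists u. split; [lra|]. specialize (Hrl u ltac:(lra)).
    rewrite Ez', Cmod_diag, Rminus_0_r, Rabs_pos_eq in Hd4 by apply Cmod_ge_0.
    replace (g u z - g u z')%C with ((g u z - l) + - (g u z' - l))%C by ring.
    eapply Rle_lt_trans; [apply Cmod_triangle|]. rewrite Cmod_opp. lra.
Qed.

End Hitting.

(** * Identification of the curve *)

Lemma clog_scale (r : R) (w : C) : 0 < r -> 0 < fst w -> clog (RtoC r * w)%C = (RtoC (ln r) + clog w)%C.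
Proof.
  intros Hr Hw. unfold clog. rewrite Cmod_mult, Cmod_R, (Rabs_pos_eq r) by lra.
  rewrite ln_mult by (try apply Cmod_gt_0_fst; assumption).
  rewrite fst_RtoC_mult, snd_RtoC_mult. replace (r * snd w / (r * fst w)) with (snd w / fst w) by (field; lra).
  unfold RtoC, Cplus; cbn. f_equal. ring.
Qed.

Lemma slit_log_scale (r : R) (z : C) : 0 < r -> snd z <> 0 \/ 0 < fst z ->
  slit_log (RtoC r * z)%C = (RtoC (ln r) + slit_log z)%C.
Proof.
  intros Hr Hz. apply half_pos in Hz. unfold slit_log.
  assert (Hm : Cmod (RtoC r * z)%C = r * Cmod z) by (rewrite Cmod_mult, Cmod_R, Rabs_pos_eq; lra).
  replace (half (RtoC r * z)%C) with (RtoC r * half z)%C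
    by (unfold half; rewrite Hm, RtoC_mult; ring).
  rewrite clog_scale by assumption. rewrite Hm, fst_RtoC_mult.
  change (0 < Cmod z + fst z) in Hz.
  replace (2 * (r * Cmod z + r * fst z)) with (r * (2 * (Cmod z + fst z))) by ring.
  rewrite ln_mult by lra. rewrite RtoC_plus. ring.
Qed.

Definition upper_power (a : R) (z : C) : C := cexp (RtoC a * slit_log z)%C.

Lemma Cmod_gt_0_snd (z : C) : 0 < snd z -> 0 < Cmod z.
Proof. intros H. apply Cmod_gt_0. intros ->. cbn in H. lra. Qed.

Lemma fst_slit_log (z : C) : 0 < snd z -> fst (slit_log z) = ln (Cmod z).
Proof.
  intros Hz. assert (Hp := Cmod_gt_0_snd z Hz).
  apply exp_inv. rewrite exp_ln by exact Hp. rewrite <- Cmod_cexp, cexp_slit_log by (left; lra). reflexivity.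
Qed.

(** Equal powers have equal moduli, so the two points are at the same distance from the origin;
    being at the same height, they agree up to the sign of the real part. *)
Lemma upper_power_abs (a x x' y : R) : 0 < a -> 0 < y ->
  upper_power a (x, y) = upper_power a (x', y) -> x' = x \/ x' = - x.
Proof.
  intros Ha Hy E. assert (Em : Cmod (upper_power a (x, y)) = Cmod (upper_power a (x', y))) by now rewrite E.
  unfold upper_power in Em. rewrite !Cmod_cexp in Em. apply exp_inv in Em.
  rewrite !fst_RtoC_mult, !fst_slit_log in Em by exact Hy.
  apply Rmult_eq_reg_l in Em; [|lra]. apply ln_inv in Em; try (now apply Cmod_gt_0_snd).
  assert (Esq : Cnormsq (x, y) = Cnormsq (x', y)) by (rewrite !Cnormsq_Cmod; now rewrite Em).
  unfold Cnormsq, Cdot in Esq; cbn [fst snd] in Esq.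
  assert (Hprod : (x' - x) * (x' + x) = 0) by lra. apply Rmult_integral in Hprod. lra.
Qed.

(** Half-angle formula: [al], with tangent [y / (|z| + x)], is half the argument, and the cotangent
    of [2 al] is [x / y]. The form with [atan (x / y)] is valid across [x = 0]. *)
Lemma arg_slit_log (x y : R) : 0 < y -> snd (slit_log (x, y)) = PI / 2 - atan (x / y).
Proof.
  intros Hy. unfold slit_log, half, clog.
  assert (Hp := half_pos (x, y) (or_introl (Rgt_not_eq _ _ Hy))). unfold half in Hp. cbn [fst snd RtoC Cplus] in Hp.
  change (fst (RtoC (Cmod (x, y)) + (x, y))%C) with (Cmod (x, y) + x) in *.
  change (snd (RtoC (Cmod (x, y)) + (x, y))%C) with (0 + y). rewrite Rplus_0_l.
  assert (Hm : Cmod (x, y) * Cmod (x, y) = x * x + y * y).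
  { unfold Cmod; cbn [fst snd]. rewrite sqrt_sqrt by (apply Rplus_le_le_0_compat; apply pow2_ge_0). ring. }
  set (m := Cmod (x, y)) in *. set (al := atan (y / (m + x))).
  replace (snd (2 * (ln (Cmod (m + (x, y))%C), al) - ln (2 * (m + fst (x, y))))%C) with (2 * al) by (cbn; ring).
  assert (Hal : 0 < al < PI / 2).
  { split; [|apply atan_bound]. unfold al. rewrite <- atan_0. apply atan_increasing.
    now apply Rdiv_lt_0_compat. }
  assert (Hs : 0 < sin al) by (apply sin_gt_0; lra). assert (Hc : 0 < cos al) by (apply cos_gt_0; lra).
  assert (Ht : sin al / cos al = y / (m + x)) by (change (tan al = y / (m + x)); apply tan_atan).
  assert (E : tan (PI / 2 - 2 * al) = x / y).
  { unfold tan. rewrite sin_shift, cos_shift, sin_2a, cos_2a.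
    assert (Ey : y = sin al / cos al * (m + x)) by (rewrite Ht; field; lra).
    transitivity ((1 - sin al / cos al * (sin al / cos al)) / (2 * (sin al / cos al))); [field; lra|].
    rewrite Ht. apply (Rmult_eq_reg_r (2 * y * y)); [|nra].
    transitivity (y * ((m + x) - y * y / (m + x))); [field; lra|].
    replace (y * y) with ((m - x) * (m + x)) by nra. field. lra. }
  rewrite <- E, atan_tan by lra. ring.
Qed.

Section TipPoint.
Variables (b T : R) (K : R -> C -> Prop) (g : R -> C -> C).
Hypothesis (Hb : 0 < b) (HC : sle_chain b T K g).

Definition tip_log (t : R) : C :=
  (slit_log (rot b (angle b T t) * jfun b 1 (angle b T t)) - (0%R, ((1 + 2 * b) * angle b T t)%R))%C.

(** The left-hand side is the formula of [chain_position] at [q = 1]. The factor [cis (drive b T t)]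
    is absorbed because it is the [1/b]-th power of [rot]. *)
Lemma tip_position (t : R) : t < T ->
  (cis (drive b T t) * RtoC (exp (- t)) * cexp (RtoC (/ b) * tip_log t))%C = upper_power (/ b) (tip b T t).
Proof.
  intros Ht. pose proof (rot_jfun_im_pos b T Hb _ (angle_bound b T Hb t Ht)) as Him.
  unfold upper_power, tip. rewrite slit_log_scale; [|apply exp_pos | left; lra].
  rewrite ln_exp. unfold tip_log. set (Y := slit_log _). set (p := angle b T t).
  replace (RtoC (/ b) * (Y - (0%R, ((1 + 2 * b) * p)%R)))%C
    with (RtoC (/ b) * Y - (0%R, (/ b * ((1 + 2 * b) * p))%R))%C
    by (apply injective_projections; cbn; ring).
  rewrite cexp_minus, Cmult_plus_distr_l, cexp_plus.
  assert (E1 : cexp (0%R, (/ b * ((1 + 2 * b) * p))%R) = cis (drive b T t)).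
  { unfold cexp, cis, drive; cbn [fst snd]. fold p. rewrite exp_0, !Rmult_1_l.
    replace (/ b * ((1 + 2 * b) * p)) with ((2 + / b) * p) by (field; lra). reflexivity. }
  assert (E2 : cexp (RtoC (/ b) * RtoC (- (b * t)))%C = RtoC (exp (- t))).
  { rewrite <- RtoC_mult. replace (/ b * - (b * t)) with (- t) by (field; lra).
    unfold cexp, RtoC; cbn [fst snd]. rewrite cos_0, sin_0. f_equal; ring. }
  assert (E3 : cis (drive b T t) <> 0%C) by (rewrite <- E1; apply cexp_neq_0).
  rewrite E1, E2. now field.
Qed.

Lemma tip_radial_log (t : R) : t < T -> radial_log b 1 (angle b T t) (tip_log t).
Proof.
  intros Ht. apply radial_log_1; [exact Hb | exact (chain_nonvanishing b T K g Hb HC) |].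
  now apply angle_bound.
Qed.

(* The preimages of the points [s * U], [s < 1], tend to the tip; if [g t] were
   defined and continuous there, its value would lie on the unit circle. *)
Lemma tip_in_hull (t : R) : t < T -> K t (upper_power (/ b) (tip b T t)).
Proof.
  intros Ht. apply NNPP. intros HK. rewrite <- tip_position in HK by exact Ht.
  destruct (tip_radial_log t Ht) as (G & G0 & G1 & HG).
  set (P := fun s : R => (RtoC s * cis (drive b T t) * RtoC (exp (- t)) * cexp (RtoC (/ b) * G s))%C).
  assert (EP1 : P 1 = (cis (drive b T t) * RtoC (exp (- t)) * cexp (RtoC (/ b) * tip_log t))%C).
  { unfold P. rewrite G1. ring. }
  rewrite <- EP1 in HK.
  assert (HP : continuous P 1).
  { unfold P. ccont. apply continuous_RtoC, continuous_id.
    apply continuous_cexp. ccont. apply HG. lra. }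
  assert (Hin : forall s, 0 <= s < 1 -> g t (P s) = (RtoC s * cis (drive b T t))%C).
  { intros s Hs. destruct (ch_surj _ _ _ _ HC t (RtoC s * cis (drive b T t))%C Ht) as [z [Hz E]].
    { rewrite Cmod_mult, Cmod_cis, Cmod_R, Rabs_pos_eq; lra. }
    destruct (ch_open _ _ _ _ HC t z Ht Hz) as [t1 [Ht1 Hal]].
    assert (Er : rel b T g z t = (RtoC s * 1)%C).
    { unfold rel. rewrite E, <- Cmult_assoc, cis_opp_r. reflexivity. }
    assert (Ez := chain_position b T K g Hb HC z t1 t (G s) (conj (proj2 Ht1) Hal) (proj1 Ht1)).
    rewrite Er in Ez. specialize (Ez (radial_log_scale b 1 (angle b T t) G s G0 HG ltac:(lra))).
    replace (P s) with z; [exact E|]. rewrite Ez. unfold scaled. rewrite E. reflexivity. }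
  assert (Hc : continuous (fun s => Cmod (g t (P s))) 1).
  { apply continuous_Cmod. apply (continuous_comp P (g t)); [exact HP|]. now apply (ch_cont _ _ _ _ HC). }
  assert (Hd := ch_disk _ _ _ _ HC t (P 1) Ht HK).
  set (m := Cmod (g t (P 1))) in *. assert (0 <= m) by apply Cmod_ge_0.
  destruct (continuous_close_left _ ((1 + m) / 2) 1 ((1 - m) / 2) Hc ltac:(lra) ltac:(lra)) as [s [Hs Hdel]].
  fold m in Hdel. rewrite Hin in Hdel by lra.
  rewrite Cmod_mult, Cmod_cis, Cmod_R, (Rabs_pos_eq s) in Hdel by lra.
  apply Rabs_def2 in Hdel. lra.
Qed.

(** With the value [1] from time [tau] on, the relative position is continuous, by
    [swallowed_limit], and its radial logarithm can be continued up to [tau] included. The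
    expression of [chain_position] is constantly [z] before [tau] and equals the tip at [tau]. *)
Lemma swallowed_is_tip (z : C) (tau : R) : tau < T -> alive T K z tau -> K tau z ->
  z = upper_power (/ b) (tip b T tau).
Proof.
  intros Htau Hal HK.
  set (q := fun s => if Rlt_dec s tau then rel b T g z s else 1%C).
  assert (Hq : forall s, s < tau -> q s = rel b T g z s) by (intros s Hs; unfold q; destruct Rlt_dec; [reflexivity | lra]).
  assert (Hq1 : q tau = 1%C) by (unfold q; destruct Rlt_dec; [lra | reflexivity]).
  assert (Hdisk : forall s, s < tau -> Cmod (rel b T g z s) < 1).
  { intros s Hs. exact (rel_disk b T K g HC z tau Hal s Hs). }
  assert (Hrel : forall s, Cmod (rel b T g z s - 1)%C = Cmod (cis (drive b T s) - g s z)%C).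
  { intros s. rewrite (g_rel b T g z s).
    replace (cis (drive b T s) - rel b T g z s * cis (drive b T s))%C
      with (- (rel b T g z s - 1) * cis (drive b T s))%C by ring.
    rewrite Cmod_mult, Cmod_cis, Cmod_opp. ring. }
  assert (Hqc : forall s, tau - 1 <= s <= tau -> continuous q s).
  { intros s Hs. destruct (Rlt_le_dec s tau) as [L|L].
    - apply (continuous_ext_loc _ (rel b T g z)).
      + generalize (locally_lt s tau L). apply filter_imp. intros u Hu. symmetry. now apply Hq.
      + exact (rel_continuous b T K g Hb HC z tau Hal s L).
    - replace s with tau by lra.
      assert (Hsmall : forall eps, 0 < eps -> locally tau (fun u => Cmod (q u - 1)%C < eps)).
      { intros eps Heps. destruct (swallowed_limit b T K g Hb HC z tau Htau Hal HK eps Heps) as [del [Hdel Hl]].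
        exists (mkposreal _ Hdel). intros u Hu. change (Rabs (u - tau) < del) in Hu. apply Rabs_def2 in Hu.
        unfold q. destruct Rlt_dec as [Lu|Lu].
        - rewrite Hrel. apply Hl. lra.
        - rewrite Cmod_diag. exact Heps. }
      apply continuous_C; split; apply continuous_R; intros eps;
        generalize (Hsmall eps (cond_pos eps)); apply filter_imp; intros u Hu; rewrite Hq1;
        (eapply Rle_lt_trans; [|exact Hu]).
      + exact (Cmod_fst_le (q u - 1)%C).
      + exact (Cmod_snd_le (q u - 1)%C). }
  assert (Hnv := chain_nonvanishing b T K g Hb HC).
  assert (Hang := angle_bound b T Hb).
  destruct (path_log b q (angle b T) (tau - 1) tau Hb) as [l Hl].
  { intros s Hs. specialize (Hang s ltac:(lra)).
    split; [now apply Hqc|]. split; [apply angle_continuous; [exact Hb | lra]|].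
    destruct (Rlt_le_dec s tau) as [L|L].
    - rewrite Hq by exact L. apply base_disk. now apply Hdisk.
    - replace s with tau in * by lra. rewrite Hq1. apply base_1. lra. }
  { intros s x Hs Hx. specialize (Hang s ltac:(lra)). destruct (Rlt_le_dec s tau) as [L|L].
    - rewrite Hq by exact L. apply (jfun_disk_neq_0 b T K g Hb HC); [lra | now apply Hdisk | exact Hx].
    - replace s with tau in * by lra. rewrite Hq1. apply jfun_radius_neq_0; auto; lra. }
  set (V := fun s => (q s * cis (drive b T s) * RtoC (exp (- s)) * cexp (RtoC (/ b) * l s))%C).
  assert (HV : forall s, tau - 1 <= s < tau -> V s = z).
  { intros s Hs. destruct (Hl s ltac:(lra)) as [_ H2]. rewrite Hq in H2 by lra.
    unfold V. rewrite Hq by lra. rewrite <- g_rel.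
    symmetry. exact (chain_position b T K g Hb HC z tau s (l s) Hal ltac:(lra) H2). }
  assert (HVtau : V tau = upper_power (/ b) (tip b T tau)).
  { destruct (Hl tau ltac:(lra)) as [_ H2]. rewrite Hq1 in H2.
    unfold V. rewrite Hq1, (radial_log_unique _ _ _ _ _ H2 (tip_radial_log tau Htau)).
    rewrite <- tip_position by exact Htau. ring. }
  rewrite <- HVtau.
  assert (HVc : continuous V tau).
  { unfold V. ccont.
    - apply (continuous_ext q); [reflexivity|]. apply Hqc. lra.
    - apply continuous_cis. now apply drive_continuous.
    - apply continuous_RtoC. apply (continuous_derivable_comp (fun s => exp (- s)) (fun s => s));
        [auto_derive; exact I | apply continuous_id].
    - apply continuous_cexp. ccont. apply (continuous_ext l); [reflexivity|]. apply Hl. lra. }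
  assert (Hm : continuous (fun s => Cmod (V s - z)%C) tau).
  { apply continuous_Cmod, continuous_Cminus; [exact HVc | apply continuous_const]. }
  symmetry. apply NNPP. intros N. apply Cmod_minus_pos in N. rename N into Hp.
  destruct (continuous_close_left _ (tau - 1) tau _ Hm Hp ltac:(lra)) as [s [Hs Hd]].
  rewrite HV in Hd by lra. rewrite Cmod_diag in Hd. apply Rabs_def2 in Hd. lra.
Qed.

End TipPoint.

(** * The chain generated by a curve *)

Lemma compact_singleton (z : C) : compact_set (fun x : C => x = z).
Proof.
  intros I O _ Hcov. destruct (Hcov z eq_refl) as [i Hi].
  exists (i :: nil). intros x ->. exists i. split; [now left | exact Hi].
Qed.

(** Differentiability over [C] speaks of balls for the modulus, whereas continuity here refers to
    the product structure of [R * R]; a radius halved in each component bridges the two. *)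
Lemma Cderivable_continuous (f : C -> C) (z : C) :
  @ex_derive C_AbsRing C_NormedModule f z -> continuous f z.
Proof.
  intros H. apply ex_derive_continuous in H. intros P HP. destruct (H P HP) as [d Hd].
  assert (Hd2 : 0 < d / 2) by (pose proof (cond_pos d); lra).
  exists (mkposreal _ Hd2). intros u [Hu1 Hu2].
  change (Rabs (fst u - fst z) < d / 2) in Hu1. change (Rabs (snd u - snd z) < d / 2) in Hu2.
  apply Hd. change (Cmod (u - z)%C < d). eapply Rle_lt_trans; [apply Cmod_le_sum|].
  change (Rabs (fst u - fst z) + Rabs (snd u - snd z) < d). lra.
Qed.

Section Curve.
Variables (rho T : R) (gamma : R -> C).
Hypothesis (Hrho : rho < -2).
Let b := - (rho + 2) / 4.

Lemma exponent_pos : 0 < b.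
Proof. unfold b. lra. Qed.

Lemma sle0_driving_angle (t : R) : sle0_driving rho T 0 t = (2 + / b) * angle b T t.
Proof.
  unfold sle0_driving, angle. rewrite Rplus_0_r. f_equal.
  - unfold b. field. lra.
  - do 2 f_equal. unfold b. field.
Qed.

Hypothesis (Hgc : forall t, t < T -> continuous gamma t).

Lemma trace_open (t : R) (z : C) : t < T -> ~ trace gamma t z ->
  exists t1, t < t1 <= T /\ forall s, s < t1 -> ~ trace gamma s z.
Proof.
  intros Ht Hz.
  assert (Hc : continuous (fun s => Cmod (gamma s - z)%C) t).
  { apply continuous_Cmod, continuous_Cminus; [now apply Hgc | apply continuous_const]. }
  assert (Hp : 0 < Cmod (gamma t - z)%C).
  { apply Cmod_minus_pos. intros E. apply Hz. exists t. split; [lra | exact E]. }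
  destruct (locally_pos _ t Hc Hp) as [d Hd]. pose proof (cond_pos d).
  exists (Rmin (t + d) T). split.
  - split; [apply Rmin_glb_lt; lra | apply Rmin_r].
  - intros s Hs (r & Hr & E). assert (Rmin (t + d) T <= t + d) by apply Rmin_l.
    destruct (Rle_lt_dec r t) as [L|L].
    + apply Hz. now exists r.
    + specialize (Hd r). assert (B : ball t d r) by (change (Rabs (r - t) < d); apply Rabs_def1; lra).
      specialize (Hd B). rewrite E, Cmod_diag in Hd. lra.
Qed.

Variable g : R -> C -> C.
Hypothesis HW : whole_plane_loewner_chain T (sle0_driving rho T 0) (trace gamma) g.

Lemma loewner_sle_chain : sle_chain b T (trace gamma) g.
Proof.
  constructor.
  - exact (wplc_growing _ _ _ _ HW).
  - exact trace_open.
  - intros t z Ht Hz. destruct (wplc_conformal _ _ _ _ HW t Ht) as (_ & H & _). now apply H.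
  - intros t z1 z2 Ht H1 H2 E. destruct (wplc_conformal _ _ _ _ HW t Ht) as (_ & _ & H & _). now apply H.
  - intros t u Ht Hu. destruct (wplc_conformal _ _ _ _ HW t Ht) as (_ & _ & _ & H). now apply H.
  - intros t z Ht Hz. destruct (wplc_conformal _ _ _ _ HW t Ht) as (H & _). now apply Cderivable_continuous, H.
  - exact (wplc_zero _ _ _ _ HW).
  - intros t z Ht Hz. rewrite <- sle0_driving_angle. apply cder_iff. exact (wplc_ode _ _ _ _ HW t z Ht Hz).
  - intros z eps Heps. destruct (wplc_infty _ _ _ _ HW _ (compact_singleton z) eps Heps) as [M HM].
    exists (Rmin M (T - 1)). split; [eapply Rle_lt_trans; [apply Rmin_r|]; lra|].
    intros t Ht. apply HM; [|reflexivity]. eapply Rlt_le_trans; [exact Ht | apply Rmin_l].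
Qed.

Lemma first_time (t : R) (z : C) : t < T -> trace gamma t z ->
  exists tau, tau <= t /\ alive T (trace gamma) z tau /\ trace gamma tau z.
Proof.
  intros Ht (r & Hr & E).
  (* Before time [M] the hulls avoid [z], so the search for the first visit can start at [M - 1]. *)
  destruct (ch_lim _ _ _ _ loewner_sle_chain z 1 Rlt_0_1) as [M [HM HL]].
  assert (HMr : M <= r).
  { apply Rnot_lt_le. intros L. apply (proj1 (HL r L)). exists r. split; [lra | exact E]. }
  destruct (first_hit (fun s => Cmod (gamma s - z)%C) (M - 1) r 0) as [v [Hv [Ev Hbef]]].
  - lra.
  - intros s Hs. apply continuous_Cmod, continuous_Cminus; [apply Hgc; lra | apply continuous_const].
  - apply Cmod_minus_pos. intros E'. apply (proj1 (HL (M - 1) ltac:(lra))). exists (M - 1). split; [lra | exact E'].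
  - rewrite E, Cmod_diag. lra.
  - apply Cmod_minus_eq_0 in Ev. exists v. split; [lra|]. split; [split; [lra|]|].
    + intros s Hs (u & Hu & Eu). destruct (Rlt_le_dec u (M - 1)) as [L|L].
      * apply (proj1 (HL u ltac:(lra))). exists u. split; [lra | exact Eu].
      * specialize (Hbef u ltac:(lra)). rewrite Eu in Hbef.
        rewrite Cmod_diag in Hbef. lra.
    + exists v. split; [lra | exact Ev].
Qed.

Let b_pos : 0 < b := exponent_pos.

(** Equality of moduli leaves only [x' = -x]. The arguments of the two points then differ by
    [2 atan (x / y)], and [1/b] times this must be a multiple of [2 pi]. *)
Lemma upper_power_collision (x x' y : R) : 0 < y -> x' <> x ->
  upper_power (/ b) (x, y) = upper_power (/ b) (x', y) ->
  exists k : Z, / b * atan (x / y) = PI * IZR k.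
Proof.
  intros Hy Hne E.
  assert (E1 : cexp (RtoC (/ b) * slit_log (x, y) - RtoC (/ b) * slit_log (x', y))%C = 1%C).
  { rewrite cexp_minus. unfold upper_power in E. rewrite E. unfold Cdiv. apply Cinv_r, cexp_neq_0. }
  apply cexp_eq_1 in E1. destruct E1 as [_ [k Ek]].
  assert (Him : snd (RtoC (/ b) * slit_log (x, y) - RtoC (/ b) * slit_log (x', y))%C
    = / b * (snd (slit_log (x, y)) - snd (slit_log (x', y)))) by (cbn; ring).
  rewrite Him, !arg_slit_log in Ek by exact Hy.
  destruct (upper_power_abs (/ b) x x' y (Rinv_0_lt_compat _ b_pos) Hy E) as [Hx | Hx]; [contradiction|].
  subst x'. replace (- x / y) with (- (x / y)) in Ek by (field; lra). rewrite atan_opp in Ek.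
  exists (- k)%Z. rewrite opp_IZR. lra.
Qed.

Lemma curve_eq (t : R) : t < T -> gamma t = upper_power (/ b) (tip b T t).
Proof.
  intros Ht. apply NNPP. intros N.
  destruct (tip_im b T b_pos) as [y0 [Hy0 Hy]].
  assert (Hpair : forall s, s < T -> tip b T s = (fst (tip b T s), y0)).
  { intros s Hs. rewrite <- (Hy s Hs). apply surjective_pairing. }
  assert (Hpc : forall s, s < T -> continuous (fun s => upper_power (/ b) (tip b T s)) s).
  { intros s Hs. apply continuous_cexp. ccont. apply (continuous_slit_log (tip b T)).
    - left. rewrite Hy by exact Hs. lra.
    - now apply tip_continuous. }
  assert (Hc : continuous (fun s => Cmod (gamma s - upper_power (/ b) (tip b T s))%C) t).
  { apply continuous_Cmod, continuous_Cminus; [now apply Hgc | now apply Hpc]. }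
  assert (Hp : 0 < Cmod (gamma t - upper_power (/ b) (tip b T t))%C).
  { now apply Cmod_minus_pos. }
  destruct (locally_pos _ t Hc Hp) as [d Hd]. pose proof (cond_pos d).
  (* The point of the tip at time [s] lies in the trace but is not [gamma s], so it was visited
     earlier, for the first time at some [tau < s]. It is then also the tip at time [tau], which
     makes [s] the time of a collision. *)
  assert (Hnew : forall s, t - d < s < t -> exists k : Z, / b * atan (fst (tip b T s) / y0) = PI * IZR k).
  { intros s Hs. assert (HsT : s < T) by lra.
    specialize (Hd s). assert (B : ball t d s) by (change (Rabs (s - t) < d); apply Rabs_def1; lra).
    specialize (Hd B). cbv beta in Hd.
    destruct (tip_in_hull b T _ g b_pos loewner_sle_chain s HsT) as (r & Hr & E).
    assert (Hrs : r < s).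
    { destruct Hr as [L | ->]; [exact L|]. rewrite E in Hd.
      rewrite Cmod_diag in Hd. lra. }
    destruct (first_time r (upper_power (/ b) (tip b T s))) as (tau & Htau & Hal & HK); [lra | exists r; split; [apply Rle_refl | exact E] |].
    assert (E2 := swallowed_is_tip b T _ g b_pos loewner_sle_chain _ tau ltac:(lra) Hal HK).
    rewrite (Hpair s), (Hpair tau) in E2 by lra.
    apply (upper_power_collision _ (fst (tip b T tau)) y0 Hy0); [|exact E2].
    pose proof (tip_re_decr b T b_pos tau s ltac:(lra) HsT). lra. }
  set (h := fun s => / b * atan (fst (tip b T s) / y0)).
  set (s1 := t - d / 2). set (s2 := t - d / 4).
  assert (Hs12 : s1 < s2) by (unfold s1, s2; lra).
  destruct (Hnew s1 ltac:(unfold s1; lra)) as [k1 E1]. destruct (Hnew s2 ltac:(unfold s2; lra)) as [k2 E2].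
  pose proof (Rinv_0_lt_compat _ b_pos) as Hbi. pose proof PI_RGT_0.
  assert (Hlt : h s2 < h s1).
  { unfold h. apply Rmult_lt_compat_l; [exact Hbi|]. apply atan_increasing.
    apply Rmult_lt_compat_r; [now apply Rinv_0_lt_compat|]. apply tip_re_decr; [exact b_pos | exact Hs12 | unfold s2; lra]. }
  assert (Hk : IZR k2 + 1 <= IZR k1).
  { rewrite <- plus_IZR. apply IZR_le. assert (k2 < k1)%Z; [|lia]. apply lt_IZR. unfold h in Hlt. nra. }
  (* A continuous, strictly decreasing function cannot take only values in [PI * Z]: it would have
     to cross a half-integer multiple of [PI]. *)
  destruct (ivt_closed h s1 s2 (PI * (IZR k2 + 1 / 2))) as [s [Hs E]]; [lra | | right; unfold h; nra |].
  - intros s Hs. apply continuous_Rmult; [apply continuous_const|].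
    apply (continuous_derivable_comp atan (fun s => fst (tip b T s) / y0)); [auto_derive; exact I|].
    apply continuous_Rmult; [|apply continuous_const].
    assert (Hct := tip_continuous b T b_pos s ltac:(unfold s2 in Hs; lra)). apply continuous_C in Hct. apply Hct.
  - destruct (Hnew s ltac:(unfold s1, s2 in Hs; lra)) as [k Ek]. fold (h s) in Ek. rewrite E in Ek.
    assert (E3 : IZR (2 * k) = IZR (2 * k2 + 1)%Z).
    { rewrite plus_IZR, !mult_IZR. nra. }
    apply eq_IZR in E3. lia.
Qed.

End Curve.

(** * Arc length and the flow line *)

Lemma cder_comp (f : R -> C) (h : R -> R) (t dh : R) (l : C) :
  cder f (h t) l -> is_derive h t dh -> cder (fun t => f (h t)) t (RtoC dh * l)%C.
Proof.
  intros [H1 H2] Hh. split.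
  - rewrite fst_RtoC_mult. exact (is_derive_comp (fun x => fst (f x)) h t _ _ H1 Hh).
  - rewrite snd_RtoC_mult. exact (is_derive_comp (fun x => snd (f x)) h t _ _ H2 Hh).
Qed.

Lemma cder_lower_bound (f : R -> C) (x e : R) (l : C) : cder f x l -> 0 < e ->
  exists d, 0 < d /\ forall y, Rabs (y - x) < d -> (Cmod l - e) * Rabs (y - x) <= Cmod (f y - f x)%C.
Proof.
  intros [H1 H2] He. apply is_derive_Reals in H1. apply is_derive_Reals in H2.
  assert (He2 : 0 < e / 2) by lra.
  destruct (H1 _ He2) as [d1 K1]. destruct (H2 _ He2) as [d2 K2].
  exists (Rmin d1 d2). split; [apply Rmin_glb_lt; apply cond_pos|]. intros y Hy.
  assert (Rmin d1 d2 <= d1) by apply Rmin_l. assert (Rmin d1 d2 <= d2) by apply Rmin_r.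
  destruct (Req_dec y x) as [-> | Hne].
  { rewrite Rminus_diag, Rabs_R0, Rmult_0_r. apply Cmod_ge_0. }
  set (h := y - x) in *. assert (Hh : h <> 0) by (unfold h; lra).
  specialize (K1 h Hh ltac:(lra)). specialize (K2 h Hh ltac:(lra)).
  replace (x + h) with y in * by (unfold h; ring).
  set (q := ((f y - f x) * RtoC (/ h))%C).
  assert (Eq : (f y - f x)%C = (RtoC h * q)%C).
  { unfold q. rewrite RtoC_inv by exact Hh. field. intros X; apply RtoC_inj in X; lra. }
  assert (Hq : Cmod (q - l)%C < e).
  { eapply Rle_lt_trans; [apply Cmod_le_sum|].
    replace (fst (q - l)%C) with ((fst (f y) - fst (f x)) / h - fst l) by (unfold q, Rdiv; cbn; ring).
    replace (snd (q - l)%C) with ((snd (f y) - snd (f x)) / h - snd l) by (unfold q, Rdiv; cbn; ring).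
    lra. }
  rewrite Eq, Cmod_mult, Cmod_R, Rmult_comm. apply Rmult_le_compat_l; [apply Rabs_pos|].
  assert (Cmod l <= Cmod q + Cmod (q - l)%C); [|lra].
  replace l with (q + - (q - l))%C at 1 by ring. eapply Rle_trans; [apply Cmod_triangle|]. rewrite Cmod_opp. lra.
Qed.

Section ArcLength.
Variables (G dG : R -> C) (S : Rbar) (eta : R -> C) (chi : R -> R).
Hypothesis HG : forall x, cder G x (dG x).
Hypothesis HdG : forall x, continuous dG x.
Hypothesis Heta : forall u : R, Rbar_lt u S -> eta u = G (chi u).
Hypothesis Hchi : forall u v : R, u < v -> Rbar_lt v S -> chi v < chi u.
Hypothesis Hlen : forall a b : R, a <= b -> Rbar_lt b S -> is_length eta a b (b - a).

Lemma Rbar_lt_le_fin (u v : R) : u <= v -> Rbar_lt v S -> Rbar_lt u S.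
Proof. intros H1 H2. eapply Rbar_le_lt_trans; [|exact H2]. exact H1. Qed.

Lemma chord_le_length (u v : R) : u <= v -> Rbar_lt v S -> Cmod (eta v - eta u)%C <= v - u.
Proof.
  intros Huv Hv. destruct (Hlen u v Huv Hv) as [Hub _]. apply Hub.
  exists O, (fun i => match i with O => u | _ => v end).
  repeat split. - intros i Hi. replace i with O by lia. exact Huv.
  - rewrite sum_O. reflexivity.
Qed.

(** Each edge of an inscribed polygon is bounded by the mean value inequality for [G], and by
    monotonicity of [chi] the bounds telescope. *)
Lemma length_le_speed (u v M : R) : u <= v -> Rbar_lt v S ->
  (forall x, chi v <= x <= chi u -> Cmod (dG x) <= M) -> v - u <= M * (chi u - chi v).
Proof.
  intros Huv Hv HM. destruct (Hlen u v Huv Hv) as [_ Hlub]. apply Hlub.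
  intros L (n & p & Hp0 & Hpn & Hmono & ->).
  assert (Hchile : forall x y, x <= y -> y <= v -> chi y <= chi x).
  { intros x y [L | ->] Hy; [|lra]. left. apply Hchi; [exact L|]. now apply (Rbar_lt_le_fin y v). }
  assert (Hge : forall i, (i <= Datatypes.S n)%nat -> u <= p i).
  { induction i as [|i IH]; intros Hi; [lra|]. specialize (Hmono i ltac:(lia)). specialize (IH ltac:(lia)). lra. }
  assert (Hle : forall k i, (i + k = Datatypes.S n)%nat -> p i <= v).
  { induction k as [|k IH]; intros i Hi.
    - replace i with (Datatypes.S n) by lia. lra.
    - specialize (Hmono i ltac:(lia)). specialize (IH (Datatypes.S i) ltac:(lia)). lra. }
  assert (Hsum : forall m, (m <= n)%nat ->
    sum_n (fun i => Cmod (eta (p (Datatypes.S i)) - eta (p i))%C) m <= M * (chi u - chi (p (Datatypes.S m)))).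
  { assert (Hstep : forall i, (i <= n)%nat ->
      Cmod (eta (p (Datatypes.S i)) - eta (p i))%C <= M * (chi (p i) - chi (p (Datatypes.S i)))).
    { intros i Hi. assert (H1 := Hle (n - i)%nat (Datatypes.S i) ltac:(lia)).
      specialize (Hmono i Hi). assert (H2 := Hge i ltac:(lia)).
      rewrite !Heta by (apply (Rbar_lt_le_fin _ v); [lra | exact Hv]).
      assert (H3 := Hchile (p i) (p (Datatypes.S i)) Hmono H1).
      assert (H4 := Hchile u (p i) H2 ltac:(lra)). assert (H5 := Hchile (p (Datatypes.S i)) v H1 ltac:(lra)).
      replace (G (chi (p (Datatypes.S i))) - G (chi (p i)))%C with (- (G (chi (p i)) - G (chi (p (Datatypes.S i)))))%C by ring.
      rewrite Cmod_opp. apply (Cmod_mean_value G dG); [exact H3|]. intros t Ht. split; [apply HG | apply HM; lra]. }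
    induction m as [|m IH]; intros Hm.
    - rewrite sum_O. rewrite <- Hp0. now apply Hstep.
    - rewrite sum_Sn. specialize (IH ltac:(lia)). specialize (Hstep (Datatypes.S m) Hm).
      eapply Rle_trans; [apply (Rplus_le_compat _ _ _ _ IH Hstep) | lra]. }
  specialize (Hsum n (Nat.le_refl n)). rewrite Hpn in Hsum. exact Hsum.
Qed.

(** An increment of arc length is at least the chord and at most the maximal speed times the change
    of [chi]. Both estimates are [|dG|] times that change to first order, which squeezes the
    difference quotient; the sign is negative because [chi] decreases. *)
Lemma arclength_derivative (u : R) : Rbar_lt u S -> continuous chi u -> dG (chi u) <> 0%C ->
  is_derive chi u (- / Cmod (dG (chi u))).
Proof.
  intros Hu Hc Hn. set (c := Cmod (dG (chi u))). assert (Hcp : 0 < c) by (now apply Cmod_gt_0).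
  apply is_derive_Reals. intros eps Heps.
  (* The bound [c / 2] keeps the slope [D] below [2 / c]; the other bound makes the final error at
     most [eps / 2]. *)
  set (e := Rmin (c / 2) (eps * c * c / 4)).
  assert (He0 : 0 < e). { unfold e. apply Rmin_glb_lt; [lra|]. apply Rdiv_lt_0_compat; [|lra]. repeat apply Rmult_lt_0_compat; lra. }
  assert (He1 : e <= c / 2) by apply Rmin_l. assert (He2 : e <= eps * c * c / 4) by apply Rmin_r.
  destruct (cder_lower_bound G (chi u) e _ (HG (chi u)) He0) as [d1 [Hd1 K1]]. fold c in K1.
  assert (Hcd : continuous (fun x => Cmod (dG x)) (chi u)) by (apply continuous_Cmod, HdG).
  destruct (continuous_close _ _ _ Hcd He0) as [d2 [Hd2 K2]]. fold c in K2.
  assert (Hd12 : 0 < Rmin d1 d2) by (apply Rmin_glb_lt; lra).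
  assert (Rmin d1 d2 <= d1) by apply Rmin_l. assert (Rmin d1 d2 <= d2) by apply Rmin_r.
  destruct (continuous_close _ _ _ Hc Hd12) as [d3 [Hd3 K3]].
  (* A two-sided derivative needs increments to the right of [u] that stay below [S]. *)
  assert (Hroom : exists r, 0 < r /\ Rbar_lt (u + r) S).
  { destruct S as [x| |]; cbn in *; [|exists 1; split; [lra | exact I]|contradiction].
    exists ((x - u) / 2). split; lra. }
  destruct Hroom as [r [Hr HrS]].
  assert (Hdel : 0 < Rmin d3 r) by (apply Rmin_glb_lt; lra).
  assert (Rmin d3 r <= d3) by apply Rmin_l. assert (Rmin d3 r <= r) by apply Rmin_r.
  exists (mkposreal _ Hdel). cbn [pos]. intros h Hh Hhd.
  assert (HhS : Rbar_lt (u + h) S).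
  { apply (Rbar_lt_le_fin _ (u + r)); [|exact HrS]. apply Rabs_def2 in Hhd. lra. }
  assert (Hclose : Rabs (chi (u + h) - chi u) < Rmin d1 d2).
  { apply K3. replace (u + h - u) with h by ring. lra. }
  set (D := (chi u - chi (u + h)) / h).
  assert (HMb : forall x, Rabs (x - chi u) < d2 -> Cmod (dG x) <= c + e).
  { intros x Hx. specialize (K2 x Hx). apply Rabs_def2 in K2. lra. }
  specialize (K1 (chi (u + h)) ltac:(lra)).
  assert (Hbounds : (c - e) * D <= 1 <= (c + e) * D /\ 0 < D).
  { apply Rabs_def2 in Hclose. destruct (Rdichotomy _ _ Hh) as [Hneg | Hpos].
    - assert (Hlt := Hchi (u + h) u ltac:(lra) Hu).
      assert (B1 := chord_le_length (u + h) u ltac:(lra) Hu). rewrite !Heta in B1 by assumption.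
      assert (B2 := length_le_speed (u + h) u (c + e) ltac:(lra) Hu).
      rewrite (Rabs_pos_eq (chi (u + h) - chi u)) in K1 by lra.
      replace (G (chi (u + h)) - G (chi u))%C with (- (G (chi u) - G (chi (u + h))))%C in K1 by ring.
      rewrite Cmod_opp in K1.
      assert (B2' : u - (u + h) <= (c + e) * (chi (u + h) - chi u)).
      { apply B2. intros x Hx. apply HMb. apply Rabs_def1; lra. }
      assert (ED : D * - h = chi (u + h) - chi u) by (unfold D; field; exact Hh).
      rewrite <- ED in K1, B2'.
      repeat split.
      + apply (Rmult_le_reg_r (- h)); lra.
      + apply (Rmult_le_reg_r (- h)); lra.
      + apply (Rmult_lt_reg_r (- h)); lra.
    - assert (Hlt := Hchi u (u + h) ltac:(lra) HhS).
      assert (B1 := chord_le_length u (u + h) ltac:(lra) HhS). rewrite !Heta in B1 by assumption.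
      assert (B2 := length_le_speed u (u + h) (c + e) ltac:(lra) HhS).
      rewrite (Rabs_left (chi (u + h) - chi u)) in K1 by lra.
      assert (B2' : u + h - u <= (c + e) * (chi u - chi (u + h))).
      { apply B2. intros x Hx. apply HMb. apply Rabs_def1; lra. }
      assert (ED : D * h = chi u - chi (u + h)) by (unfold D; field; exact Hh).
      replace (- (chi (u + h) - chi u)) with (chi u - chi (u + h)) in K1 by ring.
      rewrite <- ED in K1, B2'.
      repeat split.
      + apply (Rmult_le_reg_r h); lra.
      + apply (Rmult_le_reg_r h); lra.
      + apply (Rmult_lt_reg_r h); lra. }
  destruct Hbounds as [[L1 L2] HD].
  replace ((chi (u + h) - chi u) / h - - / c) with (- (D - / c)) by (unfold D; field; lra).
  rewrite Rabs_Ropp.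
  assert (HDc : D <= 2 / c).
  { apply (Rmult_le_reg_l (c / 2)); [lra|]. replace (c / 2 * (2 / c)) with 1 by (field; lra). nra. }
  assert (Habs : Rabs (c * D - 1) <= e * D) by (apply Rabs_le; lra).
  replace (D - / c) with ((c * D - 1) * / c) by (field; lra).
  assert (Hic : 0 < / c) by (now apply Rinv_0_lt_compat).
  rewrite Rabs_mult, (Rabs_pos_eq (/ c)) by lra.
  apply Rle_lt_trans with (e * (2 / c) * / c).
  - apply Rmult_le_compat_r; [lra|]. eapply Rle_trans; [exact Habs|]. apply Rmult_le_compat_l; lra.
  - apply Rle_lt_trans with (eps * c * c / 4 * (2 / c) * / c).
    + apply Rmult_le_compat_r; [lra|]. apply Rmult_le_compat_r; [|exact He2].
      apply Rlt_le, Rdiv_lt_0_compat; lra.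
    + replace (eps * c * c / 4 * (2 / c) * / c) with (eps / 2) by (field; lra). lra.
Qed.

End ArcLength.

(** * The image of a horizontal line under the power *)

Lemma slit_log_upper (x y : R) : 0 < y -> slit_log (x, y) = (ln (sqrt (x ^ 2 + y ^ 2)), PI / 2 - atan (x / y)).
Proof.
  intros Hy. apply injective_projections; cbn [fst snd].
  - apply exp_inv. assert (Hp : 0 < sqrt (x ^ 2 + y ^ 2)).
    { apply sqrt_lt_R0. pose proof (pow2_ge_0 x). pose proof (pow2_gt_0 y ltac:(lra)). lra. }
    rewrite exp_ln by exact Hp. rewrite <- Cmod_cexp, cexp_slit_log by (left; cbn; lra). reflexivity.
  - now apply arg_slit_log.
Qed.

Definition power_branch (a : R) (z : C) : R * R := (Rpower (Cmod z) a, a * snd (slit_log z)).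

Lemma proj_branch (a : R) (z : C) : 0 < snd z -> M0_proj (power_branch a z) = upper_power a z.
Proof.
  intros Hz. unfold M0_proj, power_branch, upper_power, Rpower; cbn [fst snd].
  rewrite <- fst_slit_log by exact Hz. unfold cexp, cis, Cmult, RtoC; cbn [fst snd].
  replace (a * fst (slit_log z) - 0 * snd (slit_log z)) with (a * fst (slit_log z)) by ring.
  replace (a * snd (slit_log z) + 0 * fst (slit_log z)) with (a * snd (slit_log z)) by ring.
  f_equal; ring.
Qed.

Lemma branch_is_power_branch (a : R) : is_power_branch a upper_half_plane (power_branch a).
Proof.
  exists (fun z => snd (slit_log z)). intros z Hz. unfold upper_half_plane, Im in Hz. split; [|split].
  - assert (K := continuous_slit_log (fun z : C => z) z (or_introl (Rgt_not_eq _ _ Hz)) (continuous_id z)).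
    apply continuous_C in K. apply K.
  - rewrite <- (cexp_slit_log z) at 1 by (left; lra).
    rewrite (surjective_pairing (slit_log z)) at 1.
    rewrite cexp_real_plus, fst_slit_log, exp_ln by (assumption || now apply Cmod_gt_0_snd). reflexivity.
  - reflexivity.
Qed.

Lemma cder_slit_log (x y : R) : 0 < y -> cder (fun x => slit_log (x, y)) x (/ (x, y))%C.
Proof.
  intros Hy.
  eapply cder_ext_loc; [apply filter_forall; intros u; symmetry; now apply slit_log_upper|].
  assert (Hn : 0 < x ^ 2 + y ^ 2) by (pose proof (pow2_ge_0 x); pose proof (pow2_gt_0 y ltac:(lra)); lra).
  assert (Hs := sqrt_lt_R0 _ Hn). assert (Hss := sqrt_sqrt _ (Rlt_le _ _ Hn)).
  split; cbn [fst snd].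
  - auto_derive.
    + cbn in Hn, Hs. rewrite ?Rmult_1_r in *. auto.
    + unfold Cinv; cbn [fst snd]. cbn [pow] in *. rewrite ?Rmult_1_r in *.
      set (s := sqrt _) in *. replace (x * x + y * y) with (s * s). field. lra.
  - auto_derive; [lra|]. unfold Cinv; cbn [fst snd]. field. split; nra.
Qed.

Section PowerCurve.
Variables (a y : R).
Hypothesis (Ha : 0 < a) (Hy : 0 < y).

Let Z (x : R) : C := (x, y).
Let G (x : R) : C := upper_power a (Z x).
Let dG (x : R) : C := (RtoC a * (/ Z x) * G x)%C.

Lemma line_neq_0 (x : R) : Z x <> 0%C.
Proof. intros E. injection E. lra. Qed.

Lemma power_curve_derive (x : R) : cder G x (dG x).
Proof.
  eapply cder_eq.
  - apply cder_cexp, cder_mult; [apply cder_const | now apply cder_slit_log].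
  - unfold dG, G, upper_power. cbv beta. fold (Z x). ring.
Qed.

Lemma power_curve_derive_continuous (x : R) : continuous dG x.
Proof.
  assert (HG := cder_continuous _ _ _ (power_curve_derive x)).
  apply continuous_Cmult; [|exact HG]. apply continuous_Cmult; [apply continuous_const|].
  apply (continuous_Cinv Z); [|apply line_neq_0].
  apply continuous_C; cbn; split; [apply continuous_id | apply continuous_const].
Qed.

Lemma power_curve_derive_neq_0 (x : R) : dG x <> 0%C.
Proof.
  apply Cmult_neq_0; [apply Cmult_neq_0|apply cexp_neq_0].
  - intros E. apply RtoC_inj in E. lra.
  - intros E. apply (line_neq_0 x). assert (K := Cinv_r (Z x) (line_neq_0 x)). rewrite E, Cmult_0_r in K.
    injection K. lra.
Qed.

Lemma cis_unit_direction (w : C) : cexp w = (RtoC (Cmod (cexp w)) * cis (snd w))%C.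
Proof. rewrite Cmod_cexp, <- cexp_real_plus. now destruct w. Qed.

Lemma power_curve_direction (x : R) :
  (RtoC (- / Cmod (dG x)) * dG x)%C = cis ((a - 1) * snd (slit_log (Z x)) + PI).
Proof.
  (* The derivative [a z^(a-1)] written as a single exponential, so that its argument is read off
     from the exponent; the minus sign of the leftward motion contributes [PI]. *)
  set (w := (RtoC (ln a) - slit_log (Z x) + RtoC a * slit_log (Z x))%C).
  assert (Ew : dG x = cexp w).
  { unfold w. rewrite cexp_plus, cexp_minus, cexp_slit_log by (left; cbn; lra).
    unfold dG, G, upper_power. f_equal. unfold Cdiv. f_equal.
    unfold cexp, RtoC; cbn. rewrite cos_0, sin_0, exp_ln by exact Ha. f_equal; ring. }
  rewrite Ew. rewrite (cis_unit_direction w) at 2. rewrite Cmod_cexp.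
  pose proof (exp_pos (fst w)).
  rewrite Cmult_assoc, <- RtoC_mult. replace (- / exp (fst w) * exp (fst w)) with (-1) by (field; lra).
  assert (Es : snd w = (a - 1) * snd (slit_log (Z x))) by (unfold w; cbn; ring).
  rewrite Es. unfold cis. rewrite neg_cos, neg_sin. unfold Cmult, RtoC; cbn. f_equal; ring.
Qed.

Lemma branch_arg_lim : is_lim (fun x => M0_arg (power_branch a (x, y))) p_infty 0.
Proof.
  apply is_lim_spec. intros eps. pose proof PI_RGT_0. pose proof (cond_pos eps) as Heps.
  set (d := Rmin (eps / (2 * a)) (PI / 4)).
  assert (Hd : 0 < d). { unfold d. apply Rmin_glb_lt; [apply Rdiv_lt_0_compat|]; lra. }
  assert (d <= eps / (2 * a)) by apply Rmin_l. assert (d <= PI / 4) by apply Rmin_r.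
  exists (y * tan (PI / 2 - d)). intros x Hx. unfold M0_arg, power_branch; cbn [snd]. rewrite arg_slit_log by exact Hy.
  assert (Hlt : PI / 2 - d < atan (x / y)).
  { rewrite <- (atan_tan (PI / 2 - d)) by lra. apply atan_increasing.
    apply (Rmult_lt_reg_l y); [exact Hy|]. replace (y * (x / y)) with x by (field; lra). exact Hx. }
  pose proof (atan_bound (x / y)). rewrite Rminus_0_r.
  rewrite Rabs_pos_eq by (apply Rmult_le_pos; lra).
  apply Rle_lt_trans with (a * (eps / (2 * a))); [apply Rmult_le_compat_l; lra|].
  replace (a * (eps / (2 * a))) with (eps / 2) by (field; lra). lra.
Qed.

End PowerCurve.

Theorem proposition12 (rho T : R) (gamma : R -> C) (S : Rbar) (eta : R -> C)
  (hrho : rho < -2)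
  (hgamma : whole_plane_sle0 rho T 0 gamma)
  (heta : arclength_parametrization T gamma S eta) :
  (exists etat : R -> R * R,
     is_lift S eta etat /\
     is_lim (fun u => M0_arg (etat u)) m_infty 0 /\
     is_flow_line (sle0_field rho) S etat) /\
  (exists (y0 : R) (x0 : Rbar) (branch : C -> R * R),
     0 < y0 /\
     Rbar_lt x0 p_infty /\
     is_power_branch (- (4 / (2 + rho))) upper_half_plane branch /\
     is_lim (fun x => M0_arg (branch (x, y0))) p_infty 0 /\
     forall z : C,
       (exists u : R, Rbar_lt u S /\ eta u = z) <->
       (exists x : R, Rbar_lt x0 x /\ M0_proj (branch (x, y0)) = z)).
Proof.
  destruct hgamma as [Hgc [g HW]].
  set (b := - (rho + 2) / 4). assert (Hb : 0 < b) by (unfold b; lra).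
  assert (Hcurve := curve_eq rho T gamma hrho Hgc g HW). fold b in Hcurve.
  set (a := / b) in *. assert (Ha : 0 < a) by (unfold a; now apply Rinv_0_lt_compat).
  assert (Eab : - (4 / (2 + rho)) = a) by (unfold a, b; field; lra).
  destruct (tip_im b T Hb) as [y0 [Hy0 Htip_im]].
  set (X := fun t => fst (tip b T t)).
  assert (HX : forall t, t < T -> tip b T t = (X t, y0)).
  { intros t Ht. rewrite <- (Htip_im t Ht). apply surjective_pairing. }
  assert (HXdecr : forall t u, t < u -> u < T -> X u < X t) by (intros; now apply tip_re_decr).
  assert (HXcont : forall t, t < T -> continuous X t).
  { intros t Ht. assert (K := tip_continuous b T Hb t Ht). apply continuous_C in K. apply K. }
  assert (HXlim : forall M, exists t0, t0 < T /\ forall t, t < t0 -> M < X t) by exact (tip_re_lim b T Hb).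
  clearbody X.
  set (G := fun x : R => upper_power a (x, y0)).
  assert (HgG : forall t, t < T -> gamma t = G (X t)).
  { intros t Ht. rewrite Hcurve, HX by exact Ht. reflexivity. }
  destruct heta as [(s & Hs_mono & Hs_surj & Hs_eta) Hlen].
  (* [s] is only assumed monotone. If it were constant on [[t, t']], the power would agree at three
     distinct abscissae, while a value determines the abscissa up to sign. *)
  assert (Hs_inj : forall t t', t < t' -> t' < T -> s t < s t').
  { intros t t' Htt Ht'. destruct (Hs_mono t t' ltac:(lra) Ht') as [|E]; [assumption | exfalso].
    set (m := (t + t') / 2). assert (Hm : t < m < t') by (unfold m; lra).
    assert (Em : s m = s t).
    { pose proof (Hs_mono t m ltac:(lra) ltac:(lra)). pose proof (Hs_mono m t' ltac:(lra) Ht'). lra. }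
    assert (Ec : forall r, r < T -> s r = s t -> G (X t) = G (X r)).
    { intros r Hr Er. rewrite <- !HgG, !Hs_eta by lra. now rewrite Er. }
    pose proof (HXdecr t m ltac:(lra) ltac:(lra)). pose proof (HXdecr m t' ltac:(lra) Ht').
    destruct (upper_power_abs a _ _ y0 Ha Hy0 (Ec m ltac:(lra) Em));
    destruct (upper_power_abs a _ _ y0 Ha Hy0 (Ec t' Ht' ltac:(lra))); lra. }
  assert (Hinv : forall u, exists t, Rbar_lt (Finite u) S -> t < T /\ s t = u).
  { intros u. destruct (classic (Rbar_lt u S)) as [L|L]; [|exists 0; tauto].
    destruct (proj1 (Hs_surj u) L) as [t Ht]. now exists t. }
  (* The time at which the arc-length parameter is [u], by choice; for [u] beyond [S] it has no
     meaning. *)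
  set (tt := fun u => proj1_sig (constructive_indefinite_description _ (Hinv u))).
  assert (Htt : forall u : R, Rbar_lt u S -> tt u < T /\ s (tt u) = u).
  { intros u. exact (proj2_sig (constructive_indefinite_description _ (Hinv u))). }
  assert (HsS : forall t, t < T -> Rbar_lt (s t) S) by (intros t Ht; apply Hs_surj; now exists t).
  assert (Htt_mono : forall u v : R, u < v -> Rbar_lt v S -> tt u < tt v).
  { intros u v Huv Hv. assert (Hu : Rbar_lt u S) by (apply (Rbar_lt_le_fin S u v); [lra | exact Hv]).
    destruct (Htt u Hu) as [H1 H2]. destruct (Htt v Hv) as [H3 H4].
    apply Rnot_le_lt. intros L. pose proof (Hs_mono _ _ L H1). lra. }
  set (chi := fun u => X (tt u)).
  assert (Heta : forall u : R, Rbar_lt u S -> eta u = G (chi u)).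
  { intros u Hu. destruct (Htt u Hu) as [H1 H2]. rewrite <- H2 at 1. rewrite <- Hs_eta by exact H1. exact (HgG _ H1). }
  assert (Hchi : forall u v : R, u < v -> Rbar_lt v S -> chi v < chi u).
  { intros u v Huv Hv. exact (HXdecr _ _ (Htt_mono u v Huv Hv) (proj1 (Htt v Hv))). }
  assert (Hchi_s : forall v t : R, v < s t -> t < T -> X t < chi v).
  { intros v t Hv Ht. assert (HvS : Rbar_lt v S) by (apply (Rbar_lt_le_fin S v (s t)); [lra | now apply HsS]).
    destruct (Htt v HvS) as [H1 H2]. apply HXdecr; [|exact Ht].
    apply Rnot_le_lt. intros L. pose proof (Hs_mono _ _ L H1). lra. }
  assert (Hchi_s' : forall v t : R, s t < v -> Rbar_lt v S -> t < T -> chi v < X t).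
  { intros v t Hv HvS Ht. destruct (Htt v HvS) as [H1 H2]. apply HXdecr; [|exact H1].
    apply Rnot_le_lt. intros L. pose proof (Hs_mono _ _ L Ht). lra. }
  assert (Hchi_cont : forall u : R, Rbar_lt u S -> continuous chi u).
  { intros u Hu. destruct (Htt u Hu) as [H1 H2]. apply continuous_R. intros eps.
    destruct (continuous_close _ _ _ (HXcont _ H1) (cond_pos eps)) as [d [Hd0 Hd]].
    (* Strict monotonicity of [s] places [u] strictly between [s t1] and [s t2], so for [v] near [u]
       the value [chi v] is squeezed between [X t2] and [X t1]. The midpoint with [T] keeps [t2]
       below [T]. *)
    set (t1 := tt u - d / 2). set (t2 := Rmin (tt u + d / 2) ((tt u + T) / 2)).
    assert (tt u < t2) by (unfold t2; apply Rmin_glb_lt; lra).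
    assert (t2 <= tt u + d / 2) by apply Rmin_l. assert (t2 <= (tt u + T) / 2) by apply Rmin_r.
    assert (Ht2 : t2 < T) by lra. assert (Ht1 : t1 < tt u) by (unfold t1; lra).
    assert (D1 := Hd t1 ltac:(apply Rabs_def1; unfold t1; lra)).
    assert (D2 := Hd t2 ltac:(apply Rabs_def1; lra)).
    apply Rabs_def2 in D1. apply Rabs_def2 in D2.
    assert (S1 : s t1 < u) by (rewrite <- H2; apply Hs_inj; lra).
    assert (S2 : u < s t2) by (rewrite <- H2 at 1; apply Hs_inj; lra).
    assert (Hr : 0 < Rmin (u - s t1) (s t2 - u)) by (apply Rmin_glb_lt; lra).
    exists (mkposreal _ Hr). intros v Hv. change (Rabs (v - u) < Rmin (u - s t1) (s t2 - u)) in Hv.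
    assert (Rmin (u - s t1) (s t2 - u) <= u - s t1) by apply Rmin_l.
    assert (Rmin (u - s t1) (s t2 - u) <= s t2 - u) by apply Rmin_r.
    apply Rabs_def2 in Hv.
    assert (C1 := Hchi_s v t2 ltac:(lra) Ht2).
    assert (C2 := Hchi_s' v t1 ltac:(lra) ltac:(apply (Rbar_lt_le_fin S v (s t2)); [lra | now apply HsS]) ltac:(lra)).
    unfold chi at 2. apply Rabs_def1; lra. }
  assert (Hchi_der : forall u : R, Rbar_lt u S -> is_derive chi u
    (- / Cmod (RtoC a * (/ (chi u, y0)) * upper_power a (chi u, y0))%C)).
  { intros u Hu. apply (arclength_derivative G (fun x => (RtoC a * (/ (x, y0)) * upper_power a (x, y0))%C) S eta chi); auto.
    - intros x. now apply power_curve_derive.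
    - intros x. now apply power_curve_derive_continuous.
    - now apply power_curve_derive_neq_0. }
  set (etat := fun u => power_branch a (chi u, y0)).
  assert (Hpair_cont : forall u : R, Rbar_lt u S -> continuous (fun u => (chi u, y0) : C) u).
  { intros u Hu. apply continuous_C; cbn; split; [now apply Hchi_cont | apply continuous_const]. }
  assert (Hlog_cont : forall u : R, Rbar_lt u S -> continuous (fun u => slit_log (chi u, y0)) u).
  { intros u Hu. apply (continuous_slit_log (fun u => (chi u, y0) : C)); [left; cbn; lra | now apply Hpair_cont]. }
  assert (Harg_cont : forall u : R, Rbar_lt u S -> continuous (fun u => snd (etat u)) u).
  { intros u Hu. unfold etat, power_branch; cbn [snd]. apply continuous_Rmult; [apply continuous_const|].
    assert (K := Hlog_cont u Hu). apply continuous_C in K. apply K. }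
  assert (Hetat_cont : forall u : R, Rbar_lt u S -> continuous etat u).
  { intros u Hu. apply (proj2 (continuous_C etat u)). split; [|now apply Harg_cont].
    unfold etat, power_branch, Rpower; cbn [fst].
    assert (Hp : 0 < Cmod (chi u, y0)) by (apply Cmod_gt_0_snd; cbn; lra).
    apply (continuous_derivable_comp (fun r => exp (a * ln r)) (fun u => Cmod (chi u, y0))).
    - auto_derive. exact Hp.
    - apply continuous_Cmod. now apply Hpair_cont. }
  assert (HM0 : forall u, M0 (etat u)) by (intros u; apply exp_pos).
  assert (Hproj : forall u : R, M0_proj (etat u) = G (chi u)).
  { intros u. apply proj_branch. exact Hy0. }
  split.
  - exists etat. split; [|split].
    + intros u Hu. split; [apply HM0|]. split; [now apply Hetat_cont|].
      rewrite Hproj. symmetry. exact (Heta u Hu).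
    + apply is_lim_spec. intros eps.
      destruct (proj2 (is_lim_spec _ _ _) (branch_arg_lim a y0 Ha Hy0) eps) as [M HM].
      destruct (HXlim M) as [t0 [Ht0 HM0']].
      exists (s (t0 - 1)). intros u Hu. apply HM.
      eapply Rlt_trans; [apply (HM0' (t0 - 1)); lra|]. apply (Hchi_s u (t0 - 1)); lra.
    + exists (fun u => cis (sle0_field rho (etat u))). intros u Hu.
      split; [apply HM0|]. split; [now apply Hetat_cont|]. split; [|split; [|split]].
      * apply cder_iff. eapply cder_ext_loc; [apply filter_forall; intros v; symmetry; apply Hproj|].
        eapply cder_eq.
        -- apply (cder_comp G chi u _ _ (power_curve_derive a y0 Hy0 (chi u)) (Hchi_der u Hu)).
        -- rewrite (power_curve_direction a y0 Ha Hy0 (chi u)). f_equal.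
           unfold sle0_field, M0_arg, etat, power_branch; cbn [snd].
           (* The field is evaluated at the argument [a th] of the lifted curve, where [th] is the
              argument on the line; since [a b = 1], [(1 - b) a th = (a - 1) th] is the direction
              already computed. *)
           replace ((6 + rho) / 4) with (1 - b) by (unfold b; field).
           assert (Hba : b * a = 1) by (unfold a; field; lra).
           set (th := snd (slit_log (chi u, y0))). 
           replace ((1 - b) * (a * th)) with (a * th - (b * a) * th) by ring. rewrite Hba. ring.
      * apply continuous_cis. unfold sle0_field, M0_arg.
        apply continuous_Rplus; [|apply continuous_const].
        apply continuous_Rmult; [apply continuous_const | now apply Harg_cont].
      * apply Cmod_cis.
      * reflexivity.
  (* The infimum in the extended reals covers both a finite left end and the whole line, where it is
     [-oo]. *)
  - set (x0 := Glb_Rbar (fun x => exists t, t < T /\ X t = x)).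
    destruct (Glb_Rbar_correct (fun x => exists t, t < T /\ X t = x)) as [Hlb Hglb]. fold x0 in Hlb, Hglb.
    assert (Hx0 : forall x : R, Rbar_lt x0 x <-> exists t, t < T /\ X t = x).
    { intros x. split.
      - intros Hx. assert (exists t, t < T /\ X t < x) as [t [Ht Hlt]].
        { apply NNPP. intros N. apply (Rbar_lt_not_le _ _ Hx). apply Hglb.
          intros x' (t & Ht & <-). cbn. apply Rnot_lt_le. intros L. apply N. eauto. }
        destruct (HXlim x) as [t0 [Ht0 Hbig]].
        set (t1 := Rmin (t0 - 1) t). assert (t1 <= t0 - 1) by apply Rmin_l. assert (t1 <= t) by apply Rmin_r.
        specialize (Hbig t1 ltac:(lra)).
        destruct (ivt_closed X t1 t x) as [t' [Ht' E]]; [lra | | right; lra |].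
        + intros r Hr. apply HXcont. lra.
        + exists t'. split; [lra | exact E].
      (* The infimum is not attained: the later time [(t + T) / 2] gives a strictly smaller
         abscissa, whence the strict inequality. *)
      - intros (t & Ht & <-). apply Rbar_le_lt_trans with (X ((t + T) / 2)).
        + apply Hlb. exists ((t + T) / 2). split; [lra | reflexivity].
        + cbn. apply HXdecr; lra. }
    exists y0, x0, (power_branch a). rewrite Eab. split; [exact Hy0|]. split; [|split; [|split]].
    + apply Rbar_lt_trans with (X (T - 1)); [|exact I]. apply Hx0. exists (T - 1). split; [lra | reflexivity].
    + apply branch_is_power_branch.
    + now apply branch_arg_lim.
    + intros z. split.
      * intros (u & Hu & <-). destruct (Htt u Hu) as [H1 _]. exists (chi u). split.
        -- apply Hx0. now exists (tt u).
        -- rewrite proj_branch by exact Hy0. symmetry. exact (Heta u Hu).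
      * intros (x & Hx & <-). apply Hx0 in Hx. destruct Hx as (t & Ht & <-).
        exists (s t). split; [now apply HsS|]. rewrite <- Hs_eta by exact Ht.
        rewrite proj_branch by exact Hy0. exact (HgG t Ht).
Qed.
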